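(* Consider the estimators $\hat\psi^{\mathrm{INT}}_{k_1,k_2}$, $\hat\psi^{\mathrm{MC}}_{k_1,k_2}$, $\hat\psi^{\mathrm{IF}}_{k_1,k_2}$ without sample splitting of $\psi(\mathbb P)=\mathbb E_{\mathbb P}[\mathrm{Cov}_{\mathbb P}(A,Y\mid X)]$ over $\mathcal P_{(\alpha,\beta)}$ defined in the context, and write $k_{\min}=k_1\wedge k_2$, $k_{\max}=k_1\vee k_2$. If $\frac{\alpha+\beta}2\ge\frac d2$, then (1) $\hat\psi^{\mathrm{INT}}_{k_1,k_2}$ is minimax rate optimal when choosing $n^{\frac d{2\alpha+2\beta}}\lesssim k_{\min}\lesssim\sqrt n$; (2) $\hat\psi^{\mathrm{MC}}_{k_1,k_2}$ is minimax rate optimal when choosing $n^{\frac d{2\alpha+2\beta}}\lesssim k_{\min}$ and $k_{\max}\lesssim\sqrt n$; (3) $\hat\psi^{\mathrm{IF}}_{k_1,k_2}$ is minimax rate optimal when choosing $n^{\frac d{2\alpha+2\beta}}\lesssim k_{\max}\lesssim\sqrt n$. If $\frac{\alpha+\beta}2<\frac d2$, then $\hat\psi^{\mathrm{INT}}_{k_1,k_2}$, $\hat\psi^{\mathrm{MC}}_{k_1,k_2}$ and $\hat\psi^{\mathrm{IF}}_{k_1,k_2}$ cannot be minimax rate optimal for any choice of $k_1,k_2$. The best rate of estimation of $\psi(\mathbb P)$ for each of these estimators is $n^{-\frac{2\alpha+2\beta}{\alpha+\beta+d}}$. Further, (1) the best rate for $\hat\psi^{\mathrm{INT}}_{k_1,k_2}$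 occurs when choosing $k_{\min}\asymp n^{\frac d{\alpha+\beta+d}}$; (2) the best rate for $\hat\psi^{\mathrm{MC}}_{k_1,k_2}$ occurs when choosing $k_{\min}\asymp k_{\max}\asymp n^{\frac d{\alpha+\beta+d}}$; (3) the best rate for $\hat\psi^{\mathrm{IF}}_{k_1,k_2}$ occurs when choosing $k_{\max}\asymp n^{\frac d{\alpha+\beta+d}}$.
   Context: Notation. $a\vee b=\max(a,b)$, $a\wedge b=\min(a,b)$; integrals are over $[0,1]^d$. For nonnegative sequences, $a_n\lesssim b_n$ means there is a constant $C>0$ with $a_n\le Cb_n$ for all $n\ge n_0$; $a_n\gtrsim b_n$ means $b_n\lesssim a_n$; $a_n\asymp b_n$ means both. Resolutions $k_1,k_2$ are sequences that may depend on $n$. Wavelets. Fix a compactly supported Cohen–Daubechies–Vial type orthonormal wavelet basis $\{\Phi_{J_0m},\Psi^{\iota}_{lm'}: m\in\mathcal Z_{J_0},\,m'\in\mathcal Z_l,\,\iota\in\{0,1\}^d\setminus\{0\},\,l\ge J_0\}$ of $L^2([0,1]^d)$ of regularity $S\ge1$, $S>\alpha\vee\beta$, with $2^{J_0}\ge S$, $|\mathcal Z_l|\asymp 2^{ld}$. For $j\ge J_0$ let $V_j=\mathrm{span}\{\Phi_{jm}:m\in\mathcal Z_j\}$ ($\{\Phi_{jm}\}_m$ the orthonormal scaling functions at level $j$; the $V_j$ are nested). A resolution is a number $k=2^{jd}$, $j\ge J_0$; write $V_k,\Phi_{km},\mathcal Z_k$ for $V_j,\Phi_{jm},\mathcal Z_j$.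 Standard properties: $|\Phi_{km}|\lesssim\sqrt k$ uniformly with support in a set of Lebesgue measure $O(1/k)$; $V_k$ contains all polynomials of degree at most $S-1$. The projection kernel is $K_{V_k}(x,y)=\sum_{m\in\mathcal Z_k}\Phi_{km}(x)\Phi_{km}(y)$. Hölder ball. $H(\alpha,M)$ is the set of uniformly continuous $h:[0,1]^d\to\mathbb R$ with $2^{J_0(\alpha+d/2)}\max_m|\langle h,\Phi_{J_0m}\rangle|+\sup_{l\ge J_0,m\in\mathcal Z_l,\iota}2^{l(\alpha+d/2)}|\langle h,\Psi^\iota_{lm}\rangle|\le M$. Model. $\mathcal P_{(\alpha,\beta)}$ is the set of distributions $\mathbb P$ of $(X,A,Y)\in[0,1]^d\times\mathbb R\times\mathbb R$ with $X\sim\mathrm{Uniform}([0,1]^d)$, $A,Y\in[C_1,C_2]$ a.s., $p(x):=\mathbb E_{\mathbb P}[A\mid X=x]\in H(\alpha,M)$ and $b(x):=\mathbb E_{\mathbb P}[Y\mid X=x]\in H(\beta,M)$, where $C_1,C_2\in\mathbb R$, $\alpha,\beta,M>0$ are fixed known constants. The functional is $\psi(\mathbb P)=\mathbb E_{\mathbb P}[\mathrm{Cov}_{\mathbb P}(A,Y\mid X)]$. Estimators. Let $\mathcal D_1$ be a sample of $n$ i.i.d. observations from $\mathbb P$. Put $\hat p_k(x)=\frac1n\sum_{i\in\mathcal D_1}A_iK_{V_k}(X_i,x)$ and $\hat b_k(x)=\frac1n\sum_{i\in\mathcal D_1}Y_iK_{V_k}(X_i,x)$. Without sample splitting: $\hat\psi^{\mathrm{INT}}_{k_1,k_2}=\frac1n\sum_{i\in\mathcal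 D_1}A_iY_i-\int\hat p_{k_1}(x)\hat b_{k_2}(x)\,dx$; $\hat\psi^{\mathrm{MC}}_{k_1,k_2}=\frac1n\sum_{i\in\mathcal D_1}A_iY_i-\frac1n\sum_{i\in\mathcal D_1}\hat p_{k_1}(X_i)\hat b_{k_2}(X_i)$; $\hat\psi^{\mathrm{IF}}_{k_1,k_2}=\frac1n\sum_{i\in\mathcal D_1}(A_i-\hat p_{k_1}(X_i))(Y_i-\hat b_{k_2}(X_i))$. Rates. The (known) minimax rate for squared error over $\mathcal P_{(\alpha,\beta)}$ is $r_n^*=n^{-1}$ if $\frac{\alpha+\beta}2\ge\frac d4$ and $r_n^*=n^{-\frac{4\alpha+4\beta}{2\alpha+2\beta+d}}$ if $\frac{\alpha+\beta}2<\frac d4$. For an estimator $\hat\psi$ with given resolution sequences let $R_n=\sup_{\mathbb P\in\mathcal P_{(\alpha,\beta)}}\mathbb E_{\mathbb P}[(\hat\psi-\psi(\mathbb P))^2]$. The estimator is minimax rate optimal for a choice of resolutions if $R_n\lesssim r_n^*$. Its best rate is $r_n$ if some choice of resolutions gives $R_n\lesssim r_n$ while every choice gives $R_n\gtrsim r_n$; the best rate ''occurs when choosing'' certain resolutions if these give $R_n\lesssim r_n$.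
   Formalization: For (α+β)/2 < d/2, non-optimality and the best-rate claims assume C1 < C2 and that the class with some radius M' < M is nonempty; without this they fail, e.g. C1 = C2 = 0 makes every estimator exactly 0 with zero risk. *)

(* Defs.v *)
From HB Require Import structures.
From mathcomp Require Import all_boot all_order all_algebra.
From mathcomp Require Import all_classical all_reals all_analysis.

Set Implicit Arguments.
Unset Strict Implicit.
Unset Printing Implicit Defensive.

Import Order.TTheory GRing.Theory Num.Theory.
Import numFieldNormedType.Exports.

Local Open Scope classical_set_scope.
Local Open Scope ring_scope.

Section power_measure.
Context {disp : measure_display} {T : measurableType disp} {R : realType}.

Definition cons_tuple n (p : T * n.-tuple T) : n.+1.-tuple T :=
  [the n.+1.-tuple T of p.1 :: p.2].

Lemma measurable_cons_tuple n : measurable_fun setT (@cons_tuple n).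
Proof. exact: measurable_cons. Qed.

HB.instance Definition _ n :=
  isMeasurableFun.Build _ _ _ _ (@cons_tuple n) (@measurable_cons_tuple n).

(* The n-fold product of P with itself: the law of n i.i.d. draws from P.     *)
Fixpoint iid (P : probability T R) n : probability (n.-tuple T) R :=
  match n with
  | 0 => \d_([tuple] : 0.-tuple T)
  | n'.+1 => distribution (P \x iid P n')%E (@cons_tuple n')
  end.

End power_measure.

Section asymptotics.
Context {R : realType}.

(* Sequences live in \bar R because a supremum of risks is a priori extended. *)
Definition lesssim (u v : nat -> \bar R) :=
  exists2 C : R, 0 < C &
  exists n0 : nat, forall n : nat, (n0 <= n)%N -> (u n <= C%:E * v n)%E.

Definition rlesssim (u v : nat -> R) := lesssim (EFin \o u) (EFin \o v).

Definition rasymp (u v : nat -> R) := rlesssim u v /\ rlesssim v u.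

End asymptotics.

Section cube.
Context {R : realType} {d : nat}.

Definition cube : set (d.-tuple R) :=
  [set x | forall i : 'I_d, 0 <= tnth x i <= 1].

(* uniform_prob lives on measurableTypeR R, which carries the same            *)
(* sigma-algebra as R under another display.                                  *)
Definition id_measurableTypeR : measurableTypeR R -> R := idfun.

HB.instance Definition _ :=
  @isMeasurableFun.Build _ _ _ _ id_measurableTypeR (@measurable_id _ _ setT).

Definition unif01 : probability R R :=
  distribution (uniform_prob (@ltr01 R)) id_measurableTypeR.

(* The uniform law on [0,1]^d is Lebesgue measure restricted to the cube, so  *)
(* an integral over [0,1]^d is an integral against unif.                      *)
Definition unif : probability (d.-tuple R) R := iid unif01 d.

Definition inner (f g : d.-tuple R -> R) : R := \int[unif]_x (f x * g x).

Definition unif_continuous_on_cube (f : d.-tuple R -> R) :=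
  forall e : R, 0 < e -> exists2 r : R, 0 < r &
    forall x y : d.-tuple R, cube x -> cube y ->
      (forall i, `|tnth x i - tnth y i| < r) -> `|f x - f y| < e.

Definition upd (x : d.-tuple R) (i : 'I_d) (t : R) : d.-tuple R :=
  [tuple if k == i then t else tnth x k | k < d].

Definition partial (i : 'I_d) (f : d.-tuple R -> R) (x : d.-tuple R) : R :=
  derive1 (fun t : R => f (upd x i t)) (tnth x i).

Definition partials (s : seq 'I_d) (f : d.-tuple R -> R) : d.-tuple R -> R :=
  foldr partial f s.

Definition continuous_at_point (f : d.-tuple R -> R) (x : d.-tuple R) :=
  forall e : R, 0 < e -> exists2 r : R, 0 < r &
    forall y, (forall i, `|tnth x i - tnth y i| < r) -> `|f x - f y| < e.

(* f is of class C^S on R^d.                                                  *)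
Definition class_C (S : nat) (f : d.-tuple R -> R) :=
  (forall (s : seq 'I_d) (i : 'I_d) (x : d.-tuple R), (size s < S)%N ->
     derivable (fun t : R => partials s f (upd x i t)) (tnth x i) 1) /\
  (forall (s : seq 'I_d) (x : d.-tuple R), (size s <= S)%N ->
     continuous_at_point (partials s f) x).

Definition lin_span (I : finType) (u : I -> d.-tuple R -> R) :
    set (d.-tuple R -> R) :=
  [set f | exists c : I -> R, f = fun x => \sum_(i : I) c i * u i x].

End cube.

(* {0,1}^d \ {0}                                                              *)
Definition wtype (d : nat) :=
  {iota : {ffun 'I_d -> bool} | iota != [ffun => false]}.

(* Functions on the cube are represented by functions on R^d.                 *)
Record wavelets (R : realType) (d : nat) := Wavelets {
  base_level : nat ;                                    (* J_0 *)
  regularity : nat ;                                    (* S *)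
  loc : nat -> finType ;                                (* Z_j *)
  Phi : forall j, loc j -> d.-tuple R -> R ;
  Psi : forall l, wtype d -> loc l -> d.-tuple R -> R }.

Section wavelets.
Context {R : realType} {d : nat}.

(* Smoothness S and compact support at scale 2^-j, uniformly over the family. *)
Definition local_regular (J0 S : nat) (I : nat -> finType)
    (u : forall j, I j -> d.-tuple R -> R) :=
  exists C : R, forall j, (J0 <= j)%N ->
  [/\ (forall i x, ~ cube x -> u j i x = 0),
      (forall i, exists a : d.-tuple R, forall x, u j i x != 0 ->
         forall k, `|tnth x k - tnth a k| <= C / 2 ^+ j),
      (forall x, #|[pred i | u j i x != 0]|%:R <= C) &
      (forall i, exists g : d.-tuple R -> R,
         [/\ class_C S g, (forall x, cube x -> u j i x = g x) &
             forall (s : seq 'I_d) x, (size s <= S)%N -> cube x ->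
               `|partials s g x| <=
                 C * 2 `^ (j%:R * (d%:R / 2 + (size s)%:R))])].

Variable W : wavelets R d.
Local Notation J0 := (base_level W).
Local Notation S := (regularity W).

Definition Psi_pair l (im : (wtype d * loc W l)%type) := Psi im.1 im.2.

Definition Vspace (j : nat) := lin_span (@Phi _ _ W j).
Definition Wspace (l : nat) := lin_span (@Psi_pair l).

(* The defining properties of a compactly supported Cohen-Daubechies-Vial     *)
(* type orthonormal wavelet basis of L^2([0,1]^d) of regularity S.            *)
Record cdv_basis : Prop := CDVBasis {
  cdv_regularity : (1 <= S <= 2 ^ J0)%N ;
  cdv_card : exists2 c : R, 0 < c & forall l, (J0 <= l)%N ->
    c^-1 * (2 ^ (l * d))%:R <= #|loc W l|%:R <= c * (2 ^ (l * d))%:R ;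
  cdv_Phi_regular : local_regular J0 S (@Phi _ _ W) ;
  cdv_Psi_regular : @local_regular J0 S
    (fun l => (wtype d * loc W l)%type) Psi_pair ;
  cdv_Phi_orthonormal : forall j, (J0 <= j)%N -> forall m m' : loc W j,
    inner (Phi m) (Phi m') = (m == m')%:R ;
  cdv_Psi_orthonormal : forall l, (J0 <= l)%N -> forall p q,
    inner (@Psi_pair l p) (@Psi_pair l q) = (p == q)%:R ;
  cdv_Psi_orthogonal : forall l l', (J0 <= l)%N -> (J0 <= l')%N -> l != l' ->
    forall p q, inner (@Psi_pair l p) (@Psi_pair l' q) = 0 ;
  cdv_Phi_Psi_orthogonal : forall l, (J0 <= l)%N ->
    forall (m : loc W J0) p, inner (Phi m) (@Psi_pair l p) = 0 ;
  cdv_total : forall f, f \in Lfun (@unif R d) 2%:E ->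
    forall e : R, 0 < e ->
    exists (L : nat) (a : loc W J0 -> R)
           (b : forall l, (wtype d * loc W l)%type -> R),
    \int[unif]_x (f x - \sum_m a m * Phi m x
       - \sum_(J0 <= l < L) \sum_p b l p * @Psi_pair l p x) ^+ 2 < e ;
  (* multiresolution: V_{j+1} = V_j + W_j; in particular the V_j are nested *)
  cdv_multiresolution : forall j, (J0 <= j)%N ->
    Vspace j.+1 =
      [set (fun x => g x + h x) | g in Vspace j & h in Wspace j] ;
  cdv_polynomials : forall j, (J0 <= j)%N ->
    forall e : {ffun 'I_d -> nat}, (\sum_i e i <= S.-1)%N ->
    exists2 g, Vspace j g &
      forall x, cube x -> \prod_(i < d) tnth x i ^+ e i = g x }.

Definition proj_kernel (j : nat) (x y : d.-tuple R) : R :=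
  \sum_(m : loc W j) Phi m x * Phi m y.

Definition holder_norm (a : R) (h : d.-tuple R -> R) : \bar R :=
  ((2 `^ (J0%:R * (a + d%:R / 2)) *
    \big[Num.max/0]_(m : loc W J0) `|inner h (Phi m)|)%:E +
  ereal_sup [set y | exists l (iota : wtype d) (m : loc W l), (J0 <= l)%N /\
    y = (2 `^ (l%:R * (a + d%:R / 2)) * `|inner h (Psi iota m)|)%:E])%E.

Definition holder_ball (a M : R) : set (d.-tuple R -> R) :=
  [set h | unif_continuous_on_cube h /\ (holder_norm a h <= M%:E)%E].

End wavelets.

Definition resolution (d j : nat) : nat := (2 ^ (j * d))%N.

Definition k_min (R : realType) (d : nat) (j1 j2 : nat -> nat) (n : nat) : R :=
  (minn (resolution d (j1 n)) (resolution d (j2 n)))%:R.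

Definition k_max (R : realType) (d : nat) (j1 j2 : nat -> nat) (n : nat) : R :=
  (maxn (resolution d (j1 n)) (resolution d (j2 n)))%:R.

Section model.
Context {R : realType} {d : nat}.
Local Notation obs := (d.-tuple R * R * R)%type.

Definition obsX (o : obs) : d.-tuple R := o.1.1.
Definition obsA (o : obs) : R := o.1.2.
Definition obsY (o : obs) : R := o.2.

(* g is a version of x |-> E_P[V | X = x].                                    *)
Definition is_condE (P : probability obs R) (V : obs -> R)
    (g : d.-tuple R -> R) :=
  [/\ measurable_fun setT g,
      P.-integrable setT (EFin \o V),
      P.-integrable setT (EFin \o (g \o obsX)) &
      forall B, measurable B ->
        \int[P]_(o in obsX @^-1` B) V o =
        \int[P]_(o in obsX @^-1` B) g (obsX o)].

Definition condE (P : probability obs R) (V : obs -> R) : d.-tuple R -> R :=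
  xget (fun=> 0) [set g | is_condE P V g].

Definition condCov (P : probability obs R) (U V : obs -> R) : d.-tuple R -> R :=
  fun x => condE P (fun o => U o * V o) x - condE P U x * condE P V x.

Definition psi (P : probability obs R) : R :=
  \int[P]_o condCov P obsA obsY (obsX o).

Variable W : wavelets R d.

Definition in_model (C1 C2 alpha beta M : R) (P : probability obs R) : Prop :=
  [/\ (forall B, measurable B -> P (obsX @^-1` B) = unif B),
      {ae P, forall o, C1 <= obsA o <= C2},
      {ae P, forall o, C1 <= obsY o <= C2},
      (exists2 p, is_condE P obsA p & holder_ball W alpha M p) &
      (exists2 b, is_condE P obsY b & holder_ball W beta M b)].

(* If 0 is not in [C1, C2] and M is too small, the class is empty; at the     *)
(* smallest M for which it is not, A or Y may be forced to be constant.       *)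
Definition nondegenerate_class (C1 C2 alpha beta M : R) : Prop :=
  C1 < C2 /\
  exists2 M', M' < M & exists P, in_model C1 C2 alpha beta M' P.

Definition p_hat (j n : nat) (D : n.-tuple obs) (x : d.-tuple R) : R :=
  n%:R^-1 * \sum_(i < n) obsA (tnth D i) * proj_kernel W j (obsX (tnth D i)) x.

Definition b_hat (j n : nat) (D : n.-tuple obs) (x : d.-tuple R) : R :=
  n%:R^-1 * \sum_(i < n) obsY (tnth D i) * proj_kernel W j (obsX (tnth D i)) x.

(* est j1 j2 n D uses the resolutions k1 = 2^{j1 d}, k2 = 2^{j2 d}.           *)
Definition estimator := nat -> nat -> forall n, n.-tuple obs -> R.

Definition psi_INT : estimator := fun j1 j2 n D =>
  n%:R^-1 * (\sum_(i < n) obsA (tnth D i) * obsY (tnth D i)) -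
  \int[unif]_x (p_hat j1 D x * b_hat j2 D x).

Definition psi_MC : estimator := fun j1 j2 n D =>
  n%:R^-1 * (\sum_(i < n) obsA (tnth D i) * obsY (tnth D i)) -
  n%:R^-1 * (\sum_(i < n)
    p_hat j1 D (obsX (tnth D i)) * b_hat j2 D (obsX (tnth D i))).

Definition psi_IF : estimator := fun j1 j2 n D =>
  n%:R^-1 * (\sum_(i < n)
    (obsA (tnth D i) - p_hat j1 D (obsX (tnth D i))) *
    (obsY (tnth D i) - b_hat j2 D (obsX (tnth D i)))).

Definition max_risk (C1 C2 alpha beta M : R) (est : estimator)
    (j1 j2 : nat -> nat) (n : nat) : \bar R :=
  ereal_sup [set (\int[iid P n]_D ((est (j1 n) (j2 n) n D - psi P) ^+ 2)%:E)%E
            | P in in_model C1 C2 alpha beta M].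

Definition minimax_rate (alpha beta : R) (n : nat) : R :=
  if d%:R / 4 <= (alpha + beta) / 2 then n%:R^-1
  else n%:R `^ (- ((4 * alpha + 4 * beta) / (2 * alpha + 2 * beta + d%:R))).

Definition level_sequence (j : nat -> nat) : Prop :=
  forall n, (base_level W <= j n)%N.

Definition achieves (C1 C2 alpha beta M : R) (est : estimator) (r : nat -> R)
    (j1 j2 : nat -> nat) : Prop :=
  lesssim (max_risk C1 C2 alpha beta M est j1 j2) (EFin \o r).

Definition minimax_rate_optimal (C1 C2 alpha beta M : R) (est : estimator)
    (j1 j2 : nat -> nat) : Prop :=
  achieves C1 C2 alpha beta M est (minimax_rate alpha beta) j1 j2.

Definition best_rate (C1 C2 alpha beta M : R) (est : estimator)
    (r : nat -> R) : Prop :=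
  (exists j1 j2, [/\ level_sequence j1, level_sequence j2 &
     achieves C1 C2 alpha beta M est r j1 j2]) /\
  (forall j1 j2, level_sequence j1 -> level_sequence j2 ->
     lesssim (EFin \o r) (max_risk C1 C2 alpha beta M est j1 j2)).

End model.

(* Main.v *)
Require Import Defs.
From HB Require Import structures.
From mathcomp Require Import all_boot all_order all_algebra.
From mathcomp Require Import all_classical all_reals all_analysis.
From mathcomp Require Import measurable_realfun.
From mathcomp Require Import ring lra.

Set Implicit Arguments.
Unset Strict Implicit.
Unset Printing Implicit Defensive.

Import Order.TTheory GRing.Theory Num.Theory.
Import numFieldNormedType.Exports.

Local Open Scope classical_set_scope.
Local Open Scope ring_scope.

(** Write [Pn] for the empirical mean and [K] for a resolution [2^(jd)]. Let [Q_j]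
    be the sum over [m] of [Pn(A Phi_jm) Pn(Y Phi_jm)] and let [M] be the empirical
    mean of [p_hat b_hat]. Because projection kernels of nested spaces compose to
    the coarser one, the three estimators are exactly
      [INT = Pn(A Y) - Q_min],  [MC = Pn(A Y) - M],
      [IF = Pn(A Y) - Q_{j1} - Q_{j2} + M].
    A law of the class is summarised by bounded versions [p], [q] of the two
    regressions and by the conditional mean [g] of [A Y]; then
    [psi = E(A Y) - <p, q>] ([psiE]).

    Upper bounds. [Q_j] estimates the inner product of the projections of [p] and
    [q] to [V_j] with squared error of order [1/n + (K/n)^2] ([emp_quad_risk]). [M]
    is a sum of such statistics plus a product of two smoothing errors whose
    fourth moments are computed after deleting the point of evaluation
    ([cross_risk]). What remains is the approximation error, of order
    [2^(-j(alpha+beta))] by Parseval and the decay of wavelet coefficients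
    ([approximation_bias]); for [IF] the approximation errors at [j1] and [j2]
    reduce to the one at the finer level, since the inner product at the coarser
    level is also what [M] estimates and cancels.

    Lower bounds. The risk of an estimator is at least its squared bias, and the
    mean error is [B p q + L g] with [B] bilinear and [L] linear, both explicit.
    A law well inside the class can be perturbed freely in [p], [q] and [g]
    ([perturbed_laws]): the responses are two-point variables driven by one
    uniform variable, whose overlap tunes [g] independently of [p] and [q].
    Alternating signs of the perturbations [u] of [p] and [v] of [q] isolates
    [B u v], and shifting [g] isolates [L 1]
    ([interaction_le_max_risk]). Waves at the level of the projection make
    [B u v] of order [2^(-j(alpha+beta))]. Without sample splitting the diagonal
    terms contribute a bias of order [K/n]: it is seen by shifting [g] for [INT]
    and [MC], and by constant [u] and [v] for [IF]. Hence the risk is at least of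
    order [(K/n)^2 + K^(-2(alpha+beta)/d)], which is smallest at
    [K = n^(d/(alpha+beta+d))] ([lower_rate]), whereas the upper bounds are of the
    same order there. This rate is larger than the minimax one by a power of [n]
    exactly when [alpha + beta < d]; when [alpha + beta >= d] the choice
    [n^(d/(2(alpha+beta))) <= K <= n^(1/2)] makes all terms at most [1/n]. *)

(** * Bounded measurable functions *)

Lemma sqr_le_of_norm {R : realDomainType} (x B : R) :
  `|x| <= B -> x ^+ 2 <= B ^+ 2.
Proof.
move=> xB; rewrite -real_normK ?num_real// lerXn2r// nnegrE//.
exact: le_trans xB.
Qed.

(** Sign of the discriminant; both Cauchy-Schwarz inequalities below follow. *)
Lemma sqr_le_of_quadratic {R : realFieldType} (a b c : R) : 0 <= a -> 0 <= b ->
  (forall s t : R, 0 <= s ^+ 2 * a - 2 * s * t * c + t ^+ 2 * b) ->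
  c ^+ 2 <= a * b.
Proof.
move=> a0 b0 q; have [a00|an0] := eqVneq a 0.
  rewrite a00 mul0r; have := q (c * (b + 1)) (c ^+ 2); rewrite a00 mulr0 add0r.
  have -> : - (2 * (c * (b + 1)) * c ^+ 2 * c) + (c ^+ 2) ^+ 2 * b =
    - (c ^+ 2) ^+ 2 * (b + 2) by ring.
  have := sqr_ge0 (c ^+ 2); nra.
have := q c a; have agt0 : 0 < a by rewrite lt_neqAle eq_sym an0.
have -> : c ^+ 2 * a - 2 * c * a * c + a ^+ 2 * b = a * (a * b - c ^+ 2) by ring.
by rewrite pmulr_rge0// subr_ge0.
Qed.

Section bounded_measurable.
Context {disp : measure_display} {T : measurableType disp} {R : realType}.

(** Every integrand below is bounded, so that measurability and integrability
    can be propagated together. *)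
Definition bmeas (f : T -> R) :=
  measurable_fun setT f /\ exists C, forall x, `|f x| <= C.

Lemma bmeas_cst (c : R) : bmeas (fun=> c).
Proof. by split; [exact: measurable_cst | exists `|c|]. Qed.

Lemma bmeasD (f g : T -> R) : bmeas f -> bmeas g -> bmeas (fun x => f x + g x).
Proof.
move=> [mf [Cf fC]] [mg [Cg gC]]; split; first exact: measurable_funD.
by exists (Cf + Cg) => x; rewrite (le_trans (ler_normD _ _))// lerD.
Qed.

Lemma bmeasM (f g : T -> R) : bmeas f -> bmeas g -> bmeas (fun x => f x * g x).
Proof.
move=> [mf [Cf fC]] [mg [Cg gC]]; split; first exact: measurable_funM.
by exists (Cf * Cg) => x; rewrite normrM ler_pM.
Qed.

Lemma bmeasN (f : T -> R) : bmeas f -> bmeas (fun x => - f x).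
Proof.
move=> bf; under eq_fun do rewrite -mulN1r.
by apply: bmeasM => //; exact: bmeas_cst.
Qed.

Lemma bmeasB (f g : T -> R) : bmeas f -> bmeas g -> bmeas (fun x => f x - g x).
Proof. by move=> bf bg; apply: bmeasD => //; exact: bmeasN. Qed.

Lemma bmeasX (f : T -> R) k : bmeas f -> bmeas (fun x => f x ^+ k).
Proof.
move=> bf; elim: k => [|k IH]; first exact: bmeas_cst.
by under eq_fun do rewrite exprS; exact: bmeasM.
Qed.

Lemma bmeas_sum_cond (I : Type) (r : seq I) (p : pred I) (f : I -> T -> R) :
  (forall i, p i -> bmeas (f i)) -> bmeas (fun x => \sum_(i <- r | p i) f i x).
Proof.
move=> bf; elim: r => [|i r IH].
  by under eq_fun do rewrite big_nil; exact: bmeas_cst.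
under eq_fun do rewrite big_cons.
by move: (bf i); case: (p i) => // bfi; apply: bmeasD => //; exact: bfi.
Qed.

Lemma bmeas_sum (I : Type) (r : seq I) (p : pred I) (f : I -> T -> R) :
  (forall i, bmeas (f i)) -> bmeas (fun x => \sum_(i <- r | p i) f i x).
Proof. by move=> bf; exact: bmeas_sum_cond. Qed.

Lemma bmeas_norm (f : T -> R) : bmeas f -> bmeas (fun x => `|f x|).
Proof.
move=> [mf [C fC]]; split; first exact: measurableT_comp.
by exists C => x; rewrite normr_id.
Qed.

Lemma bmeas_indic (A : set T) : measurable A -> bmeas (\1_A : T -> R).
Proof.
move=> mA; split; first exact: measurable_indic.
by exists 1 => x; rewrite indicE; case: (_ \in _); rewrite ?normr1 ?normr0.
Qed.

Variable P : probability T R.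

Lemma bmeas_integrable (D : set T) (f : T -> R) :
  measurable D -> bmeas f -> P.-integrable D (EFin \o f).
Proof.
move=> mD [mf [C fC]].
apply: measurable_bounded_integrable => //.
- by rewrite (le_lt_trans (probability_le1 P mD))// ltry.
- exact: measurable_funTS.
- exists C; split; first exact: num_real.
  by move=> y Cy x _; exact: le_trans (fC x) (ltW Cy).
Qed.

Lemma EFin_Rint (f : T -> R) : bmeas f ->
  ((\int[P]_x f x)%:E = \int[P]_x (f x)%:E)%E.
Proof.
by move=> bf; rewrite /Rintegral fineK//; apply: integrable_fin_num => //;
  exact: bmeas_integrable.
Qed.

Lemma Rint_cst (c : R) : \int[P]_x c = c.
Proof. by rewrite Rintegral_cst//= probability_setT mulr1. Qed.

Lemma RintD (f g : T -> R) : bmeas f -> bmeas g ->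
  \int[P]_x (f x + g x) = \int[P]_x f x + \int[P]_x g x.
Proof. by move=> ? ?; apply: RintegralD => //; exact: bmeas_integrable. Qed.

Lemma RintB (f g : T -> R) : bmeas f -> bmeas g ->
  \int[P]_x (f x - g x) = \int[P]_x f x - \int[P]_x g x.
Proof. by move=> ? ?; apply: RintegralB => //; exact: bmeas_integrable. Qed.

Lemma RintZl (c : R) (f : T -> R) : bmeas f ->
  \int[P]_x (c * f x) = c * \int[P]_x f x.
Proof. by move=> ?; apply: RintegralZl => //; exact: bmeas_integrable. Qed.

Lemma RintZr (c : R) (f : T -> R) : bmeas f ->
  \int[P]_x (f x * c) = \int[P]_x f x * c.
Proof. by move=> ?; apply: RintegralZr => //; exact: bmeas_integrable. Qed.

Lemma Rint_sum_cond (I : Type) (r : seq I) (p : pred I) (f : I -> T -> R) :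
  (forall i, p i -> bmeas (f i)) ->
  \int[P]_x (\sum_(i <- r | p i) f i x) = \sum_(i <- r | p i) \int[P]_x f i x.
Proof.
move=> bf; elim: r => [|i r IH].
  by under eq_Rintegral do rewrite big_nil; rewrite Rint_cst big_nil.
rewrite big_cons; under eq_Rintegral do rewrite big_cons.
move: (bf i); case: (p i) => // bfi; rewrite RintD ?IH//; first exact: bfi.
exact: bmeas_sum_cond.
Qed.

Lemma Rint_sum (I : Type) (r : seq I) (p : pred I) (f : I -> T -> R) :
  (forall i, bmeas (f i)) ->
  \int[P]_x (\sum_(i <- r | p i) f i x) = \sum_(i <- r | p i) \int[P]_x f i x.
Proof. by move=> bf; exact: Rint_sum_cond. Qed.

Lemma le_Rint (f g : T -> R) : bmeas f -> bmeas g ->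
  (forall x, f x <= g x) -> \int[P]_x f x <= \int[P]_x g x.
Proof. by move=> ? ? fg; apply: le_Rintegral => //; exact: bmeas_integrable. Qed.

Lemma Rint_ge0 (f : T -> R) : (forall x, 0 <= f x) -> 0 <= \int[P]_x f x.
Proof. by move=> f0; apply: Rintegral_ge0. Qed.

Lemma Rint_le (f : T -> R) (c : R) : bmeas f -> (forall x, f x <= c) ->
  \int[P]_x f x <= c.
Proof.
by move=> bf fc; rewrite -[leRHS]Rint_cst; apply: le_Rint => //; exact: bmeas_cst.
Qed.

Lemma le_norm_Rint (f : T -> R) : bmeas f ->
  `|\int[P]_x f x| <= \int[P]_x `|f x|.
Proof. by move=> bf; apply: le_normr_Rintegral => //; exact: bmeas_integrable. Qed.

Lemma Rint_norm_le (f : T -> R) c : bmeas f -> (forall x, `|f x| <= c) ->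
  `|\int[P]_x f x| <= c.
Proof.
move=> bf fc; rewrite (le_trans (le_norm_Rint bf))// Rint_le//.
exact: bmeas_norm.
Qed.

(** Variance is nonnegative. *)
Lemma Rint_sqr_ge (f : T -> R) : bmeas f ->
  (\int[P]_x f x) ^+ 2 <= \int[P]_x (f x ^+ 2).
Proof.
move=> bf; set m := \int[P]_x f x.
have : 0 <= \int[P]_x ((f x - m) ^+ 2) by apply: Rint_ge0 => x; exact: sqr_ge0.
have -> : \int[P]_x ((f x - m) ^+ 2) =
          \int[P]_x ((f x ^+ 2 - 2 * m * f x) + m ^+ 2).
  by apply: eq_Rintegral => x _; ring.
have bc := bmeas_cst; have bX := bmeasX 2 bf.
have b2 : bmeas (fun x => 2 * m * f x) by exact: bmeasM.
by rewrite RintD ?RintB ?Rint_cst ?RintZl//; [rewrite -/m; lra | exact: bmeasB].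
Qed.

Lemma Rint_cauchy_schwarz (f g : T -> R) : bmeas f -> bmeas g ->
  (\int[P]_x (f x * g x)) ^+ 2 <= \int[P]_x (f x ^+ 2) * \int[P]_x (g x ^+ 2).
Proof.
move=> bf bg.
set a := \int[P]_x (f x ^+ 2); set b := \int[P]_x (g x ^+ 2).
set c := \int[P]_x (f x * g x).
have a0 : 0 <= a by apply: Rint_ge0 => x; exact: sqr_ge0.
have b0 : 0 <= b by apply: Rint_ge0 => x; exact: sqr_ge0.
have bc := bmeas_cst; have fX := bmeasX 2 bf; have gX := bmeasX 2 bg.
have fg := bmeasM bf bg.
have q (s t : R) : 0 <= s ^+ 2 * a - 2 * s * t * c + t ^+ 2 * b.
  have : 0 <= \int[P]_x ((s * f x - t * g x) ^+ 2).
    by apply: Rint_ge0 => x; exact: sqr_ge0.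
  have -> : \int[P]_x ((s * f x - t * g x) ^+ 2) =
    \int[P]_x ((s ^+ 2 * f x ^+ 2 - 2 * s * t * (f x * g x)) +
       t ^+ 2 * g x ^+ 2) by apply: eq_Rintegral => x _; ring.
  have b1 : bmeas (fun x => s ^+ 2 * f x ^+ 2) by exact: bmeasM.
  have b2 : bmeas (fun x => 2 * s * t * (f x * g x)) by exact: bmeasM.
  have b3 : bmeas (fun x => t ^+ 2 * g x ^+ 2) by exact: bmeasM.
  by rewrite RintD ?RintB ?RintZl//; exact: bmeasB.
exact: sqr_le_of_quadratic.
Qed.

End bounded_measurable.

Section change_of_variables.
Context {d1 d2 : measure_display} {T1 : measurableType d1}
  {T2 : measurableType d2} {R : realType}.

Lemma bmeas_comp (f : T2 -> R) (g : T1 -> T2) : measurable_fun setT g ->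
  bmeas f -> bmeas (f \o g).
Proof.
move=> mg [mf [C fC]]; split; first exact: measurableT_comp.
by exists C => x /=.
Qed.

Lemma Rint_distribution (P : probability T1 R) (X : {mfun T1 >-> T2})
    (f : T2 -> R) : bmeas f ->
  \int[distribution P X]_y f y = \int[P]_x f (X x).
Proof.
move=> bf; rewrite /Rintegral; congr fine.
rewrite /distribution integral_pushforward//=.
- by apply/measurable_EFinP; exact: bf.1.
- apply: (@bmeas_integrable _ _ _ P setT (f \o X)) => //; exact: bmeas_comp.
Qed.

End change_of_variables.

Section fubini_bounded.
Context {d1 d2 : measure_display} {T1 : measurableType d1}
  {T2 : measurableType d2} {R : realType}.
Variables (P1 : probability T1 R) (P2 : probability T2 R).

Lemma bmeas_section (f : T1 * T2 -> R) x : bmeas f -> bmeas (fun y => f (x, y)).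
Proof. by move=> bf; exact: (bmeas_comp (pair1_measurable _) bf). Qed.

Lemma bmeas_section2 (f : T1 * T2 -> R) y : bmeas f -> bmeas (fun x => f (x, y)).
Proof. by move=> bf; exact: (bmeas_comp (pair2_measurable _) bf). Qed.

Lemma bmeas_Rint2 (f : T1 * T2 -> R) : bmeas f ->
  bmeas (fun x => \int[P2]_y f (x, y)).
Proof.
move=> bf; have [mf [C fC]] := bf; split; last first.
  by exists C => x; apply: Rint_norm_le => //; exact: bmeas_section.
have := @measurable_fubini_F _ _ _ _ _ P1 P2 (EFin \o f).
rewrite /fubini_F => /(_ _)/wrap[]; first exact: bmeas_integrable.
move=> mF; apply/measurable_EFinP; apply: eq_measurable_fun mF => x _ /=.
by rewrite EFin_Rint//; exact: bmeas_section.
Qed.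

Lemma Rint_prod (f : T1 * T2 -> R) : bmeas f ->
  \int[(P1 \x P2)%E]_z f z = \int[P1]_x \int[P2]_y f (x, y).
Proof.
move=> bf; rewrite /Rintegral; congr fine.
rewrite -integral12_prod_meas1; last exact: bmeas_integrable.
apply: eq_integral => x _; rewrite /fubini_F fineK//.
by apply: integrable_fin_num => //; apply: bmeas_integrable => //; exact: bmeas_section.
Qed.

Lemma Rint_exchange (f : T1 * T2 -> R) : bmeas f ->
  \int[P1]_x \int[P2]_y f (x, y) = \int[P2]_y \int[P1]_x f (x, y).
Proof.
move=> bf; rewrite -Rint_prod// /Rintegral; congr fine.
rewrite -integral21_prod_meas1; last exact: bmeas_integrable.
apply: eq_integral => x _; rewrite /fubini_G fineK//.
by apply: integrable_fin_num => //; apply: bmeas_integrable => //; exact: bmeas_section2.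
Qed.

End fubini_bounded.

(** * Sums over independent draws *)

Lemma sum_cauchy_schwarz {R : realFieldType} (I : finType) (a b : I -> R) :
  (\sum_i a i * b i) ^+ 2 <= (\sum_i a i ^+ 2) * (\sum_i b i ^+ 2).
Proof.
apply: sqr_le_of_quadratic; try by apply: sumr_ge0 => i _; exact: sqr_ge0.
move=> s t; rewrite !mulr_sumr -sumrB -big_split/=; apply: sumr_ge0 => i _.
by rewrite (_ : _ + _ = (s * a i - t * b i) ^+ 2) ?sqr_ge0//; ring.
Qed.

Section iid_integration.
Context {disp : measure_display} {T : measurableType disp} {R : realType}.
Variable P : probability T R.

Definition tsum n (f : T -> R) (D : n.-tuple T) : R :=
  \sum_(i < n) f (tnth D i).

Lemma bmeas_tnth n (f : T -> R) (i : 'I_n) : bmeas f ->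
  bmeas (fun D : n.-tuple T => f (tnth D i)).
Proof.
by move=> bf; exact: (bmeas_comp (g := fun D : n.-tuple T => tnth D i)
  (measurable_tnth _) bf).
Qed.

Lemma bmeas_tsum n (f : T -> R) : bmeas f -> bmeas (@tsum n f).
Proof. by move=> bf; apply: bmeas_sum => i; exact: bmeas_tnth. Qed.

Lemma tsum_cons n (f : T -> R) z (D : n.-tuple T) :
  tsum f (Defs.cons_tuple (z, D)) = f z + tsum f D.
Proof.
rewrite /tsum big_ord_recl; congr (f _ + _).
by apply: eq_bigr => i _; rewrite tnthS.
Qed.

Lemma Rint_iidS n (f : n.+1.-tuple T -> R) : bmeas f ->
  \int[iid P n.+1]_D f D =
  \int[P]_z \int[iid P n]_D f (Defs.cons_tuple (z, D)).
Proof.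
move=> bf; rewrite Rint_distribution// Rint_prod//.
exact: (bmeas_comp (@measurable_cons_tuple _ _ _) bf).
Qed.

Lemma bmeas_cons n (f : n.+1.-tuple T -> R) : bmeas f ->
  bmeas (fun zD => f (Defs.cons_tuple zD)).
Proof. exact: (bmeas_comp (@measurable_cons_tuple _ _ _)). Qed.

Lemma bmeas_cons1 n (f : n.+1.-tuple T -> R) z : bmeas f ->
  bmeas (fun D => f (Defs.cons_tuple (z, D))).
Proof. by move=> /bmeas_cons/(bmeas_section z). Qed.

Lemma Rint_tsum n (f : T -> R) : bmeas f ->
  \int[iid P n]_D tsum f D = n%:R * \int[P]_z f z.
Proof.
move=> bf; rewrite Rint_sum; last by move=> i; exact: bmeas_tnth.
suff H : forall n (i : 'I_n), \int[iid P n]_D f (tnth D i) = \int[P]_z f z.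
  by under eq_bigr do rewrite H; rewrite sumr_const card_ord mulr_natl.
move=> {}n; elim: n => [[]//|n IH] i; rewrite Rint_iidS; last exact: bmeas_tnth.
case: (unliftP ord0 i) => [j|] -> /=.
  rewrite -[RHS](Rint_cst P) -(IH j); apply: eq_Rintegral => z _.
  by apply: eq_Rintegral => D _; rewrite tnthS.
by apply: eq_Rintegral => z _; rewrite -[RHS](Rint_cst (iid P n)).
Qed.

(** Only the diagonal of the double sum feels the dependence between the two
    factors. *)
Lemma Rint_tsumM n (f g : T -> R) : bmeas f -> bmeas g ->
  \int[iid P n]_D (tsum f D * tsum g D) =
  n%:R * (\int[P]_z (f z * g z)) +
  n%:R * (n%:R - 1) * ((\int[P]_z f z) * (\int[P]_z g z)).
Proof.
move=> bf bg; have bfg := bmeasM bf bg; elim: n => [|n IH].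
  under eq_Rintegral do rewrite /tsum big_ord0 mul0r.
  by rewrite Rint_cst !mul0r addr0.
have bF := bmeas_tsum n bf; have bG := bmeas_tsum n bg.
have bFG := bmeasM bF bG.
rewrite Rint_iidS; last by apply: bmeasM; exact: bmeas_tsum.
have bc := bmeas_cst.
transitivity (\int[P]_z (f z * g z + (n%:R * \int[P]_z g z) * f z +
  (n%:R * \int[P]_z f z) * g z + \int[iid P n]_D (tsum f D * tsum g D))).
  apply: eq_Rintegral => z _.
  transitivity (\int[iid P n]_D (f z * g z + f z * tsum g D +
                g z * tsum f D + tsum f D * tsum g D)).
    by apply: eq_Rintegral => D _; rewrite !tsum_cons; ring.
  have b1 : bmeas (fun D : n.-tuple T => f z * tsum g D) by exact: bmeasM.
  have b2 : bmeas (fun D : n.-tuple T => g z * tsum f D) by exact: bmeasM.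
  rewrite RintD//; last by apply: bmeasD => //; exact: bmeasD.
  rewrite RintD//; last exact: bmeasD.
  by rewrite RintD// !RintZl// Rint_cst !Rint_tsum//; ring.
have b1 : bmeas (fun z => (n%:R * \int[P]_z g z) * f z) by exact: bmeasM.
have b2 : bmeas (fun z => (n%:R * \int[P]_z f z) * g z) by exact: bmeasM.
rewrite RintD//; last by apply: bmeasD => //; exact: bmeasD.
rewrite RintD//; last exact: bmeasD.
rewrite RintD// !RintZl// Rint_cst IH -natr1; ring.
Qed.

Definition delete n (i : 'I_n.+1) (D : n.+1.-tuple T) : n.-tuple T :=
  [tuple tnth D (lift i j) | j < n].

Lemma tsum_delete n (i : 'I_n.+1) (f : T -> R) D :
  tsum f D = f (tnth D i) + tsum f (delete i D).
Proof.
rewrite /tsum (bigD1_ord i)//=; congr (_ + _).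
by apply: eq_bigr => j _; rewrite tnth_mktuple.
Qed.

Lemma measurable_delete n (i : 'I_n.+1) : measurable_fun setT (delete i).
Proof.
apply/measurable_fun_tnthP => j; rewrite (_ : _ \o _ = (@tnth _ _)^~ (lift i j)).
  exact: measurable_tnth.
by apply/funext => D /=; rewrite tnth_mktuple.
Qed.

(** The deleted draw and the remaining ones are again independent; by induction,
    moving the deleted coordinate to the front one step at a time. *)
Lemma Rint_delete n (i : 'I_n.+1) (G : T * n.-tuple T -> R) : bmeas G ->
  \int[iid P n.+1]_D G (tnth D i, delete i D) =
  \int[P]_z \int[iid P n]_D G (z, D).
Proof.
have bG n' (j : 'I_n'.+1) (H : T * n'.-tuple T -> R) : bmeas H ->
    bmeas (fun D => H (tnth D j, delete j D)).
  move=> bH; apply: (bmeas_comp (g := fun D => (tnth D j, delete j D))) bH.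
  by apply: measurable_fun_pair; [exact: measurable_tnth|exact: measurable_delete].
elim: n i G => [|n IH] i G bGG; rewrite Rint_iidS; try exact: bG.
  apply: eq_Rintegral => z _; apply: eq_Rintegral => D _.
  by rewrite ord1/=; congr (G (_, _)); rewrite tuple0; exact/esym/tuple0.
case: (unliftP ord0 i) => [j|] ->.
- transitivity (\int[P]_z0 \int[P]_z \int[iid P n]_D G (z, Defs.cons_tuple (z0, D))).
    apply: eq_Rintegral => z0 _.
    rewrite -(IH j (fun zD => G (zD.1, Defs.cons_tuple (z0, zD.2)))); last first.
      apply: (bmeas_comp (g := fun zD => (zD.1, Defs.cons_tuple (z0, zD.2)))) bGG.
      apply: measurable_fun_pair => //.
      apply: (measurableT_comp (@measurable_cons_tuple _ _ _)).
      exact: (measurableT_comp (pair1_measurable _)).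
    apply: eq_Rintegral => D _ /=; rewrite tnthS; congr (G (_, _)).
    apply: eq_from_tnth => k; rewrite tnth_mktuple.
    case: (unliftP ord0 k) => [l|] ->; last first.
      have e : lift (lift ord0 j) ord0 = ord0 :> 'I_n.+2 by exact/val_inj.
      by rewrite e.
    have e : lift (lift ord0 j) (lift ord0 l) = lift ord0 (lift j l).
      by apply: val_inj => /=; rewrite /bump/= !add1n ltnS addnS.
    by rewrite e !tnthS tnth_mktuple.
  pose H (w : T * T) := \int[iid P n]_D G (w.2, Defs.cons_tuple (w.1, D)).
  have bH : bmeas H.
    apply: (@bmeas_Rint2 _ _ _ _ _ (P \x P)%E _
      (fun wD => G (wD.1.2, Defs.cons_tuple (wD.1.1, wD.2)))).
    apply: (bmeas_comp (g := fun wD => (wD.1.2, Defs.cons_tuple (wD.1.1, wD.2)))) bGG.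
    apply: measurable_fun_pair.
      exact: (measurableT_comp measurable_snd measurable_fst).
    apply: (measurableT_comp (@measurable_cons_tuple _ _ _)).
    apply: measurable_fun_pair => //.
    exact: (measurableT_comp measurable_fst measurable_fst).
  rewrite (Rint_exchange P P bH); apply: eq_Rintegral => z _.
  by rewrite Rint_iidS//; exact: (bmeas_section _ bGG).
- apply: eq_Rintegral => z _; apply: eq_Rintegral => D _; congr (G (_, _)).
  by apply: eq_from_tnth => k; rewrite tnth_mktuple tnthS.
Qed.

Lemma ge0_integral_iidS n (f : n.+1.-tuple T -> \bar R) :
  measurable_fun setT f -> (forall D, 0 <= f D)%E ->
  (\int[iid P n.+1]_D f D =
   \int[P]_z \int[iid P n]_D f (Defs.cons_tuple (z, D)))%E.
Proof.
move=> mf f0; rewrite ge0_integral_distribution// fubini_tonelli1//.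
  exact: (measurableT_comp mf (@measurable_cons_tuple _ T n)).
by move=> ?; exact: f0.
Qed.

(** An almost sure identity may be applied to each draw. *)
Lemma integral_iid_map (k : T -> T) : measurable_fun setT k ->
  {ae P, forall z, k z = z} ->
  forall n (f : n.-tuple T -> \bar R), measurable_fun setT f ->
  (forall D, 0 <= f D)%E ->
  (\int[iid P n]_D f D = \int[iid P n]_D f (map_tuple k D))%E.
Proof.
move=> mk kz; elim=> [|n IH] f mf f0.
  by apply: eq_integral => D _; rewrite !tuple0; congr f; exact/esym/tuple0.
have mmap m : measurable_fun setT (map_tuple k : m.-tuple T -> m.-tuple T).
  apply/measurable_fun_tnthP => j; rewrite (_ : _ \o _ = k \o (@tnth _ _)^~ j).
    by apply: measurableT_comp mk (measurable_tnth _).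
  by apply/funext => D /=; rewrite tnth_map.
have mc := @measurable_cons_tuple _ T n.
have mfm : measurable_fun setT (f \o map_tuple k).
  exact: (measurableT_comp mf (mmap _)).
rewrite ge0_integral_iidS//.
rewrite [RHS](ge0_integral_iidS mfm (fun=> f0 _)).
have f0c x : (0 <= (f \o @Defs.cons_tuple _ _ n) x)%E := f0 _.
pose h z := (\int[iid P n]_D f (Defs.cons_tuple (z, D)))%E.
have mh : measurable_fun setT h.
  apply: (measurable_fun_fubini_tonelli_F (f \o @Defs.cons_tuple _ _ n)) => //.
  exact: (measurableT_comp mf mc).
transitivity (\int[P]_z h (k z))%E.
  apply: ae_eq_integral => //; first exact: (measurableT_comp mh mk).
  by apply: filterS kz => z /= ->.
apply: eq_integral => z _; rewrite /h IH//; last first.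
  exact: (measurableT_comp mf (measurableT_comp mc (pair1_measurable _))).
apply: eq_integral => D _; congr f; exact: val_inj.
Qed.

End iid_integration.

Section hilbert_moments.
Context {disp : measure_display} {T : measurableType disp} {R : realType}.
Variables (P : probability T R) (I : finType) (xi : I -> T -> R).
Hypothesis bxi : forall i, bmeas (xi i).
Hypothesis xi0 : forall i, \int[P]_z xi i z = 0.

(** The functions [xi i] are the coordinates of a centred random vector; [sqn] is
    the square of its norm and [tsqn] that of a sum of independent copies. *)
Definition sqn (z : T) := \sum_i xi i z ^+ 2.
Definition tsqn n (D : n.-tuple T) := \sum_i tsum (xi i) D ^+ 2.

Lemma bmeas_sqn : bmeas sqn.
Proof. by apply: bmeas_sum => i; exact: bmeasX. Qed.

Lemma bmeas_tsqn n : bmeas (@tsqn n).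
Proof. by apply: bmeas_sum => i; apply: bmeasX; exact: bmeas_tsum. Qed.

Lemma sqn_ge0 z : 0 <= sqn z.
Proof. by apply: sumr_ge0 => i _; exact: sqr_ge0. Qed.

Lemma tsqn_ge0 n (D : n.-tuple T) : 0 <= tsqn D.
Proof. by apply: sumr_ge0 => i _; exact: sqr_ge0. Qed.

Lemma Rint_tsqn n : \int[iid P n]_D tsqn D = n%:R * \int[P]_z sqn z.
Proof.
rewrite Rint_sum; last by move=> i; apply: bmeasX; exact: bmeas_tsum.
rewrite [X in _ * X]Rint_sum; last by move=> i; exact: bmeasX.
rewrite mulr_sumr; apply: eq_bigr => i _.
under eq_Rintegral do rewrite expr2.
by rewrite Rint_tsumM// xi0 !mulr0 addr0.
Qed.

(** Fourth moment of the norm of a sum of centred independent vectors. Adding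
    one summand changes the squared norm [N] to [N + 2 c + q], where [c] has
    conditional mean zero, so that only terms of order [N q] and [q ^+ 2]
    contribute to the second moment. *)
Lemma Rint_tsqn2 n :
  \int[iid P n]_D (tsqn D ^+ 2) <=
  4 * n%:R ^+ 2 * (\int[P]_z sqn z) ^+ 2 + 3 * n%:R * \int[P]_z (sqn z ^+ 2).
Proof.
set s := \int[P]_z sqn z; set kap := \int[P]_z (sqn z ^+ 2).
have bq := bmeas_sqn; have bc := bmeas_cst.
elim: n => [|n IH].
  under eq_Rintegral do (rewrite /tsqn big1 ?expr0n; last by
    move=> i _; rewrite /tsum big_ord0 expr0n).
  by rewrite Rint_cst/=; lra.
have bN := bmeas_tsqn n; have bN2 := bmeasX 2 bN.
rewrite Rint_iidS; last by apply: bmeasX; exact: bmeas_tsqn.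
pose cr z (D : n.-tuple T) := \sum_i xi i z * tsum (xi i) D.
have bcr z : bmeas (cr z).
  by apply: bmeas_sum => i; apply: bmeasM => //; exact: bmeas_tsum.
pose u (D : n.-tuple T) z := tsqn D ^+ 2 + 4 * tsqn D * cr z D +
  8 * tsqn D * sqn z + 3 * sqn z ^+ 2.
have cons z D : tsqn (Defs.cons_tuple (z, D)) = tsqn D + 2 * cr z D + sqn z.
  rewrite /tsqn /cr /sqn mulr_sumr -!big_split/=; apply: eq_bigr => i _.
  by rewrite tsum_cons; ring.
have le_u z D : tsqn (Defs.cons_tuple (z, D)) ^+ 2 <= u D z.
  have cs : cr z D ^+ 2 <= sqn z * tsqn D by exact: sum_cauchy_schwarz.
  have cs2 : 0 <= tsqn D - 2 * cr z D + sqn z.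
    rewrite /tsqn /cr /sqn mulr_sumr -sumrB -big_split/=.
    apply: sumr_ge0 => i _.
    by rewrite (_ : _ + _ = (tsum (xi i) D - xi i z) ^+ 2) ?sqr_ge0//; ring.
  have := sqn_ge0 z; have := tsqn_ge0 D; rewrite cons /u.
  move: (tsqn D) (cr z D) (sqn z) cs cs2 => N c q; nra.
have b0 z : bmeas (fun D => tsqn (Defs.cons_tuple (z, D)) ^+ 2).
  by apply: bmeasX; apply: bmeas_cons1; exact: bmeas_tsqn.
have bcrz : bmeas (fun zD : T * n.-tuple T => cr zD.1 zD.2).
  apply: bmeas_sum => i; apply: bmeasM.
    exact: (bmeas_comp measurable_fst).
  by apply: (bmeas_comp measurable_snd); exact: bmeas_tsum.
have bu : bmeas (fun zD : T * n.-tuple T => u zD.2 zD.1).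
  have bN' : bmeas (fun zD : T * n.-tuple T => tsqn zD.2).
    exact: (bmeas_comp measurable_snd).
  have bq' : bmeas (fun zD : T * n.-tuple T => sqn zD.1).
    exact: (bmeas_comp measurable_fst).
  apply: bmeasD; last by apply: bmeasM => //; exact: bmeasX.
  apply: bmeasD; last by apply: bmeasM => //; exact: bmeasM.
  apply: bmeasD; first exact: bmeasX.
  by apply: bmeasM => //; exact: bmeasM.
apply: (@le_trans _ _ (\int[P]_z \int[iid P n]_D u D z)).
  apply: le_Rint.
  - apply: (bmeas_Rint2 P (iid P n) (f := fun zD => tsqn (Defs.cons_tuple zD) ^+ 2)).
    by apply: (@bmeas_cons _ _ _ n (fun D => tsqn D ^+ 2)); apply: bmeasX;
      exact: bmeas_tsqn.
  - exact: (bmeas_Rint2 P (iid P n) bu).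
  - move=> z; apply: (@le_Rint _ _ _ _ _ (u^~ z)) => //.
    exact: (bmeas_section z bu).
rewrite (Rint_exchange P (iid P n) bu)/=.
have -> : \int[iid P n]_D \int[P]_z u D z =
    \int[iid P n]_D (tsqn D ^+ 2 + (8 * s) * tsqn D + 3 * kap).
  apply: eq_Rintegral => D _; rewrite /u.
  have b1 : bmeas (fun z => cr z D) by exact: (bmeas_section2 D bcrz).
  have b2 := bmeasX 2 bq.
  rewrite RintD; [|apply: bmeasD; first apply: bmeasD|]; try exact: bmeasM => //.
  rewrite RintD; [|apply: bmeasD|]; try exact: bmeasM => //.
  rewrite RintD; [|by []|]; try exact: bmeasM => //.
  rewrite Rint_cst !RintZl// -/s -/kap.
  have -> : \int[P]_z cr z D = 0; last by ring.
  rewrite Rint_sum; last by move=> i; exact: bmeasM.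
  by rewrite big1 => // i _; rewrite RintZr// xi0 mul0r.
have b3 : bmeas (fun D : n.-tuple T => 8 * s * tsqn D) by exact: bmeasM.
rewrite RintD ?RintD ?RintZl ?Rint_cst ?Rint_tsqn//; last exact: bmeasD.
rewrite -/s -[n.+1%:R]natr1; have : 0 <= kap by apply: Rint_ge0 => z; exact: sqr_ge0.
have := sqr_ge0 s; move: IH; move: (n%:R) => N; nra.
Qed.

End hilbert_moments.

(** * Families of functions on the cube with bounded overlaps *)

Section cube_functions.
Context {R : realType} {d : nat}.
Implicit Type f g : d.-tuple R -> R.

Lemma measurable_cube : measurable (@cube R d).
Proof.
rewrite (_ : cube = \bigcap_(i in [set: 'I_d]) ((@tnth d R)^~ i @^-1` `[0, 1])).
  apply: fin_bigcap_measurable; first exact: finite_finset.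
  by move=> i _; rewrite -[X in measurable X]setTI; apply: measurable_tnth.
by apply/seteqP; split => [x cx i _ /=|x cx i];
  [rewrite in_itv/=; exact: cx|have := cx i I; rewrite /= in_itv].
Qed.

(** Rational boxes form a countable base of the topology of [R^d], and they
    belong to the product sigma-algebra. *)
Lemma continuous_measurable f :
  (forall x, continuous_at_point f x) -> measurable_fun setT f.
Proof.
move=> cf; apply: (measurability _ (RGenOInfty.measurableE R)).
move=> _ [_ [a ->] <-]; rewrite setTI preimage_itvoy.
pose box (b : d.-tuple rat * rat) : set (d.-tuple R) :=
  [set x | forall i, `|tnth x i - ratr (tnth b.1 i)| < ratr b.2].
pose good b := box b `<=` [set x | a < f x].
have -> : [set x | a < f x] =
    \bigcup_b (if `[< good b >] then box b else set0).
  apply/seteqP; split => [x /= ax|x [b _]]; last first.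
    by case: asboolP => // gb bx; exact: gb.
  have [|r r0 fr] := cf x (f x - a); first by rewrite subr_gt0.
  have [e] : exists q : rat, ratr q \in `](0 : R), (r / 2)[.
    by apply: rat_in_itvoo; rewrite divr_gt0.
  rewrite in_itv/= => /andP[e0 er].
  have /choice[q qP] : forall i, exists q : rat,
      `|tnth x i - ratr q| < ratr e.
    move=> i; have [q] : exists q : rat,
      ratr q \in `](tnth x i - ratr e), (tnth x i + ratr e)[.
      by apply: rat_in_itvoo; rewrite ltrD2l; lra.
    by rewrite in_itv/= => /andP[q1 q2]; exists q; rewrite ltr_norml; lra.
  exists ([tuple q i | i < d], e) => //.
  have bx : box ([tuple q i | i < d], e) x by move=> i; rewrite tnth_mktuple.
  case: asboolP => // -[] y yb /=.
  have := fr y; rewrite ltr_norml => /(_ _)/wrap[|]; last by lra.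
  move=> i; have := bx i; have := yb i; rewrite /= !tnth_mktuple.
  rewrite !ltr_norml; lra.
apply: countable_bigcupT_measurable; first exact: countableP.
move=> b; case: asboolP => // _.
rewrite (_ : box b = \bigcap_(i in [set: 'I_d]) ((@tnth d R)^~ i @^-1`
    `](ratr (tnth b.1 i) - ratr b.2), (ratr (tnth b.1 i) + ratr b.2)[)).
  apply: fin_bigcap_measurable; first exact: finite_finset.
  by move=> i _; rewrite -[X in measurable X]setTI; apply: measurable_tnth.
by apply/seteqP; split => [x bx i _ /=|x bx i]; [have := bx i|have := bx i I];
  rewrite /= in_itv/= ltr_norml => ?; lra.
Qed.

Lemma continuous_bmeas_on_cube f g C :
  (forall x, ~ cube x -> f x = 0) -> (forall x, cube x -> f x = g x) ->
  (forall x, continuous_at_point g x) ->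
  (forall x, cube x -> `|g x| <= C) -> bmeas f /\ forall x, `|f x| <= `|C|.
Proof.
move=> f0 fg cg gC.
have fC x : `|f x| <= `|C|.
  have [cx|/f0->] := pselect (cube x); last by rewrite normr0.
  by rewrite fg// (le_trans (gC _ cx))// ler_norm.
split=> //; split; last by exists `|C|.
rewrite (_ : f = fun x => g x * \1_cube x).
  apply: measurable_funM; first exact: continuous_measurable.
  by apply: measurable_indic; exact: measurable_cube.
apply/funext => x; rewrite indicE.
have [cx|ncx] := pselect (cube x); first by rewrite mem_set// mulr1 fg.
by rewrite memNset// mulr0 f0.
Qed.

End cube_functions.

(** What the estimation theory needs of a wavelet family: at each level the
    functions are bounded measurable, of size [2^(jd/2)] with overlaps bounded
    uniformly in the level. *)
Definition frame_bounds {R : realType} {d : nat} (J0 : nat) (I : nat -> finType)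
    (u : forall j, I j -> d.-tuple R -> R) (C : R) :=
  1 <= C /\ forall j, (J0 <= j)%N ->
  [/\ forall i, bmeas (u j i),
      forall i x, `|u j i x| <= C * 2 `^ (j%:R * (d%:R / 2)) &
      forall x, #|[pred i | u j i x != 0]|%:R <= C].

Lemma frame_bounds_le {R : realType} {d : nat} J0 (I : nat -> finType)
    (u : forall j, I j -> d.-tuple R -> R) (C C' : R) :
  C <= C' -> frame_bounds J0 u C -> frame_bounds J0 u C'.
Proof.
move=> CC [C1 H]; split; first exact: le_trans CC.
move=> j Jj; have [Hm Hb Hc] := H j Jj; split => // [i x|x].
  by rewrite (le_trans (Hb i x))// ler_wpM2r// powR_ge0.
exact: le_trans (Hc x) CC.
Qed.

Lemma local_regular_frame {R : realType} {d : nat} J0 S (I : nat -> finType)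
    (u : forall j, I j -> d.-tuple R -> R) :
  local_regular J0 S u -> exists C, frame_bounds J0 u C.
Proof.
move=> [C H]; exists (Num.max 1 C); split; first by rewrite le_max lexx.
move=> j Jj; have [H0 _ Hc Hg] := H j Jj.
have C0 : 0 <= C.
  by apply: le_trans (Hc [tuple 0 | i < d]); rewrite ler0n.
have hi i : bmeas (u j i) /\
    forall x, `|u j i x| <= C * 2 `^ (j%:R * (d%:R / 2)).
  have [g [gS ug gb]] := Hg i.
  have Ce : `|C * 2 `^ (j%:R * (d%:R / 2))| = C * 2 `^ (j%:R * (d%:R / 2)).
    by rewrite ger0_norm// mulr_ge0// powR_ge0.
  rewrite -Ce.
  apply: (@continuous_bmeas_on_cube _ _ _ g) => //.
  - exact: H0.
  - by move=> x; exact: (gS.2 [::]).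
  - by move=> x cx; have := gb [::] x isT cx; rewrite /= addr0.
split => [i|i x|x]; first exact: (hi i).1.
- by rewrite (le_trans ((hi i).2 x))// ler_wpM2r ?powR_ge0// le_max lexx orbT.
- by rewrite (le_trans (Hc x))// le_max lexx orbT.
Qed.

Section frame_consequences.
Context {R : realType} {d J0 : nat} {I : nat -> finType}.
Variables (u : forall j, I j -> d.-tuple R -> R) (C : R).
Hypothesis uC : frame_bounds J0 u C.

Lemma pow2_level j : (2 `^ (j%:R * (d%:R / 2))) ^+ 2 = (resolution d j)%:R :> R.
Proof.
rewrite -powR_mulrn ?powR_ge0// -powRrM /resolution natrX -powR_mulrn//.
by rewrite natrM; congr (_ `^ _); field.
Qed.

(** At most [C] terms are nonzero at a given point, each of size [C 2^(jd/2)]. *)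
Lemma frame_sum_le j (c : I j -> R) (B : R) x : (J0 <= j)%N ->
  0 <= B -> (forall i, `|c i| <= B) ->
  \sum_i `|c i * u i x| <= B * C ^+ 2 * 2 `^ (j%:R * (d%:R / 2)).
Proof.
move=> Jj B0 cB; have [C1 /(_ j Jj) [_ ub uc]] := uC.
set e := 2 `^ _; have e0 : 0 <= e by exact: powR_ge0.
have C0 : 0 <= C by exact: le_trans C1.
rewrite (bigID [pred i | u i x != 0])/= [X in _ + X]big1 ?addr0; last first.
  by move=> i /negPn/eqP ->; rewrite mulr0 normr0.
apply: (@le_trans _ _ (\sum_(i | u i x != 0) B * (C * e))).
  by apply: ler_sum => i _; rewrite normrM ler_pM.
rewrite sumr_const -[_ *+ _]mulr_natr expr2 -!mulrA ler_wpM2l//.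
rewrite ler_wpM2l// [leRHS]mulrC ler_wpM2l//; exact: uc.
Qed.

Lemma frame_sqr_sum_le j x : (J0 <= j)%N ->
  \sum_(i : I j) u i x ^+ 2 <= C ^+ 3 * (resolution d j)%:R.
Proof.
move=> Jj; have [C1 /(_ j Jj) [_ ub uc]] := uC.
have C0 : 0 <= C by exact: le_trans C1.
have e0 : 0 <= 2 `^ (j%:R * (d%:R / 2)) :> R by exact: powR_ge0.
have := @frame_sum_le j (fun i => u i x) (C * 2 `^ (j%:R * (d%:R / 2))) x Jj
  (mulr_ge0 C0 e0) (fun i => ub i x).
rewrite -pow2_level => H; apply: le_trans (le_trans H _).
  by apply: ler_sum => i _; rewrite expr2 ler_norm.
by rewrite le_eqVlt; apply/orP; left; apply/eqP; ring.
Qed.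

End frame_consequences.

(** * Projections to the multiresolution spaces *)

Section inner_product.
Context {R : realType} {d : nat}.
Implicit Types f g h : d.-tuple R -> R.

Lemma innerC f g : inner f g = inner g f.
Proof. by apply: eq_Rintegral => x _; rewrite mulrC. Qed.

Lemma inner_suml (I : finType) (c : I -> R) (u : I -> d.-tuple R -> R) g :
  (forall i, bmeas (u i)) -> bmeas g ->
  inner (fun x => \sum_i c i * u i x) g = \sum_i c i * inner (u i) g.
Proof.
move=> bu bg; rewrite /inner.
transitivity (\int[unif]_x \sum_i c i * (u i x * g x)).
  by apply: eq_Rintegral => x _; rewrite mulr_suml; apply: eq_bigr => i _; ring.
have bug i : bmeas (fun x => u i x * g x) by exact: bmeasM.
rewrite Rint_sum => [|i]; last by apply: bmeasM => //; exact: bmeas_cst.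
by apply: eq_bigr => i _; rewrite RintZl.
Qed.

Lemma innerDl f g h : bmeas f -> bmeas g -> bmeas h ->
  inner (fun x => f x + g x) h = inner f h + inner g h.
Proof.
move=> bf bg bh; rewrite /inner -RintD; [|exact: bmeasM|exact: bmeasM].
by apply: eq_Rintegral => x _; rewrite mulrDl.
Qed.

Lemma innerBl f g h : bmeas f -> bmeas g -> bmeas h ->
  inner (fun x => f x - g x) h = inner f h - inner g h.
Proof.
move=> bf bg bh; rewrite /inner -RintB; [|exact: bmeasM|exact: bmeasM].
by apply: eq_Rintegral => x _; rewrite mulrBl.
Qed.

Lemma innerZl (c : R) f h : bmeas f -> bmeas h ->
  inner (fun x => c * f x) h = c * inner f h.
Proof.
move=> bf bh; rewrite /inner -RintZl; last exact: bmeasM.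
by apply: eq_Rintegral => x _; rewrite mulrA.
Qed.

Lemma inner_mulr0 f k : inner f (fun x => k x * 0) = 0.
Proof.
rewrite -[RHS](Rint_cst (@unif R d)); apply: eq_Rintegral => x _.
by rewrite !mulr0.
Qed.

Lemma bmeas_lin (I : finType) (c : I -> R) (u : I -> d.-tuple R -> R) :
  (forall i, bmeas (u i)) -> bmeas (fun x => \sum_i c i * u i x).
Proof.
by move=> bu; apply: bmeas_sum => i; apply: bmeasM => //; exact: bmeas_cst.
Qed.

Section orthonormal_families.
Context {I J : finType}.
Variables (u : I -> d.-tuple R -> R) (v : J -> d.-tuple R -> R).
Hypotheses (bu : forall i, bmeas (u i)) (bv : forall k, bmeas (v k)).
Hypothesis ou : forall i j, inner (u i) (u j) = (i == j)%:R.
Hypothesis ov : forall i j, inner (v i) (v j) = (i == j)%:R.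

Lemma inner_lin_ortho (c : I -> R) i :
  inner (fun x => \sum_j c j * u j x) (u i) = c i.
Proof.
rewrite inner_suml// (bigD1 i)//= ou eqxx mulr1 big1 ?addr0// => j ji.
by rewrite ou (negbTE ji) mulr0.
Qed.

Lemma lin_spanE f : lin_span u f ->
  f = fun x => \sum_i inner f (u i) * u i x.
Proof.
move=> [c ->]; apply/funext => x; apply: eq_bigr => i _.
by rewrite inner_lin_ortho.
Qed.

Lemma lin_span_mem i : lin_span u (u i).
Proof.
exists (fun j => (j == i)%:R); apply/funext => x.
rewrite (bigD1 i)//= eqxx mul1r big1 ?addr0// => j /negbTE ->.
by rewrite mul0r.
Qed.

End orthonormal_families.

(** The reproducing kernel depends on the span only. *)
Lemma kernel_of_span (I J : finType) (u : I -> d.-tuple R -> R)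
    (v : J -> d.-tuple R -> R) x y :
  (forall i, bmeas (u i)) -> (forall k, bmeas (v k)) ->
  (forall i j, inner (u i) (u j) = (i == j)%:R) ->
  (forall i j, inner (v i) (v j) = (i == j)%:R) ->
  (forall i, lin_span v (u i)) -> (forall k, lin_span u (v k)) ->
  \sum_i u i x * u i y = \sum_k v k x * v k y.
Proof.
move=> bu bv ou ov uv vu.
transitivity (\sum_i \sum_k inner (u i) (v k) * v k x * u i y).
  apply: eq_bigr => i _; rewrite -mulr_suml; congr (_ * _).
  by rewrite {1}(lin_spanE bv ov (uv i)).
rewrite exchange_big/=; apply: eq_bigr => k _.
have -> : v k y = \sum_i inner (v k) (u i) * u i y.
  by rewrite {1}(lin_spanE bu ou (vu k)).
rewrite mulr_sumr.
by apply: eq_bigr => i _; rewrite (innerC (v k)); ring.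
Qed.

End inner_product.

Section wavelet_projections.
Context {R : realType} {d : nat}.
Variable W : wavelets R d.
Hypothesis HW : cdv_basis W.
Local Notation J0 := (base_level W).
Local Notation X := (d.-tuple R).

Lemma cdv_frames : exists C, frame_bounds J0 (@Phi _ _ W) C /\
  @frame_bounds R d J0 (fun l => (wtype d * loc W l)%type) (@Psi_pair _ _ W) C.
Proof.
have [C1 H1] := local_regular_frame (cdv_Phi_regular HW).
have [C2 H2] := local_regular_frame (cdv_Psi_regular HW).
exists (Num.max C1 C2); split; [move: H1|move: H2]; apply: frame_bounds_le;
  by rewrite le_max lexx ?orbT.
Qed.

Lemma bmeas_Phi j (m : loc W j) : (J0 <= j)%N -> bmeas (Phi m).
Proof. by move=> Jj; have [C [[_ /(_ j Jj)[b _ _]] _]] := cdv_frames. Qed.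

Lemma bmeas_Psi j (p : wtype d * loc W j) : (J0 <= j)%N -> bmeas (Psi_pair p).
Proof. by move=> Jj; have [C [_ [_ /(_ j Jj)[b _ _]]]] := cdv_frames. Qed.

Lemma Vspace_Phi j (m : loc W j) : Vspace W j (Phi m).
Proof. exact: lin_span_mem. Qed.

Lemma zero_lin_span (I : finType) (u : I -> X -> R) : lin_span u (fun=> 0).
Proof.
by exists (fun=> 0); apply/funext => x; rewrite big1// => i _; rewrite mul0r.
Qed.

(** By induction on [j], splitting [V_{j+1}] into [V_j] and [W_j]. *)
Lemma Phi_Psi_ortho j l (m : loc W j) (p : wtype d * loc W l) :
  (J0 <= j)%N -> (j <= l)%N -> inner (Phi m) (Psi_pair p) = 0.
Proof.
elim: j m => [|j IH] m Jj jl.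
  move: m; rewrite leqn0 in Jj; rewrite -(eqP Jj) => m.
  by apply: (cdv_Phi_Psi_orthogonal HW); rewrite (eqP Jj).
have [Jj'|jJ] := leqP J0 j; last first.
  have e : j.+1 = J0 by apply/eqP; rewrite eqn_leq jJ.
  by move: m; rewrite e => m; apply: (cdv_Phi_Psi_orthogonal HW); rewrite -e.
have Jl := leq_trans Jj jl.
have := Vspace_Phi m; rewrite (cdv_multiresolution HW Jj') => -[g [a ->]].
move=> [h [b ->]] <-.
have bP := bmeas_Psi p Jl.
rewrite innerDl//; [|by apply: bmeas_lin => i; exact: bmeas_Phi|
                   by apply: bmeas_lin => i; exact: bmeas_Psi].
rewrite !inner_suml//; try (move=> i; by [exact: bmeas_Phi|exact: bmeas_Psi]).
rewrite !big1 ?addr0// => i _.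
- by rewrite (cdv_Psi_orthogonal HW)// ?mulr0// neq_ltn jl.
- by rewrite IH ?mulr0//; exact: ltnW.
Qed.

(** The orthonormal basis of [V_{j+1}] adapted to [V_{j+1} = V_j + W_j]. *)
Definition split_basis j (i : loc W j + wtype d * loc W j) : X -> R :=
  match i with inl m => Phi m | inr p => Psi_pair p end.

Definition wave_kernel l (x y : X) : R :=
  \sum_(p : wtype d * loc W l) Psi_pair p x * Psi_pair p y.

Lemma proj_kernelS j x y : (J0 <= j)%N ->
  proj_kernel W j.+1 x y = proj_kernel W j x y + wave_kernel j x y.
Proof.
move=> Jj; have Jj1 : (J0 <= j.+1)%N by exact: leqW.
have bs i : bmeas (@split_basis j i).
  by case: i => [m|p]; [exact: bmeas_Phi|exact: bmeas_Psi].
have VE := cdv_multiresolution HW Jj.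
rewrite /proj_kernel (@kernel_of_span _ _ _ _ _ (@split_basis j))//.
- by rewrite big_sumType.
- by move=> i; exact: bmeas_Phi.
- exact: (cdv_Phi_orthonormal HW).
- move=> [m|p] [m'|p'] /=.
  + by rewrite (cdv_Phi_orthonormal HW)//.
  + by rewrite Phi_Psi_ortho.
  + by rewrite innerC Phi_Psi_ortho.
  + by rewrite (cdv_Psi_orthonormal HW).
- move=> m; have := Vspace_Phi m; rewrite VE => -[g [a ->]] [h [b ->]] <-.
  exists (fun i => match i with inl m => a m | inr p => b p end).
  by apply/funext => z; rewrite big_sumType.
- move=> k; suff : Vspace W j.+1 (split_basis k) by [].
  rewrite VE; case: k => [m|p] /=.
  + exists (Phi m); first exact: Vspace_Phi.
    exists (fun=> 0); first exact: zero_lin_span.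
    by apply/funext => z; rewrite addr0.
  + exists (fun=> 0); first exact: zero_lin_span.
    exists (Psi_pair p); first exact: lin_span_mem.
    by apply/funext => z; rewrite add0r.
Qed.

Definition projV j (f : X -> R) (x : X) : R :=
  \sum_(m : loc W j) inner f (Phi m) * Phi m x.

Definition wproj l (f : X -> R) (x : X) : R :=
  \sum_(p : wtype d * loc W l) inner f (Psi_pair p) * Psi_pair p x.

(** Inner product of the projections of two functions to [V_j]. *)
Definition ipV j (f g : X -> R) : R :=
  \sum_(m : loc W j) inner f (Phi m) * inner g (Phi m).

Definition ipW l (f g : X -> R) : R :=
  \sum_(p : wtype d * loc W l) inner f (Psi_pair p) * inner g (Psi_pair p).

Lemma bmeas_projV j f : (J0 <= j)%N -> bmeas (projV j f).
Proof. by move=> Jj; apply: bmeas_lin => m; exact: bmeas_Phi. Qed.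

Lemma bmeas_wproj j f : (J0 <= j)%N -> bmeas (wproj j f).
Proof. by move=> Jj; apply: bmeas_lin => m; exact: bmeas_Psi. Qed.

Lemma inner_projV j f g : (J0 <= j)%N -> bmeas g ->
  inner (projV j f) g = ipV j f g.
Proof.
move=> Jj bg; rewrite /projV inner_suml//; last by move=> i; exact: bmeas_Phi.
by apply: eq_bigr => m _; rewrite (innerC g).
Qed.

Lemma inner_wproj j f g : (J0 <= j)%N -> bmeas g ->
  inner (wproj j f) g = ipW j f g.
Proof.
move=> Jj bg; rewrite /wproj inner_suml//; last by move=> i; exact: bmeas_Psi.
by apply: eq_bigr => m _; rewrite (innerC g).
Qed.

Lemma projVE j f x : (J0 <= j)%N -> bmeas f ->
  projV j f x = inner f (proj_kernel W j x).
Proof.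
move=> Jj bf; rewrite innerC /proj_kernel inner_suml//.
  by apply: eq_bigr => m _; rewrite innerC mulrC.
by move=> m; exact: bmeas_Phi.
Qed.

Lemma wprojE j f x : (J0 <= j)%N -> bmeas f ->
  wproj j f x = inner f (wave_kernel j x).
Proof.
move=> Jj bf; rewrite innerC /wave_kernel inner_suml//.
  by apply: eq_bigr => m _; rewrite innerC mulrC.
by move=> m; exact: bmeas_Psi.
Qed.

Lemma projVS j f x : (J0 <= j)%N -> bmeas f ->
  projV j.+1 f x = projV j f x + wproj j f x.
Proof.
move=> Jj bf; rewrite !projVE// ?wprojE//; last exact: leqW.
rewrite ![inner f _]innerC -innerDl//; first last.
- by apply: bmeas_lin => m; exact: bmeas_Psi.
- by apply: bmeas_lin => m; exact: bmeas_Phi.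
by congr inner; apply/funext => y; rewrite proj_kernelS.
Qed.

Lemma projV_range j L f x : (J0 <= j)%N -> (j <= L)%N -> bmeas f ->
  projV L f x = projV j f x + \sum_(j <= l < L) wproj l f x.
Proof.
move=> Jj + bf; elim: L => [|L IH].
  by rewrite leqn0 => /eqP->; rewrite big_geq ?addr0.
rewrite leq_eqVlt => /orP[/eqP<-|]; first by rewrite big_geq ?addr0.
rewrite ltnS => jL; rewrite big_nat_recr//= addrA -IH//.
by rewrite projVS//; exact: leq_trans jL.
Qed.

Lemma ipVS j f g : (J0 <= j)%N -> bmeas f -> bmeas g ->
  ipV j.+1 f g = ipV j f g + ipW j f g.
Proof.
move=> Jj bf bg; rewrite -!inner_projV// -?inner_wproj//; last exact: leqW.
rewrite -innerDl//; [|exact: bmeas_projV|exact: bmeas_wproj].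
by congr inner; apply/funext => y; rewrite projVS.
Qed.

Lemma ipV_range j L f g : (J0 <= j)%N -> (j <= L)%N -> bmeas f -> bmeas g ->
  ipV L f g = ipV j f g + \sum_(j <= l < L) ipW l f g.
Proof.
move=> Jj + bf bg; elim: L => [|L IH].
  by rewrite leqn0 => /eqP->; rewrite big_geq ?addr0.
rewrite leq_eqVlt => /orP[/eqP<-|]; first by rewrite big_geq ?addr0.
rewrite ltnS => jL; rewrite big_nat_recr//= addrA -IH//.
by rewrite ipVS//; exact: leq_trans jL.
Qed.

Lemma ipVC j f g : ipV j f g = ipV j g f.
Proof. by apply: eq_bigr => m _; rewrite mulrC. Qed.

Lemma inner_projV_Phi j f (m : loc W j) : (J0 <= j)%N ->
  inner (projV j f) (Phi m) = inner f (Phi m).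
Proof.
move=> Jj; rewrite /projV inner_lin_ortho//.
  by move=> i; exact: bmeas_Phi.
exact: (cdv_Phi_orthonormal HW).
Qed.

(** [V_j] is contained in [V_L], so projecting to [V_L] first changes nothing. *)
Lemma projV_id j L f : (J0 <= j)%N -> (j <= L)%N -> projV L (projV j f) = projV j f.
Proof.
move=> Jj jL; apply/funext => x.
have bp : bmeas (projV j f) by exact: bmeas_projV.
rewrite (projV_range _ Jj jL bp) big_nat big1 ?addr0 => [|l /andP[jl lL]].
  by apply: eq_bigr => m _; rewrite inner_projV_Phi.
rewrite /wproj big1// => p _.
have Jl := leq_trans Jj jl.
rewrite inner_suml//; first last.
- exact: bmeas_Psi.
- by move=> i; exact: bmeas_Phi.
by rewrite big1 ?mul0r// => m _; rewrite Phi_Psi_ortho ?mulr0.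
Qed.

Lemma inner_projV_projV j L f g : (J0 <= j)%N -> (j <= L)%N ->
  bmeas f -> bmeas g -> inner (projV j f) (projV L g) = ipV j f g.
Proof.
move=> Jj jL bf bg; have JL := leq_trans Jj jL.
rewrite innerC inner_projV//; last exact: bmeas_projV.
by rewrite ipVC -inner_projV// projV_id// inner_projV.
Qed.

End wavelet_projections.

(** * Hoelder norms through wavelet coefficients *)

Lemma bmeas_Lfun2 {disp} {T : measurableType disp} {R : realType}
    (P : probability T R) (f : T -> R) : bmeas f -> f \in Lfun P 2%:E.
Proof.
move=> bf; apply/andP; split; first by rewrite inE/=; exact: bf.1.
rewrite inE/= /finite_norm unlock /Lnorm poweR_lty//.
have b2 : bmeas (fun x => `|f x| `^ 2).
  rewrite (_ : (fun x => _) = fun x => `|f x| ^+ 2); last first.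
    by apply/funext => x; rewrite powR_mulrn.
  by apply: bmeasX; exact: bmeas_norm.
by rewrite -EFin_Rint// ltry.
Qed.

Lemma pow2N_lt1 {R : realType} (a : R) : 0 < a -> 2 `^ (- a) < 1 :> R.
Proof.
move=> a0; rewrite /powR pnatr_eq0/= expR_lt1 mulNr oppr_lt0 mulr_gt0//.
by rewrite ln_gt0// ltr1n.
Qed.

Lemma geo_sum_le {R : realType} (a : R) j L : 0 < a -> (j <= L)%N ->
  \sum_(j <= l < L) 2 `^ (- (l%:R * a)) <=
  2 `^ (- (j%:R * a)) / (1 - 2 `^ (- a)).
Proof.
move=> a0 jL; set q := 2 `^ (- a).
have qE l : 2 `^ (- (l%:R * a)) = q ^+ l.
  by rewrite -powR_mulrn ?powR_ge0// /q -powRrM; congr (_ `^ _); ring.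
have q0 : 0 < q by exact: powR_gt0.
have q1 : q < 1 by exact: pow2N_lt1.
rewrite qE ler_pdivlMr ?subr_gt0//.
suff -> : (\sum_(j <= l < L) 2 `^ (- (l%:R * a))) * (1 - q) = q ^+ j - q ^+ L.
  by rewrite gerBl exprn_ge0// ltW.
elim: L jL => [|L IH].
  by rewrite leqn0 => /eqP->; rewrite big_geq// mul0r subrr.
rewrite leq_eqVlt => /orP[/eqP<-|]; first by rewrite big_geq// mul0r subrr.
rewrite ltnS => jL; rewrite big_nat_recr//= mulrDl IH// qE exprS; ring.
Qed.

Section hoelder_coefficients.
Context {R : realType} {d : nat}.
Variable W : wavelets R d.
Hypothesis HW : cdv_basis W.
Hypothesis d0 : (0 < d)%N.
Local Notation J0 := (base_level W).
Local Notation X := (d.-tuple R).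

Lemma wtype_inhabited : exists iota : wtype d, True.
Proof.
have h : [ffun=> true] != [ffun=> false] :> {ffun 'I_d -> bool}.
  by apply/eqP => /ffunP/(_ (Ordinal d0)); rewrite !ffunE.
by exists (Sub [ffun=> true] h).
Qed.

Lemma loc_inhabited l : (J0 <= l)%N -> exists m : loc W l, True.
Proof.
move=> Jl; have [c c0 /(_ l Jl)/andP[cl _]] := cdv_card HW.
have [m _|no] := pickP (@predT (loc W l)); first by exists m.
move: cl; rewrite eq_card0// leNgt => /negP[].
by rewrite mulr_gt0 ?invr_gt0// ltr0n expn_gt0.
Qed.

Definition coef_bounds (a : R) (h : X -> R) (bPhi bPsi : R) :=
  [/\ 0 <= bPhi, 0 <= bPsi,
    forall m : loc W J0,
      2 `^ (J0%:R * (a + d%:R / 2)) * `|inner h (Phi m)| <= bPhi &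
    forall l (p : wtype d * loc W l), (J0 <= l)%N ->
      2 `^ (l%:R * (a + d%:R / 2)) * `|inner h (Psi_pair p)| <= bPsi].

(** The supremum in the norm ranges over a nonempty set, hence is nonnegative, so
    that a finite norm splits into two finite real bounds. *)
Lemma holder_normP a h M : (holder_norm W a h <= M%:E)%E <->
  exists bPhi bPsi, coef_bounds a h bPhi bPsi /\ bPhi + bPsi <= M.
Proof.
rewrite /holder_norm; set c := 2 `^ _; set mx := \big[_/_]_m _.
set A := [set y | _].
have c0 : 0 <= c by exact: powR_ge0.
have mx0 : 0 <= mx by exact: bigmax_ge_id.
split => [|[B [B' [[B0 B'0 HB HB'] BM]]]].
- have [iota _] := wtype_inhabited.
  have [m _] := loc_inhabited (leqnn J0).
  have s0 : (0 <= ereal_sup A)%E.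
    apply: (@le_trans _ _ (2 `^ (J0%:R * (a + d%:R / 2)) *
      `|inner h (Psi iota m)|)%:E).
      by rewrite lee_fin mulr_ge0// powR_ge0.
    by apply: ereal_sup_ubound; exists J0, iota, m.
  case: (ereal_sup A) s0 (@ereal_sup_ubound _ A) => [s| |]; first last.
  + by rewrite leeNy_eq.
  + by move=> _ _; rewrite addey// leye_eq.
  rewrite lee_fin => s0 sub; rewrite -EFinD lee_fin => sM.
  exists (c * mx), s; split => //; split => // [|m'|l [i m'] Jl].
  + by rewrite mulr_ge0.
  + by rewrite ler_wpM2l//; exact: le_bigmax.
  + by rewrite -lee_fin; apply: sub; exists l, i, m'.
- apply: (@le_trans _ _ (B%:E + B'%:E)%E); last by rewrite -EFinD lee_fin.
  apply: leeD.
    rewrite lee_fin; have [cE|cn0] := eqVneq c 0; first by rewrite cE mul0r.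
    have cgt0 : 0 < c by rewrite lt_neqAle eq_sym cn0.
    rewrite mulrC -ler_pdivlMr//; apply: bigmax_le; first by rewrite divr_ge0.
    by move=> m _; rewrite ler_pdivlMr// mulrC; exact: HB.
  apply: ge_ereal_sup => _ [l [i [m [Jl ->]]]].
  by rewrite lee_fin; exact: (HB' l (i, m)).
Qed.

Lemma coef_boundsD a f g B1 B1' B2 B2' : bmeas f -> bmeas g ->
  coef_bounds a f B1 B1' -> coef_bounds a g B2 B2' ->
  coef_bounds a (fun x => f x + g x) (B1 + B2) (B1' + B2').
Proof.
move=> bf bg [h1 h2 h3 h4] [k1 k2 k3 k4]; split; try exact: addr_ge0.
- move=> m; have bP := bmeas_Phi HW m (leqnn _); rewrite innerDl//.
  by rewrite (le_trans _ (lerD (h3 m) (k3 m)))// -mulrDr ler_wpM2l ?powR_ge0// ler_normD.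
- move=> l p Jl; have bP := bmeas_Psi HW p Jl; rewrite innerDl//.
  by rewrite (le_trans _ (lerD (h4 l p Jl) (k4 l p Jl)))// -mulrDr ler_wpM2l ?powR_ge0// ler_normD.
Qed.

Lemma coef_boundsZ a c f B B' : bmeas f -> coef_bounds a f B B' ->
  coef_bounds a (fun x => c * f x) (`|c| * B) (`|c| * B').
Proof.
move=> bf [h1 h2 h3 h4]; split; try by rewrite mulr_ge0.
- move=> m; have bP := bmeas_Phi HW m (leqnn _).
  by rewrite innerZl// normrM mulrCA ler_wpM2l.
- move=> l p Jl; have bP := bmeas_Psi HW p Jl.
  by rewrite innerZl// normrM mulrCA ler_wpM2l//; exact: h4.
Qed.

Lemma holder_norm_comb a f g c1 c2 M1 M2 : bmeas f -> bmeas g ->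
  (holder_norm W a f <= M1%:E)%E -> (holder_norm W a g <= M2%:E)%E ->
  (holder_norm W a (fun x => c1 * f x + c2 * g x)%R <=
    (`|c1| * M1 + `|c2| * M2)%:E)%E.
Proof.
move=> bf bg /holder_normP[B1 [B1' [h1 m1]]] /holder_normP[B2 [B2' [h2 m2]]].
have bc := bmeas_cst; apply/holder_normP.
exists (`|c1| * B1 + `|c2| * B2), (`|c1| * B1' + `|c2| * B2'); split.
  by apply: coef_boundsD; try exact: bmeasM; exact: coef_boundsZ.
have := ler_wpM2l (normr_ge0 c1) m1; have := ler_wpM2l (normr_ge0 c2) m2; lra.
Qed.

Section consequences.
Variables (a M : R).
Hypothesis a0 : 0 < a.

Lemma holder_Psi_le h l (p : wtype d * loc W l) :
  (holder_norm W a h <= M%:E)%E -> (J0 <= l)%N ->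
  `|inner h (Psi_pair p)| <= M * 2 `^ (- (l%:R * (a + d%:R / 2))).
Proof.
move=> /holder_normP[B [B' [[B0 B'0 HB HB'] BM]]] Jl.
rewrite powRN ler_pdivlMr ?powR_gt0// mulrC; apply: le_trans (HB' l p Jl) _.
by rewrite (le_trans _ BM)// lerDr.
Qed.

Lemma holder_Phi_le h (m : loc W J0) :
  (holder_norm W a h <= M%:E)%E -> `|inner h (Phi m)| <= M.
Proof.
move=> /holder_normP[B [B' [[B0 B'0 HB HB'] BM]]].
apply: (@le_trans _ _ B); last by rewrite (le_trans _ BM)// lerDl.
apply: le_trans (HB m); rewrite ler_peMl//.
rewrite -[leLHS](powRr0 (2 : R)) ler_powR ?ler1n// mulr_ge0//.
by rewrite addr_ge0 ?divr_ge0 ?ler0n ?(ltW a0).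
Qed.

Lemma holder_norm_ge0 h : (holder_norm W a h <= M%:E)%E -> 0 <= M.
Proof.
move=> /holder_normP[B [B' [[B0 B'0 _ _] BM]]].
by rewrite (le_trans _ BM)// addr_ge0.
Qed.

(** Each wavelet level contributes at most a multiple of [2^(-la)], so the
    projections stay bounded uniformly in the level. *)
Lemma holder_proj_le : exists B, 0 <= B /\ forall h j x, bmeas h ->
  (holder_norm W a h <= M%:E)%E -> (J0 <= j)%N -> `|projV W j h x| <= B.
Proof.
have [C [CPhi CPsi]] := cdv_frames HW.
set B1 := `|M| * C ^+ 2 * 2 `^ (J0%:R * (d%:R / 2)).
set B2 := `|M| * C ^+ 2 * (2 `^ (- (J0%:R * a)) / (1 - 2 `^ (- a))).
have q1 : 0 < 1 - 2 `^ (- a) :> R.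
  by rewrite subr_gt0 pow2N_lt1.
have C20 : 0 <= `|M| * C ^+ 2 by rewrite mulr_ge0// sqr_ge0.
have B10 : 0 <= B1 by rewrite mulr_ge0// powR_ge0.
have B20 : 0 <= B2.
  by rewrite mulr_ge0// divr_ge0 ?powR_ge0// ltW.
exists (B1 + B2); split; first exact: addr_ge0.
move=> h j x bh hM Jj; have M0 := holder_norm_ge0 hM.
rewrite (projV_range HW _ (leqnn J0) Jj bh) (le_trans (ler_normD _ _))// lerD//.
  rewrite (le_trans (ler_norm_sum _ _ _))// /B1 ger0_norm//.
  by apply: (frame_sum_le CPhi) => // i; exact: holder_Phi_le.
rewrite (le_trans (ler_norm_sum _ _ _))//.
apply: (@le_trans _ _ (\sum_(J0 <= l < j) `|M| * C ^+ 2 * 2 `^ (- (l%:R * a)))).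
  rewrite !big_nat; apply: ler_sum => l /andP[Jl _].
  rewrite (le_trans (ler_norm_sum _ _ _))// ger0_norm//.
  have := @frame_sum_le _ _ _ _ _ _ CPsi l (fun p => inner h (Psi_pair p))
    (M * 2 `^ (- (l%:R * (a + d%:R / 2)))) x Jl.
  move=> /(_ _ _)/wrap[||H].
  - by rewrite mulr_ge0// powR_ge0.
  - by move=> i; exact: holder_Psi_le.
  apply: le_trans H _; rewrite le_eqVlt; apply/orP; left; apply/eqP.
  have -> : 2 `^ (- (l%:R * a)) = 2 `^ (- (l%:R * (a + d%:R / 2))) *
      2 `^ (l%:R * (d%:R / 2)) :> R.
    rewrite -powRD; last by rewrite (_ : 2 != 0 :> R) ?implybT.
    by congr (_ `^ _); ring.
  ring.
by rewrite -mulr_sumr ler_wpM2l ?geo_sum_le.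
Qed.

End consequences.
End hoelder_coefficients.

(** * Approximation error of the projections *)

Section approximation_bias.
Context {R : realType} {d : nat}.
Variable W : wavelets R d.
Hypothesis HW : cdv_basis W.
Local Notation J0 := (base_level W).
Local Notation X := (d.-tuple R).

Lemma inner_Psi_Psi l l' (p : wtype d * loc W l) (p' : wtype d * loc W l') :
  (J0 <= l)%N -> (J0 <= l')%N -> l != l' ->
  inner (Psi_pair p) (Psi_pair p') = 0.
Proof. by move=> Jl Jl' ll; apply: (cdv_Psi_orthogonal HW). Qed.

Lemma projV_Psi_ge j l (p : wtype d * loc W l) : (J0 <= j)%N -> (j <= l)%N ->
  projV W j (Psi_pair p) = fun=> 0.
Proof.
move=> Jj jl; apply/funext => x; rewrite /projV big1// => m _.
by rewrite innerC Phi_Psi_ortho// mul0r.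
Qed.

Lemma wprojV_Psi l (p : wtype d * loc W l) : (J0 <= l)%N ->
  wproj W l (Psi_pair p) = Psi_pair p.
Proof.
move=> Jl; apply/funext => x; rewrite /wproj (bigD1 p)//=.
rewrite (cdv_Psi_orthonormal HW)// eqxx mul1r big1 ?addr0// => q qp.
by rewrite (cdv_Psi_orthonormal HW)// eq_sym (negbTE qp) mul0r.
Qed.

Lemma projV_Psi_lt j l (p : wtype d * loc W l) : (J0 <= l)%N -> (l < j)%N ->
  projV W j (Psi_pair p) = Psi_pair p.
Proof.
move=> Jl lj; apply/funext => x; have bP := bmeas_Psi HW p Jl.
rewrite (projV_range HW x Jl (ltnW lj) bP) projV_Psi_ge// add0r.
rewrite big_ltn// wprojV_Psi// big_nat big1 ?addr0// => l' /andP[ll' _].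
rewrite /wproj big1// => q _; rewrite inner_Psi_Psi ?mul0r//.
- by rewrite (leq_trans Jl)// ltnW.
- by rewrite neq_ltn ll'.
Qed.

Lemma projV_Phi j L (m : loc W j) : (J0 <= j)%N -> (j <= L)%N ->
  projV W L (Phi m) = Phi m.
Proof.
move=> Jj jL; have e : Phi m = projV W j (Phi m).
  apply/funext => x; rewrite /projV (bigD1 m)//=.
  rewrite (cdv_Phi_orthonormal HW)// eqxx mul1r big1 ?addr0// => q qp.
  by rewrite (cdv_Phi_orthonormal HW)// eq_sym (negbTE qp) mul0r.
by rewrite e projV_id.
Qed.

Lemma inner_projV_sym L f g : (J0 <= L)%N -> bmeas f -> bmeas g ->
  inner (projV W L f) g = inner f (projV W L g).
Proof. by move=> JL bf bg; rewrite (innerC f) !inner_projV// ipVC. Qed.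

(** The projection to [V_L] is at least as close to [f] as any finite wavelet
    sum of levels below [L]; the latter are dense. *)
Lemma projV_dense f (e : R) : bmeas f -> 0 < e ->
  exists L0, forall L, (L0 <= L)%N -> (J0 <= L)%N ->
    \int[unif]_x ((f x - projV W L f x) ^+ 2) < e.
Proof.
move=> bf e0; have [L0 [a [b ab]]] := cdv_total HW (bmeas_Lfun2 unif bf) e0.
exists L0 => L L0L JL; have bp : bmeas (projV W L f) by exact: bmeas_projV.
set s := fun x => \sum_(m : loc W J0) a m * Phi m x +
  \sum_(J0 <= l < L0) \sum_(p : wtype d * loc W l) b l p * Psi_pair p x.
have fsE : \int[unif]_x ((f x - s x) ^+ 2) < e.
  by under eq_Rintegral do rewrite /s opprD addrA.
have bl l : (J0 <= l)%N -> bmeas (fun x => \sum_(p : wtype d * loc W l) b l p * Psi_pair p x).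
  by move=> Jl; apply: bmeas_lin => p; exact: bmeas_Psi.
have bs1 : bmeas (fun x => \sum_(m : loc W J0) a m * Phi m x).
  by apply: bmeas_lin => m; exact: bmeas_Phi.
have bs2 : bmeas (fun x => \sum_(J0 <= l < L0)
    \sum_(p : wtype d * loc W l) b l p * Psi_pair p x).
  under eq_fun do rewrite big_nat.
  by apply: bmeas_sum_cond => l /andP[Jl _]; exact: bl.
have bs : bmeas s by exact: bmeasD.
set r := fun x => f x - projV W L f x; have br : bmeas r by exact: bmeasB.
have rV g : bmeas g -> projV W L g = g -> inner r g = 0.
  by move=> bg pg; rewrite innerBl// inner_projV_sym// pg subrr.
have rs : inner r s = 0.
  rewrite innerC innerDl// [X in X + _]inner_suml//; last first.
    by move=> m; exact: bmeas_Phi.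
  rewrite big1 ?add0r => [|m _]; last first.
    rewrite innerC rV ?mulr0//; first exact: bmeas_Phi.
    by rewrite projV_Phi.
  rewrite /inner; transitivity (\int[unif]_x \sum_(J0 <= l < L0)
      ((\sum_(p : wtype d * loc W l) b l p * Psi_pair p x) * r x)).
    by apply: eq_Rintegral => x _; rewrite mulr_suml.
  under eq_Rintegral do rewrite big_nat.
  rewrite Rint_sum_cond; last first.
    by move=> l /andP[Jl _]; apply: bmeasM => //; exact: bl.
  rewrite big1// => l /andP[Jl lL]; rewrite -/(inner _ r) inner_suml//; last first.
    by move=> p; exact: bmeas_Psi.
  rewrite big1// => p _; rewrite innerC rV ?mulr0//; first exact: bmeas_Psi.
  by rewrite projV_Psi_lt//; exact: leq_trans L0L.
have rp : inner r (projV W L f) = 0 by rewrite rV// projV_id.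
have rr : \int[unif]_x (r x ^+ 2) = inner r (fun x => f x - s x).
  rewrite innerC innerBl// (innerC s) rs subr0 -[LHS]/(inner r r).
  by rewrite {1}/r innerBl// (innerC (projV W L f)) rp subr0.
have := Rint_cauchy_schwarz unif br (bmeasB bf bs).
rewrite -[X in X ^+ 2]/(inner r (fun x => f x - s x)) -rr.
have : 0 <= \int[unif]_x (r x ^+ 2) by apply: Rint_ge0 => x; exact: sqr_ge0.
rewrite -[X in X < _]/(\int[unif]_x (r x ^+ 2)).
move: (\int[unif]_x (r x ^+ 2)) fsE => A fsE A0.
rewrite leNgt => CS; rewrite ltNge; apply/negP => eA; move/negP: CS; apply.
rewrite expr2 ltr_pM2l ?(lt_le_trans e0 eA)//.
exact: lt_le_trans fsE eA.
Qed.

(** Parseval over the levels from [j] on: a level contributes the product of the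
    coefficient bounds times the number of wavelets, [2^(-l(alpha+beta))] up to
    a constant. *)
Lemma approximation_bias (d0 : (0 < d)%N) (a b M : R) : 0 < a -> 0 < b ->
  exists C, 0 <= C /\ forall f g j, bmeas f -> bmeas g ->
  (holder_norm W a f <= M%:E)%E -> (holder_norm W b g <= M%:E)%E -> (J0 <= j)%N ->
  `|inner f g - ipV W j f g| <= C * 2 `^ (- (j%:R * (a + b))).
Proof.
move=> a0 b0; have ab0 : 0 < a + b by exact: addr_gt0.
have [c c0 card_c] := cdv_card HW.
pose C1 := #|{: wtype d}|%:R * c * M ^+ 2.
have q1 : 0 < 1 - 2 `^ (- (a + b)) :> R by rewrite subr_gt0 pow2N_lt1.
have C10 : 0 <= C1 by rewrite /C1 mulr_ge0 ?sqr_ge0// mulr_ge0// ltW.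
exists (C1 / (1 - 2 `^ (- (a + b)))); split; first by rewrite divr_ge0// ltW.
move=> f g j bf bg hf hg Jj.
have M0 := holder_norm_ge0 HW d0 hf.
have lev l : (J0 <= l)%N -> `|ipW W l f g| <= C1 * 2 `^ (- (l%:R * (a + b))).
  move=> Jl; rewrite (le_trans (ler_norm_sum _ _ _))//.
  pose B := M ^+ 2 * (2 `^ (- (l%:R * (a + d%:R / 2))) *
                      2 `^ (- (l%:R * (b + d%:R / 2)))).
  apply: (@le_trans _ _ (\sum_(p : wtype d * loc W l) B)).
    apply: ler_sum => p _; rewrite normrM.
    rewrite [B](_ : _ = (M * 2 `^ (- (l%:R * (a + d%:R / 2)))) *
      (M * 2 `^ (- (l%:R * (b + d%:R / 2))))); last by rewrite /B; ring.
    by apply: ler_pM => //; exact: holder_Psi_le.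
  rewrite sumr_const card_prod -[_ *+ _]mulr_natr natrM.
  have /andP[_ lc] := card_c l Jl.
  have -> : C1 * 2 `^ (- (l%:R * (a + b))) =
      B * (#|{: wtype d}|%:R * (c * (2 ^ (l * d))%:R)).
    have -> : (2 ^ (l * d))%:R = 2 `^ (l%:R * d%:R) :> R.
      by rewrite -natrM powR_mulrn// natrX.
    have -> : 2 `^ (- (l%:R * (a + b))) = 2 `^ (- (l%:R * (a + d%:R / 2))) *
        2 `^ (- (l%:R * (b + d%:R / 2))) * 2 `^ (l%:R * d%:R) :> R.
      rewrite -!powRD; try by rewrite (_ : 2 != 0 :> R) ?implybT.
      by congr (_ `^ _); field.
    by rewrite /B /C1; ring.
  apply: ler_wpM2l; last by rewrite ler_wpM2l.
  by rewrite /B mulr_ge0 ?sqr_ge0// mulr_ge0// powR_ge0.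
rewrite leNgt; apply/negP; set T := _ * _ => hT.
set D := inner f g - ipV W j f g in hT.
(* [e] makes the tail beyond [V_L] smaller than the assumed excess of [D] over [T]. *)
have [K fK] := bg.2; pose e := (`|D| - T) ^+ 2 / (2 * (K ^+ 2 + 1)).
have K1 : 0 < K ^+ 2 + 1 by rewrite ltr_wpDl ?sqr_ge0.
have e0 : 0 < e by apply: divr_gt0; [rewrite exprn_gt0// subr_gt0|rewrite mulr_gt0].
have [L0 HL] := projV_dense bf e0.
pose L := maxn L0 j; have jL : (j <= L)%N by exact: leq_maxr.
have JL : (J0 <= L)%N by exact: leq_trans jL.
have := HL L (leq_maxl _ _) JL.
set r := fun x => f x - projV W L f x.
have br : bmeas r by apply: bmeasB => //; exact: bmeas_projV.
have DE : D = inner r g + \sum_(j <= l < L) ipW W l f g.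
  rewrite /D innerBl//; last exact: bmeas_projV.
  by rewrite inner_projV// (ipV_range HW Jj jL bf bg); ring.
have sumT : `|\sum_(j <= l < L) ipW W l f g| <= T.
  rewrite (le_trans (ler_norm_sum _ _ _))//.
  apply: (@le_trans _ _ (\sum_(j <= l < L) C1 * 2 `^ (- (l%:R * (a + b))))).
    rewrite !big_nat; apply: ler_sum => l /andP[jl _].
    by apply: lev; exact: leq_trans jl.
  rewrite -mulr_sumr (le_trans (ler_wpM2l C10 (geo_sum_le ab0 jL)))//.
  by rewrite /T mulrA mulrAC.
have rD : `|D| - T <= `|inner r g|.
  rewrite lerBlDr DE (le_trans (ler_normD _ _))// lerD2l//.
have := Rint_cauchy_schwarz unif br bg; rewrite -[X in X ^+ 2]/(inner r g).
have gK : \int[unif]_x (g x ^+ 2) <= K ^+ 2.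
  apply: Rint_le; first exact: bmeasX.
  by move=> x; rewrite -real_normK ?num_real// lerXn2r ?nnegrE// (le_trans _ (fK x)).
have g0 : 0 <= \int[unif]_x (g x ^+ 2) by apply: Rint_ge0 => x; exact: sqr_ge0.
have r0 : 0 <= \int[unif]_x (r x ^+ 2) by apply: Rint_ge0 => x; exact: sqr_ge0.
rewrite -[X in X < _]/(\int[unif]_x (r x ^+ 2)).
have rsq : (`|D| - T) ^+ 2 <= inner r g ^+ 2.
  rewrite -[leRHS]real_normK ?num_real// lerXn2r ?nnegrE// subr_ge0; exact: ltW.
have eE : e * (2 * (K ^+ 2 + 1)) = (`|D| - T) ^+ 2.
  by rewrite /e divfK// mulf_neq0// gt_eqF.
move: (\int[unif]_x (r x ^+ 2)) (\int[unif]_x (g x ^+ 2)) gK g0 r0 => A G gK g0 r0.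
move=> CS Ae; have : A * G <= e * K ^+ 2 by rewrite ler_pM// ltW.
have := sqr_ge0 K; nra.
Qed.

End approximation_bias.

(** * Empirical means *)

Section empirical.
Context {R : realType} {d : nat}.
Local Notation obs := (d.-tuple R * R * R)%type.
Local Notation X := (d.-tuple R).

Lemma measurable_obsX : measurable_fun setT (@obsX R d).
Proof. exact: (measurableT_comp measurable_fst measurable_fst). Qed.

HB.instance Definition _ :=
  isMeasurableFun.Build _ _ _ _ (@obsX R d) measurable_obsX.

Variable P : probability obs R.

Lemma bmeas_obsX (h : X -> R) : bmeas h -> bmeas (fun o : obs => h (obsX o)).
Proof. exact: (bmeas_comp measurable_obsX). Qed.

Definition emp n (f : obs -> R) (D : n.-tuple obs) : R := n%:R^-1 * tsum f D.

Lemma bmeas_emp n f : bmeas f -> bmeas (@emp n f).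
Proof. by move=> bf; apply: bmeasM; [exact: bmeas_cst|exact: bmeas_tsum]. Qed.

Lemma emp_center n f c D : (0 < n)%N ->
  @emp n f D - c = @emp n (fun o => f o - c) D.
Proof.
move=> n0; rewrite /emp /tsum sumrB mulrBr sumr_const card_ord -[c *+ n]mulr_natl.
by congr (_ - _); rewrite mulrA mulVf ?mul1r// pnatr_eq0 -lt0n.
Qed.

Lemma emp_var n f : (0 < n)%N -> bmeas f ->
  \int[iid P n]_D ((emp f D - \int[P]_o f o) ^+ 2) <=
  n%:R^-1 * \int[P]_o (f o ^+ 2).
Proof.
move=> n0 bf; set c := \int[P]_o f o.
have bg : bmeas (fun o => f o - c) by apply: bmeasB => //; exact: bmeas_cst.
under eq_Rintegral do rewrite emp_center// /emp exprMn [_^-1 ^+ 2]expr2 -mulrA.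
have bT := bmeasX 2 (bmeas_tsum n bg).
rewrite RintZl; last by apply: bmeasM => //; exact: bmeas_cst.
rewrite ler_wpM2l// RintZl//.
under eq_Rintegral do rewrite expr2.
rewrite Rint_tsumM// RintB ?Rint_cst//; last exact: bmeas_cst.
rewrite subrr mul0r mulr0 addr0. rewrite mulrA mulVf ?mul1r ?pnatr_eq0 -?lt0n//.
have bf2 := bmeasX 2 bf; have bc := bmeas_cst.
have -> : \int[P]_z ((f z - c) * (f z - c)) =
    \int[P]_z (f z ^+ 2 - 2 * c * f z + c ^+ 2).
  by apply: eq_Rintegral => z _; ring.
have b2 : bmeas (fun z => 2 * c * f z) by exact: bmeasM.
rewrite RintD ?RintB ?RintZl ?Rint_cst//; last exact: bmeasB.
have := sqr_ge0 c; rewrite -/c; nra.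
Qed.

Section marginal.
Hypothesis PX : forall B, measurable B -> P (@obsX R d @^-1` B) = unif B.

Lemma Rint_obsX (h : X -> R) : bmeas h ->
  \int[P]_o h (obsX o) = \int[unif]_x h x.
Proof.
move=> bh; rewrite -(Rint_distribution P (@obsX R d))//.
rewrite /Rintegral; congr fine; apply: eq_measure_integral => A mA _.
exact: PX.
Qed.

End marginal.
End empirical.

(** * The quadratic statistic *)

(** [a1], [a2] stand for the fourth moments of the centred vectors and [l1], [l2]
    for the second moments of the linear terms. *)
Lemma quad_arith {R : realFieldType} (a1 a2 l1 l2 Q b4 v k : R) :
  0 <= Q -> 0 <= b4 -> 0 <= v -> 0 <= k ->
  a1 <= 7 * Q * k -> a2 <= 7 * Q * k -> l1 <= b4 * v -> l2 <= b4 * v ->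
  3 * ((2^-1 * a1 + 2^-1 * a2) + (l1 + l2)) <= 3 * (7 * Q + 2 * b4) * (v + k).
Proof.
move=> Q0 b0 v0 k0 h1 h2 h3 h4.
have := mulr_ge0 Q0 v0; have := mulr_ge0 b0 k0; lra.
Qed.

Section quadratic_risk.
Context {R : realType} {d : nat}.
Local Notation obs := (d.-tuple R * R * R)%type.
Local Notation X := (d.-tuple R).
Variable W : wavelets R d.
Hypothesis HW : cdv_basis W.
Local Notation J0 := (base_level W).
Local Notation K j := (resolution d j)%:R.

Definition feat j (U : obs -> R) (m : loc W j) (o : obs) : R :=
  U o * Phi m (obsX o).

Definition coef (P : probability obs R) j (U : obs -> R) (m : loc W j) : R :=
  \int[P]_o feat U m o.

Lemma bmeas_feat j U (m : loc W j) : (J0 <= j)%N -> bmeas U -> bmeas (feat U m).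
Proof.
by move=> Jj bU; apply: bmeasM => //; apply: bmeas_obsX; exact: bmeas_Phi.
Qed.

(** The integral over the cube of the product of the two smoothers at level [j]. *)
Definition emp_quad j n (U V : obs -> R) (D : n.-tuple obs) : R :=
  \sum_(m : loc W j) emp (feat U m) D * emp (feat V m) D.

Lemma bmeas_emp_quad j n U V : (J0 <= j)%N -> bmeas U -> bmeas V ->
  bmeas (@emp_quad j n U V).
Proof.
move=> Jj bU bV; apply: bmeas_sum => m.
by apply: bmeasM; apply: bmeas_emp; exact: bmeas_feat.
Qed.

Variable C : R.
Hypothesis CPhi : frame_bounds J0 (@Phi _ _ W) C.

Let C0 : 0 <= C. Proof. by have [C1 _] := CPhi; exact: le_trans C1. Qed.

Lemma Phi_sqr_sum_le j x : (J0 <= j)%N ->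
  \sum_(m : loc W j) Phi m x ^+ 2 <= C ^+ 3 * K j.
Proof. by move=> Jj; exact: (frame_sqr_sum_le CPhi). Qed.

Section fixed_law.
Variable P : probability obs R.
Hypothesis PX : forall B, measurable B -> P (@obsX R d @^-1` B) = unif B.
Variable B : R.

(** Bessel's inequality. *)
Lemma coef_sqr_sum_le j U : (J0 <= j)%N -> bmeas U -> (forall o, `|U o| <= B) ->
  \sum_(m : loc W j) coef P U m ^+ 2 <= B ^+ 2.
Proof.
move=> Jj bU UB; set s := \sum_m _.
have s0 : 0 <= s by apply: sumr_ge0 => m _; exact: sqr_ge0.
pose g x := \sum_(m : loc W j) coef P U m * Phi m x.
have bP (m : loc W j) : bmeas (Phi m) by exact: bmeas_Phi.
have bg : bmeas g by exact: bmeas_lin.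
have sE : s = \int[P]_o (U o * g (obsX o)).
  transitivity (\int[P]_o \sum_(m : loc W j) coef P U m * feat U m o).
    rewrite Rint_sum => [|m]; last first.
      by apply: bmeasM; [exact: bmeas_cst|exact: bmeas_feat].
    by apply: eq_bigr => m _; rewrite RintZl ?expr2//; exact: bmeas_feat.
  apply: eq_Rintegral => o _; rewrite mulr_sumr; apply: eq_bigr => m _.
  by rewrite /feat; ring.
have gE : \int[P]_o (g (obsX o) ^+ 2) = s.
  rewrite (Rint_obsX PX (h := fun x => g x ^+ 2)); last exact: bmeasX.
  rewrite -[LHS]/(inner g g) {1}/g inner_suml//; apply: eq_bigr => m _.
  by rewrite innerC inner_lin_ortho ?expr2//; exact: (cdv_Phi_orthonormal HW).
have := Rint_cauchy_schwarz P bU (bmeas_obsX bg); rewrite -sE gE.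
have UB2 : \int[P]_o (U o ^+ 2) <= B ^+ 2.
  by apply: Rint_le => [|o]; [exact: bmeasX|exact: sqr_le_of_norm].
move=> CS; have [->|sn0] := eqVneq s 0; first exact: sqr_ge0.
have sgt : 0 < s by rewrite lt_neqAle eq_sym sn0.
by move: CS; rewrite expr2 ler_pM2r// => /le_trans; exact.
Qed.

Definition centred j U (m : loc W j) (o : obs) : R := feat U m o - coef P U m.

Lemma bmeas_centred j U (m : loc W j) : (J0 <= j)%N -> bmeas U ->
  bmeas (centred U m).
Proof. by move=> Jj bU; apply: bmeasB; [exact: bmeas_feat|exact: bmeas_cst]. Qed.

Lemma centred0 j U (m : loc W j) : (J0 <= j)%N -> bmeas U ->
  \int[P]_o centred U m o = 0.
Proof.
move=> Jj bU; rewrite RintB ?Rint_cst ?subrr//; last exact: bmeas_cst.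
exact: bmeas_feat.
Qed.

Lemma feat_sqr_sum_le j U o : (J0 <= j)%N -> (forall o, `|U o| <= B) ->
  \sum_(m : loc W j) feat U m o ^+ 2 <= B ^+ 2 * (C ^+ 3 * K j).
Proof.
move=> Jj UB; under eq_bigr do rewrite exprMn.
rewrite -mulr_sumr; apply: ler_pM; first exact: sqr_ge0.
- by apply: sumr_ge0 => m _; exact: sqr_ge0.
- exact: sqr_le_of_norm.
- exact: Phi_sqr_sum_le.
Qed.

Lemma centred_sqn_le j U o : (J0 <= j)%N -> bmeas U -> (forall o, `|U o| <= B) ->
  sqn (fun m : loc W j => centred U m) o <= 4 * (B ^+ 2 * (C ^+ 3 * K j)).
Proof.
move=> Jj bU UB; set q := B ^+ 2 * _.
have h1 : \sum_(m : loc W j) feat U m o ^+ 2 <= q by exact: feat_sqr_sum_le.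
have h2 : \sum_(m : loc W j) coef P U m ^+ 2 <= q.
  apply: (@le_trans _ _ (\int[P]_o \sum_(m : loc W j) feat U m o ^+ 2)).
    rewrite Rint_sum => [|m]; last by apply: bmeasX; exact: bmeas_feat.
    by apply: ler_sum => m _; apply: Rint_sqr_ge; exact: bmeas_feat.
  apply: Rint_le => [|o']; last exact: feat_sqr_sum_le.
  by apply: bmeas_sum => m; apply: bmeasX; exact: bmeas_feat.
apply: (@le_trans _ _ (2 * (\sum_(m : loc W j) feat U m o ^+ 2) +
                       2 * (\sum_(m : loc W j) coef P U m ^+ 2))); last by lra.
rewrite !mulr_sumr -big_split/=; apply: ler_sum => m _; rewrite /centred.
have := sqr_ge0 (feat U m o + coef P U m); nra.
Qed.

Lemma emp_centred n j U (m : loc W j) D : (0 < n)%N ->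
  @emp R d n (feat U m) D - coef P U m = n%:R^-1 * tsum (centred U m) D.
Proof. exact: emp_center. Qed.

(** A feature vector has squared norm of order [K], and [n] independent centred
    vectors add up to a fourth moment of order [(n K)^2]. *)
Lemma centred_fourth_moment j U n : (0 < n)%N -> (J0 <= j)%N -> bmeas U ->
  (forall o, `|U o| <= B) ->
  \int[iid P n]_D
    ((\sum_(m : loc W j) (emp (feat U m) D - coef P U m) ^+ 2) ^+ 2) <=
  7 * (4 * (B ^+ 2 * (C ^+ 3 * K j))) ^+ 2 / n%:R ^+ 2.
Proof.
move=> n0 Jj bU UB; set q := 4 * _.
have nR : 0 < n%:R :> R by rewrite ltr0n.
have n1 : 1 <= n%:R :> R by rewrite ler1n.
pose xi (m : loc W j) := centred U m.
have bxi m : bmeas (xi m) by exact: bmeas_centred.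
have xi0 m : \int[P]_o xi m o = 0 by exact: centred0.
have qxi o : sqn xi o <= q by exact: centred_sqn_le.
have q0 : 0 <= q by apply: le_trans (qxi ([tuple 0 | i < d], 0, 0)); exact: sqn_ge0.
have -> : \int[iid P n]_D ((\sum_(m : loc W j)
    (emp (feat U m) D - coef P U m) ^+ 2) ^+ 2) =
    \int[iid P n]_D ((n%:R^-1) ^+ 4 * tsqn xi D ^+ 2).
  apply: eq_Rintegral => D _.
  have -> : \sum_(m : loc W j) (emp (feat U m) D - coef P U m) ^+ 2 =
      n%:R^-1 ^+ 2 * tsqn xi D.
    by rewrite /tsqn mulr_sumr; apply: eq_bigr => m _; rewrite emp_centred// exprMn.
  ring.
rewrite RintZl; last by apply: bmeasX; exact: bmeas_tsqn.
apply: (@le_trans _ _ (n%:R^-1 ^+ 4 * (7 * n%:R ^+ 2 * q ^+ 2))); last first.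
  by rewrite le_eqVlt; apply/orP; left; apply/eqP; field; rewrite lt0r_neq0.
rewrite ler_wpM2l ?exprn_ge0 ?invr_ge0//.
apply: le_trans (Rint_tsqn2 bxi xi0 n) _.
have bs : bmeas (sqn xi) by exact: bmeas_sqn.
have s1 : \int[P]_z sqn xi z <= q by exact: Rint_le.
have s0 : 0 <= \int[P]_z sqn xi z by apply: Rint_ge0 => z; exact: sqn_ge0.
have k1 : \int[P]_z sqn xi z ^+ 2 <= q ^+ 2.
  apply: Rint_le => [|z]; first exact: bmeasX.
  by apply: sqr_le_of_norm; rewrite ger0_norm// sqn_ge0.
move: s0 s1 k1; set s := \int[P]_z sqn xi z => s0 s1 k1.
have h : s ^+ 2 <= q ^+ 2 by rewrite lerXn2r.
have h4 := ler_wpM2l (mulr_ge0 (ler0n R 4) (sqr_ge0 n%:R)) h.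
have h3 := ler_wpM2l (mulr_ge0 (ler0n R 3) (ltW nR)) k1.
apply: le_trans (lerD h4 h3) _.
have q20 := sqr_ge0 q; have nn : n%:R * q ^+ 2 <= n%:R ^+ 2 * q ^+ 2.
  by rewrite ler_wpM2r// expr2 ler_peMr// ltW.
lra.
Qed.

(** The linear part of the error is an average of independent terms. *)
Lemma lin_coef_error j U V n : (0 < n)%N -> (J0 <= j)%N -> bmeas U -> bmeas V ->
  (forall o, `|U o| <= B) -> (forall o, `|V o| <= B) ->
  \int[iid P n]_D ((\sum_(m : loc W j) coef P U m *
     (emp (feat V m) D - coef P V m)) ^+ 2) <= B ^+ 4 / n%:R.
Proof.
move=> n0 Jj bU bV UB VB.
pose g x := \sum_(m : loc W j) coef P U m * Phi m x.
have bP (m : loc W j) : bmeas (Phi m) by exact: bmeas_Phi.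
have bg : bmeas g by exact: bmeas_lin.
pose f o := V o * g (obsX o).
have bf : bmeas f by apply: bmeasM => //; exact: bmeas_obsX.
have fE o : f o = \sum_(m : loc W j) coef P U m * feat V m o.
  by rewrite /f mulr_sumr; apply: eq_bigr => m _; rewrite /feat; ring.
have -> : \int[iid P n]_D ((\sum_(m : loc W j) coef P U m *
     (emp (feat V m) D - coef P V m)) ^+ 2) =
   \int[iid P n]_D ((emp f D - \int[P]_o f o) ^+ 2).
  apply: eq_Rintegral => D _; congr (_ ^+ 2).
  have -> : emp f D = \sum_(m : loc W j) coef P U m * emp (feat V m) D.
    rewrite /emp /tsum; under eq_bigr do rewrite fE.
    rewrite exchange_big/= mulr_sumr; apply: eq_bigr => m _.
    by rewrite -mulr_sumr; ring.
  have -> : \int[P]_o f o = \sum_(m : loc W j) coef P U m * coef P V m.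
    under eq_Rintegral do rewrite fE.
    rewrite Rint_sum => [|m]; last first.
      by apply: bmeasM; [exact: bmeas_cst|exact: bmeas_feat].
    by apply: eq_bigr => m _; rewrite RintZl//; exact: bmeas_feat.
  by rewrite -sumrB; apply: eq_bigr => m _; rewrite mulrBr.
apply: le_trans (emp_var P n0 bf) _.
rewrite mulrC ler_wpM2r// ?invr_ge0//.
have b2 : bmeas (fun o => g (obsX o) ^+ 2) by apply: bmeasX; exact: bmeas_obsX.
apply: (@le_trans _ _ (\int[P]_o (B ^+ 2 * g (obsX o) ^+ 2))).
  apply: le_Rint => [||o]; first exact: bmeasX.
    by apply: bmeasM => //; exact: bmeas_cst.
  by rewrite /f exprMn ler_wpM2r ?sqr_ge0//; exact: sqr_le_of_norm.
rewrite RintZl// (Rint_obsX PX (h := fun x => g x ^+ 2)); last exact: bmeasX.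
have -> : \int[unif]_x g x ^+ 2 = \sum_(m : loc W j) coef P U m ^+ 2.
  rewrite -[LHS]/(inner g g) {1}/g inner_suml//; apply: eq_bigr => m _.
  by rewrite innerC inner_lin_ortho ?expr2//; exact: (cdv_Phi_orthonormal HW).
rewrite -[4%N]/(2 + 2)%N exprD ler_wpM2l ?sqr_ge0//.
exact: coef_sqr_sum_le.
Qed.

Definition quad_const := 3 * (7 * (4 * (B ^+ 2 * C ^+ 3)) ^+ 2 + 2 * B ^+ 4).

(** Expanding each product of empirical coefficients around the true ones leaves
    two linear terms, of variance [1/n], and the product of two centred vectors,
    which the Cauchy-Schwarz inequality bounds through their fourth moments. *)
Lemma emp_quad_risk j U V n : (0 < n)%N -> (J0 <= j)%N -> bmeas U -> bmeas V ->
  (forall o, `|U o| <= B) -> (forall o, `|V o| <= B) ->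
  \int[iid P n]_D ((emp_quad j U V D -
     \sum_(m : loc W j) coef P U m * coef P V m) ^+ 2) <=
  quad_const * (n%:R^-1 + (K j / n%:R) ^+ 2).
Proof.
move=> n0 Jj bU bV UB VB.
pose a U D := \sum_(m : loc W j) (@emp R d n (feat U m) D - coef P U m) ^+ 2.
pose l U V D := \sum_(m : loc W j) coef P U m * (@emp R d n (feat V m) D - coef P V m).
have bc := bmeas_cst.
have ba F : bmeas F -> bmeas (fun D => a F D ^+ 2).
  move=> bF; apply: bmeasX; apply: bmeas_sum => m; apply: bmeasX.
  by apply: bmeasB => //; apply: bmeas_emp; exact: bmeas_feat.
have bl F G : bmeas G -> bmeas (fun D => l F G D ^+ 2).
  move=> bG; apply: bmeasX; apply: bmeas_sum => m; apply: bmeasM => //.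
  by apply: bmeasB => //; apply: bmeas_emp; exact: bmeas_feat.
have aU := ba _ bU; have aV := ba _ bV; have lUV := bl U V bV; have lVU := bl V U bU.
have b1 : bmeas (fun D => 2^-1 * a U D ^+ 2 + 2^-1 * a V D ^+ 2).
  by apply: bmeasD; exact: bmeasM.
have b2 : bmeas (fun D => l U V D ^+ 2 + l V U D ^+ 2) by exact: bmeasD.
apply: (@le_trans _ _ (\int[iid P n]_D (3 *
   ((2^-1 * a U D ^+ 2 + 2^-1 * a V D ^+ 2) + (l U V D ^+ 2 + l V U D ^+ 2))))).
  apply: le_Rint => [||D].
  - by apply: bmeasX; apply: bmeasB => //; exact: bmeas_emp_quad.
  - by apply: bmeasM => //; exact: bmeasD.
  pose c := \sum_(m : loc W j) (emp (feat U m) D - coef P U m) *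
     (emp (feat V m) D - coef P V m).
  have cs : c ^+ 2 <= a U D * a V D by exact: sum_cauchy_schwarz.
  have -> : emp_quad j U V D - \sum_(m : loc W j) coef P U m * coef P V m =
      c + l U V D + l V U D.
    by rewrite /emp_quad /c /l -sumrB -!big_split/=; apply: eq_bigr => m _; ring.
  have := sqr_ge0 (a U D - a V D); move: cs.
  move: (a U D) (a V D) (l U V D) (l V U D) c => x y z w c cs xy.
  have := sqr_ge0 (c - z); have := sqr_ge0 (c - w); have := sqr_ge0 (z - w); nra.
rewrite RintZl; last exact: bmeasD.
rewrite RintD// !RintD//; try exact: bmeasM.
rewrite !RintZl//.
have := centred_fourth_moment n0 Jj bU UB; have := centred_fourth_moment n0 Jj bV VB.
have := lin_coef_error n0 Jj bU bV UB VB; have := lin_coef_error n0 Jj bV bU VB UB.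
rewrite -/(l U V) -/(l V U) -/(a U) -/(a V).
rewrite (_ : 7 * _ ^+ 2 / _ = 7 * (4 * (B ^+ 2 * C ^+ 3)) ^+ 2 * (K j / n%:R) ^+ 2); last first.
  by rewrite expr_div_n; ring.
have nR : 0 <= n%:R^-1 :> R by [].
have B40 : 0 <= B ^+ 4 by rewrite exprn_even_ge0.
have Q0 : 0 <= (4 * (B ^+ 2 * C ^+ 3)) ^+ 2 := sqr_ge0 _.
have k0 : 0 <= (K j / n%:R) ^+ 2 :> R := sqr_ge0 _.
by move=> h1 h2 h3 h4; exact: (quad_arith Q0 B40 nR k0 h4 h3 h2 h1).
Qed.

End fixed_law.
End quadratic_risk.

(** * Smoothing errors at the sample points *)

(** The one-dimensional case of the moment bound for sums of vectors. *)
Lemma Rint_tsum4 {disp} {T : measurableType disp} {R : realType}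
    (P : probability T R) (f : T -> R) n : bmeas f -> \int[P]_z f z = 0 ->
  \int[iid P n]_D (tsum f D ^+ 4) <=
  4 * n%:R ^+ 2 * (\int[P]_z (f z ^+ 2)) ^+ 2 +
  3 * n%:R * \int[P]_z (f z ^+ 4).
Proof.
move=> bf f0; have := @Rint_tsqn2 _ _ _ P 'I_1 (fun=> f) (fun=> bf) (fun=> f0) n.
rewrite /tsqn /sqn.
under eq_Rintegral do rewrite big_ord1 -exprM.
under [X in _ <= _ * X ^+ 2 + _ -> _]eq_Rintegral do rewrite big_ord1.
by under [X in _ <= _ + _ * X -> _]eq_Rintegral do rewrite big_ord1 -exprM.
Qed.

Section cross_term.
Context {R : realType} {d : nat}.
Local Notation obs := (d.-tuple R * R * R)%type.
Local Notation X := (d.-tuple R).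
Variable W : wavelets R d.
Hypothesis HW : cdv_basis W.
Local Notation J0 := (base_level W).
Local Notation K j := (resolution d j)%:R.

Definition smooth j n (U : obs -> R) (D : n.-tuple obs) (x : X) : R :=
  \sum_(m : loc W j) emp (feat U m) D * Phi m x.

Definition proj_coef (P : probability obs R) j (U : obs -> R) (x : X) : R :=
  \sum_(m : loc W j) coef P U m * Phi m x.

Definition emp_cross j1 j2 n (U V : obs -> R) (D : n.-tuple obs) : R :=
  n%:R^-1 * \sum_(i < n)
    smooth j1 U D (obsX (tnth D i)) * smooth j2 V D (obsX (tnth D i)).

Lemma smoothE j n (U : obs -> R) (D : n.-tuple obs) x :
  smooth j U D x =
  n%:R^-1 * \sum_(i < n) U (tnth D i) * proj_kernel W j (obsX (tnth D i)) x.
Proof.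
rewrite /smooth; under [in RHS]eq_bigr do rewrite mulr_sumr.
rewrite exchange_big/= mulr_sumr; apply: eq_bigr => m _.
rewrite /emp /tsum -mulrA mulr_suml; congr (_ * _); apply: eq_bigr => i _.
by rewrite /feat mulrA.
Qed.

Lemma bmeas_proj_coef P j U : (J0 <= j)%N -> bmeas (proj_coef P j U).
Proof. by move=> Jj; apply: bmeas_lin => m; exact: bmeas_Phi. Qed.

Lemma bmeas_smooth_at j n U (i : 'I_n) : (J0 <= j)%N -> bmeas U ->
  bmeas (fun D : n.-tuple obs => smooth j U D (obsX (tnth D i))).
Proof.
move=> Jj bU; apply: bmeas_sum => m; apply: bmeasM.
  by apply: bmeas_emp; exact: bmeas_feat.
by apply: (bmeas_tnth (f := fun o => Phi m (obsX o))); apply: bmeas_obsX; exact: bmeas_Phi.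
Qed.

Lemma bmeas_emp_cross j1 j2 n U V : (J0 <= j1)%N -> (J0 <= j2)%N ->
  bmeas U -> bmeas V -> bmeas (@emp_cross j1 j2 n U V).
Proof.
move=> J1 J2 bU bV; apply: bmeasM; first exact: bmeas_cst.
by apply: bmeas_sum => i; apply: bmeasM; exact: bmeas_smooth_at.
Qed.

Variable C : R.
Hypothesis CPhi : frame_bounds J0 (@Phi _ _ W) C.

Let C1 : 1 <= C. Proof. by have [] := CPhi. Qed.
Let C0 : 0 <= C. Proof. exact: le_trans C1. Qed.

Lemma proj_kernel_le j x y : (J0 <= j)%N -> `|proj_kernel W j x y| <= C ^+ 3 * K j.
Proof.
move=> Jj; have h := sum_cauchy_schwarz (fun m : loc W j => Phi m x) (fun m => Phi m y).
have q0 : 0 <= C ^+ 3 * K j :> R by rewrite mulr_ge0// exprn_ge0.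
rewrite -ler_sqr ?nnegrE// real_normK ?num_real//; apply: le_trans h _.
by rewrite expr2; apply: ler_pM;
  do 1? [exact: Phi_sqr_sum_le | apply: sumr_ge0 => m _; exact: sqr_ge0].
Qed.

Section fixed_law.
Variable P : probability obs R.
Hypothesis PX : forall B, measurable B -> P (@obsX R d @^-1` B) = unif B.
Variable B : R.
Hypothesis B0 : 0 <= B.

Lemma coef_obsX j (h : X -> R) (m : loc W j) : (J0 <= j)%N -> bmeas h ->
  coef P (fun o => h (obsX o)) m = inner h (Phi m).
Proof.
move=> Jj bh; rewrite /coef /feat.
rewrite (Rint_obsX PX (h := fun x => h x * Phi m x))//.
by apply: bmeasM => //; exact: bmeas_Phi.
Qed.

Section one_level.
Variables (j : nat) (U : obs -> R).
Hypotheses (Jj : (J0 <= j)%N) (bU : bmeas U) (UB : forall o, `|U o| <= B).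

(** The contribution of one observation to the smoothing error at [x], which is an
    average of these. *)
Definition dev (x : X) (o : obs) : R :=
  \sum_(m : loc W j) centred P U m o * Phi m x.

Lemma devE x o : dev x o = U o * proj_kernel W j (obsX o) x - proj_coef P j U x.
Proof.
rewrite /dev /proj_kernel /proj_coef mulr_sumr -sumrB; apply: eq_bigr => m _.
by rewrite /centred /feat; ring.
Qed.

Let bPhi (m : loc W j) : bmeas (Phi m). Proof. exact: bmeas_Phi. Qed.
Let bcen (m : loc W j) : bmeas (centred P U m). Proof. exact: bmeas_centred. Qed.

Lemma bmeas_dev x : bmeas (dev x).
Proof. by apply: bmeas_sum => m; apply: bmeasM => //; exact: bmeas_cst. Qed.

Lemma dev0 x : \int[P]_o dev x o = 0.
Proof.
rewrite Rint_sum => [|m]; last by apply: bmeasM => //; exact: bmeas_cst.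
by rewrite big1// => m _; rewrite RintZr// centred0// mul0r.
Qed.

Lemma bmeas_UK x : bmeas (fun o => U o * proj_kernel W j (obsX o) x).
Proof.
apply: bmeasM => //; apply: bmeas_sum => m.
by apply: bmeasM; [exact: bmeas_obsX|exact: bmeas_cst].
Qed.

Lemma proj_coefE x :
  proj_coef P j U x = \int[P]_o (U o * proj_kernel W j (obsX o) x).
Proof.
apply/eqP; rewrite -subr_eq0 -oppr_eq0 opprB -(Rint_cst P (proj_coef P j U x)).
rewrite -RintB; [|exact: bmeas_UK|exact: bmeas_cst].
by under eq_Rintegral do rewrite -devE; rewrite dev0.
Qed.

Lemma UK_le x o : `|U o * proj_kernel W j (obsX o) x| <= B * (C ^+ 3 * K j).
Proof. by rewrite normrM ler_pM//; exact: proj_kernel_le. Qed.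

Lemma dev_le x o : `|dev x o| <= 2 * (B * (C ^+ 3 * K j)).
Proof.
rewrite devE (le_trans (ler_normB _ _))// mulr2n mulrDl mul1r lerD ?UK_le//.
rewrite proj_coefE; apply: Rint_norm_le; first exact: bmeas_UK.
by move=> o'; exact: UK_le.
Qed.

(** By the reproducing property the second moment of the kernel at a fixed point
    is of the same order [K] as its supremum, one order less than the square of
    the supremum. *)
Lemma dev_var x : \int[P]_o (dev x o ^+ 2) <= B ^+ 2 * (C ^+ 3 * K j).
Proof.
have bc := bmeas_cst; have bUK := bmeas_UK x; have bUK2 := bmeasX 2 bUK.
set c := proj_coef P j U x.
have -> : \int[P]_o (dev x o ^+ 2) = \int[P]_o
   ((U o * proj_kernel W j (obsX o) x) ^+ 2 -
    2 * c * (U o * proj_kernel W j (obsX o) x) + c ^+ 2).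
  by apply: eq_Rintegral => o _; rewrite devE -/c; ring.
have b2 : bmeas (fun o => 2 * c * (U o * proj_kernel W j (obsX o) x)) by exact: bmeasM.
rewrite RintD ?RintB ?RintZl ?Rint_cst -?proj_coefE//; last exact: bmeasB.
pose Kx y := proj_kernel W j y x.
have bK : bmeas Kx by apply: bmeas_sum => m; apply: bmeasM.
have h : \int[P]_o ((U o * Kx (obsX o)) ^+ 2) <= B ^+ 2 * (C ^+ 3 * K j).
  apply: (@le_trans _ _ (\int[P]_o (B ^+ 2 * (Kx (obsX o) ^+ 2)))).
    apply: le_Rint => [||o]; first exact: bUK2.
      by apply: bmeasM => //; apply: (bmeas_obsX (h := fun y => Kx y ^+ 2)); exact: bmeasX.
    by rewrite exprMn ler_wpM2r ?sqr_ge0//; exact: sqr_le_of_norm.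
  rewrite RintZl; last by apply: (bmeas_obsX (h := fun y => Kx y ^+ 2)); exact: bmeasX.
  rewrite ler_wpM2l ?sqr_ge0// (Rint_obsX PX (h := fun y => Kx y ^+ 2)); last exact: bmeasX.
  have -> : \int[unif]_y (Kx y ^+ 2) = \sum_(m : loc W j) Phi m x ^+ 2.
    have KE : Kx = fun y => \sum_(m : loc W j) Phi m x * Phi m y.
      by apply/funext => y; apply: eq_bigr => m _; rewrite mulrC.
    rewrite -[LHS]/(inner Kx Kx) {1}KE inner_suml//; apply: eq_bigr => m _.
    by rewrite innerC KE inner_lin_ortho ?expr2//; exact: (cdv_Phi_orthonormal HW).
  exact: Phi_sqr_sum_le.
rewrite -/c; have := sqr_ge0 c; move: h; rewrite /Kx; lra.
Qed.

Lemma smooth_dev n (D : n.-tuple obs) x : (0 < n)%N ->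
  smooth j U D x - proj_coef P j U x = n%:R^-1 * tsum (dev x) D.
Proof.
move=> n0; rewrite /smooth /proj_coef -sumrB /tsum /dev exchange_big/= mulr_sumr.
apply: eq_bigr => m _; rewrite -mulrBl emp_centred// /tsum -mulr_suml; ring.
Qed.

Definition dev_const := 8 * (2 * (B * C ^+ 3)) ^+ 4 +
  (32 * (B ^+ 2 * C ^+ 3) ^+ 2 +
   24 * (2 * (B * C ^+ 3)) ^+ 2 * (B ^+ 2 * C ^+ 3)).

(** The smoother is evaluated at a point of its own sample. The term of that
    point is at most of order [K/n]; the other terms are independent of it and,
    given it, form a centred sum with fourth moment of order [(n K)^2]. *)
Lemma dev_fourth_moment n : (0 < n)%N ->
  \int[iid P n]_D (n%:R^-1 * \sum_(i < n)
    (smooth j U D (obsX (tnth D i)) - proj_coef P j U (obsX (tnth D i))) ^+ 4) <=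
  dev_const * ((K j / n%:R) ^+ 2 + (K j / n%:R) ^+ 4).
Proof.
case: n => // n _; set N := n.+1%:R; set k := K j.
have N0 : 0 < N :> R by rewrite ltr0n.
set L := 2 * (B * (C ^+ 3 * k)); set s := B ^+ 2 * (C ^+ 3 * k).
pose G (zD : obs * n.-tuple obs) :=
  (N^-1 * (dev (obsX zD.1) zD.1 + tsum (dev (obsX zD.1)) zD.2)) ^+ 4.
have bG : bmeas G.
  apply: bmeasX; apply: bmeasM; first exact: bmeas_cst.
  apply: bmeasD.
    apply: (bmeas_comp measurable_fst (f := fun z => dev (obsX z) z)).
    by apply: bmeas_sum => m; apply: bmeasM => //; exact: bmeas_obsX.
  apply: bmeas_sum => i; apply: bmeas_sum => m; apply: bmeasM.
    apply: (bmeas_comp measurable_snd (f := fun D => centred P U m (tnth D i))).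
    exact: bmeas_tnth.
  by apply: (bmeas_comp measurable_fst (f := fun z => Phi m (obsX z))); exact: bmeas_obsX.
have GE i (D : n.+1.-tuple obs) :
  (smooth j U D (obsX (tnth D i)) - proj_coef P j U (obsX (tnth D i))) ^+ 4 =
  G (tnth D i, delete i D).
  by rewrite smooth_dev// (tsum_delete i).
have L0 : 0 <= L.
  by have := dev_le [tuple 0 | i < d] ([tuple 0 | i < d], 0, 0); apply: le_trans.
have s0 : 0 <= s.
  by apply: le_trans (dev_var [tuple 0 | i < d]); apply: Rint_ge0 => o; exact: sqr_ge0.
set M := N^-1 ^+ 4 * (8 * L ^+ 4 + 8 * (4 * N ^+ 2 * s ^+ 2 + 3 * N * (L ^+ 2 * s))).
have GM z : \int[iid P n]_D G (z, D) <= M.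
  have bd := bmeas_dev (obsX z); set x := obsX z in bd *.
  have bT := bmeasX 4 (bmeas_tsum n bd).
  apply: (@le_trans _ _ (\int[iid P n]_D (N^-1 ^+ 4 *
      (8 * L ^+ 4 + 8 * tsum (dev x) D ^+ 4)))).
    apply: le_Rint => [||D].
    - exact: (bmeas_section z bG).
    - apply: bmeasM; first exact: bmeas_cst.
      by apply: bmeasD; [exact: bmeas_cst|apply: bmeasM => //; exact: bmeas_cst].
    rewrite /G/= -/x exprMn ler_wpM2l ?exprn_ge0 ?invr_ge0 ?(ltW N0)//.
    have da : dev x z ^+ 4 <= L ^+ 4.
      rewrite (exprM _ 2 2) (exprM L 2 2); apply: sqr_le_of_norm.
      by rewrite ger0_norm ?sqr_ge0//; apply: sqr_le_of_norm; exact: dev_le.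
    apply: (@le_trans _ _ (8 * dev x z ^+ 4 + 8 * tsum (dev x) D ^+ 4)); last by lra.
    move: (dev x z) (tsum _ _) => a b.
    have h1 : (a + b) ^+ 2 <= 2 * (a ^+ 2 + b ^+ 2).
      by have := sqr_ge0 (a - b); rewrite !sqrrD mulrN; lra.
    have h2 : ((a + b) ^+ 2) ^+ 2 <= (2 * (a ^+ 2 + b ^+ 2)) ^+ 2.
      by apply: sqr_le_of_norm; rewrite ger0_norm ?sqr_ge0.
    have := sqr_ge0 (a ^+ 2 - b ^+ 2); move: h2.
    rewrite (_ : (a + b) ^+ 4 = ((a + b) ^+ 2) ^+ 2); last by ring.
    by move: ((a + b) ^+ 2) => c; nra.
  rewrite RintZl; last first.
    by apply: bmeasD; [exact: bmeas_cst|apply: bmeasM => //; exact: bmeas_cst].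
  rewrite RintD ?Rint_cst ?RintZl//; [|exact: bmeas_cst|]; last first.
    by apply: bmeasM => //; exact: bmeas_cst.
  rewrite /M ler_wpM2l ?exprn_ge0 ?invr_ge0 ?(ltW N0)// lerD2l ler_wpM2l//.
  apply: le_trans (Rint_tsum4 n bd (dev0 x)) _.
  have nN : n%:R <= N :> R by rewrite ler_nat.
  have v := dev_var x; rewrite -/k -/s in v.
  have v0 : 0 <= \int[P]_o (dev x o ^+ 2) by apply: Rint_ge0 => o; exact: sqr_ge0.
  have bd2 := bmeasX 2 bd; have bd4 := bmeasX 4 bd.
  have f4 : \int[P]_o (dev x o ^+ 4) <= L ^+ 2 * s.
    apply: (@le_trans _ _ (\int[P]_o (L ^+ 2 * dev x o ^+ 2))).
      apply: le_Rint => [||o]; [exact: bd4|by apply: bmeasM => //; exact: bmeas_cst|].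
      rewrite -[4%N]/(2 + 2)%N exprD ler_wpM2r ?sqr_ge0//.
      by apply: sqr_le_of_norm; exact: dev_le.
    by rewrite RintZl// ler_wpM2l ?sqr_ge0.
  have nN2 : n%:R ^+ 2 <= N ^+ 2 by rewrite lerXn2r// nnegrE// ltW.
  have vs2 : (\int[P]_o (dev x o ^+ 2)) ^+ 2 <= s ^+ 2 by rewrite lerXn2r// nnegrE.
  have f40 : 0 <= \int[P]_o (dev x o ^+ 4).
    by apply: Rint_ge0 => o; exact: exprn_even_ge0.
  apply: lerD; apply: ler_pM => //.
  - by rewrite mulr_ge0// sqr_ge0.
  - by rewrite ler_wpM2l.
  - by rewrite ler_wpM2l.
apply: (@le_trans _ _ M).
  rewrite RintZl; last first.
    by apply: bmeas_sum => i; apply: bmeasX; apply: bmeasB;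
      [exact: bmeas_smooth_at|
       apply: (bmeas_tnth (f := fun o => proj_coef P j U (obsX o)));
       apply: bmeas_obsX; exact: bmeas_proj_coef].
  rewrite mulrC ler_pdivrMr//.
  rewrite Rint_sum => [|i]; last first.
    by apply: bmeasX; apply: bmeasB;
      [exact: bmeas_smooth_at|
       apply: (bmeas_tnth (f := fun o => proj_coef P j U (obsX o)));
       apply: bmeas_obsX; exact: bmeas_proj_coef].
  apply: (@le_trans _ _ (\sum_(i < n.+1) M)); last first.
    by rewrite sumr_const card_ord mulr_natr.
  apply: ler_sum => i _; under eq_Rintegral do rewrite GE.
  by rewrite Rint_delete//; apply: Rint_le => //; exact: bmeas_Rint2.
set r := k / N; have r0 : 0 <= r by rewrite divr_ge0// ltW.
have -> : M = 8 * (2 * (B * C ^+ 3)) ^+ 4 * r ^+ 4 +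
   32 * (B ^+ 2 * C ^+ 3) ^+ 2 * r ^+ 2 +
   24 * (2 * (B * C ^+ 3)) ^+ 2 * (B ^+ 2 * C ^+ 3) * r ^+ 3.
  by rewrite /M /L /s /r; field; rewrite lt0r_neq0.
have r3 : r ^+ 3 <= r ^+ 2 + r ^+ 4.
  have := mulr_ge0 (sqr_ge0 r) (sqr_ge0 (r - 1)).
  have := mulr_ge0 (sqr_ge0 r) r0; have := mulr_ge0 (sqr_ge0 r) (sqr_ge0 r); nra.
rewrite /dev_const; set a := _ * _ ^+ 4; set b := 32 * _; set c := 24 * _ * _.
have a0 : 0 <= a by rewrite mulr_ge0// exprn_even_ge0.
have b0 : 0 <= b by rewrite mulr_ge0// sqr_ge0.
have c0 : 0 <= c.
  by rewrite !mulr_ge0 ?exprn_ge0// ?mulr_ge0 ?exprn_ge0.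
have := mulr_ge0 a0 (sqr_ge0 r); have := mulr_ge0 b0 (exprn_ge0 4 r0).
have := ler_wpM2l c0 r3; lra.
Qed.

End one_level.
End fixed_law.
End cross_term.

(** * The cross statistic *)

Lemma mean_sqr_le {R : realFieldType} n (a : 'I_n -> R) : (0 < n)%N ->
  (n%:R^-1 * \sum_i a i) ^+ 2 <= n%:R^-1 * \sum_i a i ^+ 2.
Proof.
move=> n0; have nR : 0 < n%:R :> R by rewrite ltr0n.
have := sum_cauchy_schwarz a (fun=> 1).
under eq_bigr do rewrite mulr1.
under [X in _ <= _ * X -> _]eq_bigr do rewrite expr1n.
rewrite sumr_const card_ord => h; rewrite exprMn expr2 -mulrA ler_wpM2l ?invr_ge0//.
by rewrite ler_pdivrMl// mulrC.
Qed.

(** [g1], [g2] stand for fourth moments of smoothing errors, [q1], [q2] for the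
    risks of the quadratic statistics and [e] for a variance. *)
Lemma cross_arith {R : realFieldType} (q1 q2 g1 g2 e c b4 D v x1 x2 y1 y2 : R) :
  0 <= c -> 0 <= b4 -> 0 <= D -> 0 <= v -> 0 <= x1 -> 0 <= x2 -> 0 <= y1 ->
  0 <= y2 -> g1 <= D * (x1 + y1) -> g2 <= D * (x2 + y2) ->
  q1 <= c * (v + x2) -> q2 <= c * (v + x1) -> e <= v * b4 ->
  4 * ((2^-1 * g1 + 2^-1 * g2) + (q1 + q2) + e) <=
  4 * (D + 2 * c + b4) * (v + (x1 + x2) + (y1 + y2)).
Proof.
move=> c0 b0 D0 v0 x10 x20 y10 y20.
have := mulr_ge0 c0 v0; have := mulr_ge0 c0 x10; have := mulr_ge0 c0 x20.
have := mulr_ge0 c0 y10; have := mulr_ge0 c0 y20.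
have := mulr_ge0 b0 v0; have := mulr_ge0 b0 x10; have := mulr_ge0 b0 x20.
have := mulr_ge0 b0 y10; have := mulr_ge0 b0 y20.
have := mulr_ge0 D0 v0; have := mulr_ge0 D0 x10; have := mulr_ge0 D0 x20.
have := mulr_ge0 D0 y10; have := mulr_ge0 D0 y20.
rewrite !mulrDr !mulrDl; lra.
Qed.

Section cross_risk.
Context {R : realType} {d : nat}.
Local Notation obs := (d.-tuple R * R * R)%type.
Local Notation X := (d.-tuple R).
Variable W : wavelets R d.
Hypothesis HW : cdv_basis W.
Local Notation J0 := (base_level W).
Local Notation K j := (resolution d j)%:R.
Variable P : probability obs R.
Hypothesis PX : forall B, measurable B -> P (@obsX R d @^-1` B) = unif B.

Lemma sum_coef_obsX j1 j2 U V : (J0 <= j1)%N -> (J0 <= j2)%N ->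
  \sum_(m : loc W j2) coef P (fun o => proj_coef W P j1 U (obsX o)) m * coef P V m =
  inner (proj_coef W P j1 U) (proj_coef W P j2 V).
Proof.
move=> J1 J2; rewrite (innerC _ (proj_coef W P j2 V)) inner_suml; first last.
- exact: bmeas_proj_coef.
- by move=> m; exact: bmeas_Phi.
apply: eq_bigr => m _; rewrite (coef_obsX HW PX)//; last exact: bmeas_proj_coef.
by rewrite mulrC (innerC (Phi m)).
Qed.

Lemma emp_quadE j n U V (D : n.-tuple obs) :
  n%:R^-1 * \sum_(i < n) U (tnth D i) * smooth W j V D (obsX (tnth D i)) =
  emp_quad W j U V D.
Proof.
rewrite /emp_quad /smooth mulr_sumr.
under eq_bigr do rewrite mulr_sumr mulr_sumr.
rewrite exchange_big/=; apply: eq_bigr => m _; set E := emp (feat V m) D.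
rewrite /emp /tsum.
rewrite -mulrA mulr_suml mulr_sumr; apply: eq_bigr => i _; rewrite /feat; ring.
Qed.

Lemma emp_quadC j n U V (D : n.-tuple obs) : emp_quad W j U V D = emp_quad W j V U D.
Proof. by apply: eq_bigr => m _; rewrite mulrC. Qed.

(** Centring both smoothers at their means leaves a product of two smoothing
    errors; the linear terms are quadratic statistics of the projections. *)
Lemma cross_decomposition j1 j2 n U V (D : n.-tuple obs) :
  let p1 := proj_coef W P j1 U in let p2 := proj_coef W P j2 V in
  emp_cross W j1 j2 U V D =
  n%:R^-1 * \sum_(i < n)
    ((smooth W j1 U D (obsX (tnth D i)) - p1 (obsX (tnth D i))) *
     (smooth W j2 V D (obsX (tnth D i)) - p2 (obsX (tnth D i)))) +
  emp_quad W j2 (fun o => p1 (obsX o)) V D +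
  emp_quad W j1 (fun o => p2 (obsX o)) U D -
  emp (fun o => p1 (obsX o) * p2 (obsX o)) D.
Proof.
move=> p1 p2; rewrite -!emp_quadE /emp /tsum /emp_cross -!mulrDr -mulrBr.
congr (_ * _). rewrite -!big_split/= -sumrB; apply: eq_bigr => i _. ring.
Qed.

Variables (C B : R).
Hypothesis CPhi : frame_bounds J0 (@Phi _ _ W) C.
Hypothesis B0 : 0 <= B.

Definition cross_const :=
  4 * (dev_const C B + 2 * quad_const C B + B ^+ 4).

Let C0 : 0 <= C. Proof. by have [C1 _] := CPhi; exact: le_trans C1. Qed.

Lemma dev_const_ge0 : 0 <= dev_const C B.
Proof.
rewrite /dev_const addr_ge0 ?mulr_ge0 ?exprn_even_ge0// addr_ge0//.
  by rewrite mulr_ge0// sqr_ge0.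
apply: mulr_ge0; first by rewrite mulr_ge0// sqr_ge0.
by rewrite mulr_ge0 ?sqr_ge0// exprn_ge0.
Qed.

Lemma quad_const_ge0 : 0 <= quad_const C B.
Proof.
rewrite /quad_const mulr_ge0// addr_ge0// mulr_ge0//; first exact: sqr_ge0.
exact: exprn_even_ge0.
Qed.

Lemma cross_const_ge0 : 0 <= cross_const.
Proof.
rewrite /cross_const mulr_ge0// addr_ge0 ?exprn_even_ge0//.
by rewrite addr_ge0 ?dev_const_ge0// mulr_ge0// quad_const_ge0.
Qed.

Lemma cross_risk j1 j2 U V n : (0 < n)%N -> (J0 <= j1)%N -> (J0 <= j2)%N ->
  bmeas U -> bmeas V -> (forall o, `|U o| <= B) -> (forall o, `|V o| <= B) ->
  (forall x, `|proj_coef W P j1 U x| <= B) ->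
  (forall x, `|proj_coef W P j2 V x| <= B) ->
  \int[iid P n]_D ((emp_cross W j1 j2 U V D -
    inner (proj_coef W P j1 U) (proj_coef W P j2 V)) ^+ 2) <=
  cross_const * (n%:R^-1 + ((K j1 / n%:R) ^+ 2 + (K j2 / n%:R) ^+ 2) +
    ((K j1 / n%:R) ^+ 4 + (K j2 / n%:R) ^+ 4)).
Proof.
move=> n0 J1 J2 bU bV UB VB.
set p1 := proj_coef W P j1 U; set p2 := proj_coef W P j2 V => p1B p2B.
have bp1 : bmeas p1 by exact: bmeas_proj_coef.
have bp2 : bmeas p2 by exact: bmeas_proj_coef.
have bq1 := bmeas_obsX bp1; have bq2 := bmeas_obsX bp2.
have bc := bmeas_cst.
set I := inner p1 p2.
pose g1 (D : n.-tuple obs) := n%:R^-1 * \sum_(i < n)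
  (smooth W j1 U D (obsX (tnth D i)) - p1 (obsX (tnth D i))) ^+ 4.
pose g2 (D : n.-tuple obs) := n%:R^-1 * \sum_(i < n)
  (smooth W j2 V D (obsX (tnth D i)) - p2 (obsX (tnth D i))) ^+ 4.
pose q1 (D : n.-tuple obs) := (emp_quad W j2 (fun o => p1 (obsX o)) V D - I) ^+ 2.
pose q2 (D : n.-tuple obs) := (emp_quad W j1 (fun o => p2 (obsX o)) U D - I) ^+ 2.
pose e (D : n.-tuple obs) := (emp (fun o => p1 (obsX o) * p2 (obsX o)) D - I) ^+ 2.
have bsm j F h (i : 'I_n) : (J0 <= j)%N -> bmeas F -> bmeas h -> bmeas (fun D =>
    (smooth W j F D (obsX (tnth D i)) - h (obsX (tnth D i))) ^+ 4).
  move=> Jj bF bh; apply: bmeasX; apply: bmeasB; first exact: bmeas_smooth_at.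
  apply: (bmeas_tnth (f := fun o => h (obsX o))); exact: bmeas_obsX.
have bg1 : bmeas g1 by apply: bmeasM => //; apply: bmeas_sum => i; exact: bsm.
have bg2 : bmeas g2 by apply: bmeasM => //; apply: bmeas_sum => i; exact: bsm.
have bQ1 : bmeas q1 by apply: bmeasX; apply: bmeasB => //; exact: bmeas_emp_quad.
have bQ2 : bmeas q2 by apply: bmeasX; apply: bmeasB => //; exact: bmeas_emp_quad.
have bpp : bmeas (fun o : obs => p1 (obsX o) * p2 (obsX o)) by exact: bmeasM.
have be : bmeas e by apply: bmeasX; apply: bmeasB => //; exact: bmeas_emp.
have bgg : bmeas (fun D => 2^-1 * g1 D + 2^-1 * g2 D).
  by apply: bmeasD; exact: bmeasM.
have bqq : bmeas (fun D => q1 D + q2 D) by exact: bmeasD.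
have bgq : bmeas (fun D => 2^-1 * g1 D + 2^-1 * g2 D + (q1 D + q2 D)).
  exact: bmeasD.
apply: (@le_trans _ _ (\int[iid P n]_D (4 *
    (2^-1 * g1 D + 2^-1 * g2 D + (q1 D + q2 D) + e D)))).
  apply: le_Rint => [||D].
  - by apply: bmeasX; apply: bmeasB => //; exact: bmeas_emp_cross.
  - by apply: bmeasM => //; exact: bmeasD.
  rewrite cross_decomposition -/p1 -/p2.
  set Q := n%:R^-1 * \sum_i _ * _.
  have Qle : Q ^+ 2 <= 2^-1 * g1 D + 2^-1 * g2 D.
    apply: le_trans (mean_sqr_le _ n0) _.
    rewrite /g1 /g2 mulrCA (mulrCA 2^-1) -mulrDr ler_wpM2l ?invr_ge0//.
    rewrite !mulr_sumr -big_split/=; apply: ler_sum => i _.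
    set x := _ - _; set y := _ - _.
    by have := sqr_ge0 (x ^+ 2 - y ^+ 2); nra.
  rewrite /q1 /q2 /e; move: Qle.
  set z := 2^-1 * _ + _; set A := emp_quad _ _ _ _ _; set A' := emp_quad _ _ _ _ _.
  set E := emp _ _ => Qz.
  have -> : Q + A + A' - E - I = Q + (A - I) + (A' - I) - (E - I) by ring.
  move: (A - I) (A' - I) (E - I) Qz => a b c.
  have := sqr_ge0 (Q - a); have := sqr_ge0 (Q - b); have := sqr_ge0 (Q + c).
  have := sqr_ge0 (a - b); have := sqr_ge0 (a + c); have := sqr_ge0 (b + c); nra.
rewrite RintZl; last exact: bmeasD.
rewrite RintD// RintD// RintD//; try exact: bmeasM.
rewrite [X in _ * (_ + X + _)]RintD//.
rewrite [\int[_]_x (2^-1 * g1 x)]RintZl// [\int[_]_x (2^-1 * g2 x)]RintZl//.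
have I1 : I = \sum_(m : loc W j2) coef P (fun o => p1 (obsX o)) m * coef P V m.
  by rewrite sum_coef_obsX.
have I2 : I = \sum_(m : loc W j1) coef P (fun o => p2 (obsX o)) m * coef P U m.
  by rewrite sum_coef_obsX// innerC.
have I3 : I = \int[P]_o (p1 (obsX o) * p2 (obsX o)).
  by rewrite (Rint_obsX PX (h := fun x => p1 x * p2 x))//; exact: bmeasM.
have hg1 := dev_fourth_moment HW CPhi PX B0 J1 bU UB n0.
have hg2 := dev_fourth_moment HW CPhi PX B0 J2 bV VB n0.
have hq1 := emp_quad_risk HW CPhi PX n0 J2 bq1 bV (fun o => p1B (obsX o)) VB.
have hq2 := emp_quad_risk HW CPhi PX n0 J1 bq2 bU (fun o => p2B (obsX o)) UB.
rewrite -I1 in hq1; rewrite -I2 in hq2.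
have he := emp_var P n0 bpp; rewrite -I3 in he.
have he' : \int[iid P n]_D e D <= n%:R^-1 * B ^+ 4.
  apply: le_trans he _; rewrite ler_wpM2l ?invr_ge0//.
  apply: Rint_le => [|o]; first exact: bmeasX.
  rewrite -[4%N]/(2 * 2)%N exprM; apply: sqr_le_of_norm.
  by rewrite normrM expr2 ler_pM.
have x0 (j : nat) (l : nat) : 0 <= (K j / n%:R) ^+ l :> R.
  by rewrite exprn_ge0// divr_ge0.
have v0 : 0 <= n%:R^-1 :> R by rewrite invr_ge0.
exact: (cross_arith quad_const_ge0 (exprn_even_ge0 B (isT : ~~ odd 4)) dev_const_ge0
  v0 (x0 j1 2%N) (x0 j2 2%N) (x0 j1 4%N) (x0 j2 4%N) hg1 hg2 hq1 hq2 he').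
Qed.

End cross_risk.

(** * Means of the quadratic and cross statistics *)

Section means.
Context {R : realType} {d : nat}.
Local Notation obs := (d.-tuple R * R * R)%type.
Local Notation X := (d.-tuple R).
Variable W : wavelets R d.
Hypothesis HW : cdv_basis W.
Local Notation J0 := (base_level W).
Variable P : probability obs R.
Hypothesis PX : forall B, measurable B -> P (@obsX R d @^-1` B) = unif B.
Local Notation KK j := (fun o : obs => proj_kernel W j (obsX o) (obsX o)).

Lemma bmeas_kernel_diag j : (J0 <= j)%N -> bmeas (fun x => proj_kernel W j x x).
Proof.
by move=> Jj; apply: bmeas_sum => m; apply: bmeasM; exact: bmeas_Phi.
Qed.

Lemma bmeas_kernel j x : (J0 <= j)%N -> bmeas (proj_kernel W j x).
Proof.
move=> Jj; apply: bmeas_sum => m; apply: bmeasM; first exact: bmeas_cst.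
exact: bmeas_Phi.
Qed.

Lemma proj_kernelC j x y : proj_kernel W j x y = proj_kernel W j y x.
Proof. by apply: eq_bigr => m _; rewrite mulrC. Qed.

(** A pair of indices is either diagonal or made of independent draws. *)
Lemma Rint_emp_quad j U V n : (0 < n)%N -> (J0 <= j)%N -> bmeas U -> bmeas V ->
  \int[iid P n]_D emp_quad W j U V D =
  n%:R^-1 * \int[P]_o (U o * V o * KK j o) +
  (1 - n%:R^-1) * \sum_(m : loc W j) coef P U m * coef P V m.
Proof.
move=> n0 Jj bU bV.
have bF m : bmeas (feat U (m : loc W j)) by exact: bmeas_feat.
have bG m : bmeas (feat V (m : loc W j)) by exact: bmeas_feat.
rewrite Rint_sum => [|m]; last by apply: bmeasM; exact: bmeas_emp.
have -> : \int[P]_o (U o * V o * KK j o) =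
    \sum_(m : loc W j) \int[P]_o (feat U m o * feat V m o).
  rewrite -Rint_sum => [|m]; last exact: bmeasM.
  apply: eq_Rintegral => o _; rewrite mulr_sumr; apply: eq_bigr => m _.
  by rewrite /feat; ring.
rewrite !mulr_sumr -big_split/=; apply: eq_bigr => m _.
transitivity (\int[iid P n]_D (n%:R^-1 ^+ 2 * (tsum (feat U m) D * tsum (feat V m) D))).
  by apply: eq_Rintegral => D _; rewrite /emp; ring.
rewrite RintZl; last by apply: bmeasM; exact: bmeas_tsum.
rewrite Rint_tsumM// /coef.
by field; rewrite pnatr_eq0 -lt0n.
Qed.

(** Projecting to the finer space and then to the coarser one is projecting to
    the coarser one. *)
Lemma kernel_compose j1 j2 y z : (J0 <= j1)%N -> (J0 <= j2)%N ->
  inner (proj_kernel W j1 y) (proj_kernel W j2 z) =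
  proj_kernel W (minn j1 j2) y z.
Proof.
wlog le12 : j1 j2 y z / (j1 <= j2)%N => [wl J1 J2|J1 J2].
  case/orP: (leq_total j1 j2) => h; first exact: wl.
  by rewrite innerC wl// (minn_idPl h) (minn_idPr h) proj_kernelC.
rewrite (minn_idPl le12) {1}/proj_kernel inner_suml; first last.
- exact: bmeas_kernel.
- by move=> m; exact: bmeas_Phi.
apply: eq_bigr => m _.
have bm : bmeas (Phi m) by exact: bmeas_Phi.
by rewrite -(projVE HW z J2 bm) projV_Phi.
Qed.

(** The triples of indices are sorted by coincidences: all equal, two equal in
    one of three ways, all distinct. *)
Lemma Rint_emp_cross j1 j2 U V n : (0 < n)%N -> (J0 <= j1)%N -> (J0 <= j2)%N ->
  bmeas U -> bmeas V ->
  \int[iid P n]_D emp_cross W j1 j2 U V D =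
  n%:R^-1 ^+ 2 * (\int[P]_o (U o * V o * (KK j1 o * KK j2 o)) +
   (n%:R - 1) * (\int[P]_o (U o * KK j1 o * proj_coef W P j2 V (obsX o)) +
                 \int[P]_o (V o * KK j2 o * proj_coef W P j1 U (obsX o)) +
                 \int[P]_o (U o * V o * KK (minn j1 j2) o)) +
   (n%:R - 1) * (n%:R - 2) *
     inner (proj_coef W P j1 U) (proj_coef W P j2 V)).
Proof.
case: n => // n _ J1 J2 bU bV; set N := n.+1%:R; set v := N^-1 ^+ 2.
have N0 : 0 < N :> R by rewrite ltr0n.
have nE : n%:R = N - 1 by rewrite /N -[n.+1%:R]natr1 addrK.
set p1 := proj_coef W P j1 U; set p2 := proj_coef W P j2 V.
have bp1 : bmeas p1 by exact: bmeas_proj_coef.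
have bp2 : bmeas p2 by exact: bmeas_proj_coef.
have bc := bmeas_cst.
pose f x (o : obs) := U o * proj_kernel W j1 (obsX o) x.
pose h x (o : obs) := V o * proj_kernel W j2 (obsX o) x.
have bPhi j (m : loc W j) : (J0 <= j)%N -> bmeas (Phi m) by move=> ?; exact: bmeas_Phi.
have bk2 j F : (J0 <= j)%N -> bmeas F -> bmeas (fun zo : obs * obs =>
    F zo.2 * proj_kernel W j (obsX zo.2) (obsX zo.1)).
  move=> Jj bF; apply: bmeasM; first exact: (bmeas_comp measurable_snd).
  apply: bmeas_sum => m; have bm := bmeas_obsX (bPhi j m Jj).
  by apply: bmeasM; [exact: (bmeas_comp measurable_snd bm)|exact: (bmeas_comp measurable_fst bm)].
have bf2 : bmeas (fun zo : obs * obs => f (obsX zo.1) zo.2) := bk2 _ _ J1 bU.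
have bh2 : bmeas (fun zo : obs * obs => h (obsX zo.1) zo.2) := bk2 _ _ J2 bV.
have bf z : bmeas (f (obsX z)) by exact: (bmeas_section z bf2).
have bh z : bmeas (h (obsX z)) by exact: (bmeas_section z bh2).
have diag : measurable_fun setT (fun z : obs => (z, z)).
  by apply: measurable_fun_pair.
have bfd : bmeas (fun z => f (obsX z) z) by exact: (bmeas_comp diag bf2).
have bhd : bmeas (fun z => h (obsX z) z) by exact: (bmeas_comp diag bh2).
pose G (zD : obs * n.-tuple obs) :=
  (f (obsX zD.1) zD.1 + tsum (f (obsX zD.1)) zD.2) *
  (h (obsX zD.1) zD.1 + tsum (h (obsX zD.1)) zD.2).
have bT (F : X -> obs -> R) :
    bmeas (fun zo : obs * obs => F (obsX zo.1) zo.2) ->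
    bmeas (fun zD : obs * n.-tuple obs => tsum (F (obsX zD.1)) zD.2).
  move=> bF; apply: bmeas_sum => i.
  apply: (bmeas_comp (g := fun zD : obs * n.-tuple obs => (zD.1, tnth zD.2 i))
    (f := fun zo => F (obsX zo.1) zo.2)) bF.
  apply: measurable_fun_pair => //.
  exact: (measurableT_comp (measurable_tnth i) measurable_snd).
have bG : bmeas G.
  apply: bmeasM; apply: bmeasD; try exact: bT.
    exact: (bmeas_comp measurable_fst bfd).
  exact: (bmeas_comp measurable_fst bhd).
have crossE (D : n.+1.-tuple obs) : emp_cross W j1 j2 U V D =
    N^-1 ^+ 3 * \sum_(i < n.+1) G (tnth D i, delete i D).
  rewrite /emp_cross !mulr_sumr; apply: eq_bigr => i _.
  rewrite !smoothE -/(tsum (fun o => U o * proj_kernel W j1 (obsX o) _) D) -/(tsum (fun o => V o * proj_kernel W j2 (obsX o) _) D) (tsum_delete i) (tsum_delete i) /G /f /h/=.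
  by rewrite -/N; ring.
under eq_Rintegral do rewrite crossE.
have bGd i : bmeas (fun D : n.+1.-tuple obs => G (tnth D i, delete i D)).
  apply: (bmeas_comp (g := fun D => (tnth D i, delete i D))) bG.
  by apply: measurable_fun_pair; [exact: measurable_tnth|exact: measurable_delete].
rewrite RintZl; last exact: bmeas_sum.
rewrite Rint_sum//.
under eq_bigr do rewrite Rint_delete//.
rewrite sumr_const card_ord -[_ *+ _]mulr_natl -/N.
rewrite mulrA (_ : N^-1 ^+ 3 * N = v); last by rewrite /v; field; rewrite lt0r_neq0.
congr (_ * _).
have fE z : \int[P]_o f (obsX z) o = p1 (obsX z).
  by rewrite /f -(proj_coefE HW P J1 bU).
have hE z : \int[P]_o h (obsX z) o = p2 (obsX z).
  by rewrite /h -(proj_coefE HW P J2 bV).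
have inn z : \int[iid P n]_D G (z, D) =
    f (obsX z) z * h (obsX z) z +
    ((N - 1) * (f (obsX z) z * p2 (obsX z) + h (obsX z) z * p1 (obsX z)) +
    ((N - 1) * (\int[P]_o (f (obsX z) o * h (obsX z) o)) +
    (N - 1) * (N - 2) * (p1 (obsX z) * p2 (obsX z)))).
  rewrite /G/=; move: (bf z) (bh z) (fE z) (hE z).
  move: (obsX z) => x bfx bhx fEx hEx.
  transitivity (\int[iid P n]_D (f x z * h x z + (f x z * tsum (h x) D +
     (h x z * tsum (f x) D + tsum (f x) D * tsum (h x) D)))).
    by apply: eq_Rintegral => D _; ring.
  have b1 := bmeas_tsum n bfx; have b2 := bmeas_tsum n bhx.
  have b12 := bmeasM b1 b2.
  have b3 : bmeas (fun D : n.-tuple obs => h x z * tsum (f x) D).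
    exact: (bmeasM (bmeas_cst _) b1).
  have b4 : bmeas (fun D : n.-tuple obs => f x z * tsum (h x) D).
    exact: (bmeasM (bmeas_cst _) b2).
  have b5 := bmeasD b3 b12.
  rewrite RintD//; last exact: bmeasD.
  rewrite RintD// RintD// Rint_cst !RintZl// !Rint_tsum// Rint_tsumM// fEx hEx nE.
  ring.
under eq_Rintegral do rewrite inn.
have bfh : bmeas (fun z => \int[P]_o (f (obsX z) o * h (obsX z) o)).
  exact: (bmeas_Rint2 P P (bmeasM bf2 bh2)).
have bq1 := bmeas_obsX bp1; have bq2 := bmeas_obsX bp2.
have bfp : bmeas (fun z => f (obsX z) z * p2 (obsX z)) by exact: (bmeasM bfd bq2).
have bhp : bmeas (fun z => h (obsX z) z * p1 (obsX z)) by exact: (bmeasM bhd bq1).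
have bpp : bmeas (fun z : obs => p1 (obsX z) * p2 (obsX z)) by exact: (bmeasM bq1 bq2).
have b1 : bmeas (fun z => f (obsX z) z * h (obsX z) z) by exact: (bmeasM bfd bhd).
have b2 := bmeasD bfp bhp.
have b3 : bmeas (fun z => (N - 1) * (f (obsX z) z * p2 (obsX z) +
    h (obsX z) z * p1 (obsX z))) by exact: bmeasM.
have b4 : bmeas (fun z => (N - 1) * \int[P]_o (f (obsX z) o * h (obsX z) o)).
  exact: bmeasM.
have b5 : bmeas (fun z => (N - 1) * (N - 2) * (p1 (obsX z) * p2 (obsX z))).
  exact: bmeasM.
have b6 := bmeasD b4 b5; have b7 := bmeasD b3 b6.
rewrite RintD// RintD// RintD// !RintZl// RintD//.
have e1 : \int[P]_z (f (obsX z) z * h (obsX z) z) =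
    \int[P]_o (U o * V o * (KK j1 o * KK j2 o)).
  by apply: eq_Rintegral => o _; rewrite /f /h; ring.
have e2 : \int[P]_z \int[P]_o (f (obsX z) o * h (obsX z) o) =
    \int[P]_o (U o * V o * KK (minn j1 j2) o).
  rewrite (Rint_exchange P P (bmeasM bf2 bh2))/=; apply: eq_Rintegral => o _.
  rewrite -(kernel_compose _ _ J1 J2).
  pose k x := proj_kernel W j1 (obsX o) x * proj_kernel W j2 (obsX o) x.
  have bk : bmeas k by apply: bmeasM; exact: bmeas_kernel.
  transitivity (\int[P]_z (U o * V o * k (obsX z))).
    by apply: eq_Rintegral => z _; rewrite /f /h /k; ring.
  rewrite RintZl; last exact: bmeas_obsX.
  by rewrite (Rint_obsX PX bk).
have e3 : \int[P]_z (p1 (obsX z) * p2 (obsX z)) = inner p1 p2.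
  by rewrite (Rint_obsX PX (h := fun x => p1 x * p2 x))//; exact: bmeasM.
by rewrite e1 e2 e3 /f /h; ring.
Qed.

End means.

(** * Testing against indicators *)

Section uniform_layers.
Context {R : realType}.

Lemma unif01_itv (a b : R) : 0 <= a -> a <= b -> b <= 1 ->
  \int[unif01]_t \1_`[a, b[%classic t = b - a.
Proof.
move=> a0 ab b1; rewrite /Rintegral integral_indic//= setIT.
rewrite -[X in fine X]/(uniform_prob (@ltr01 R) `[a, b[%classic).
rewrite /uniform_prob integral_uniform_pdf.
rewrite (eq_integral (fun=> 1%:E)); last first.
  by move=> x; rewrite inE => -[_ /=]; rewrite in_itv/= /uniform_pdf => ->;
    rewrite subr0 invr1.
have mI : measurable (`[a, b[ `&` `[0, 1] : set R).
  by apply: measurableI; exact: measurable_itv.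
rewrite integral_cst//= mul1e setIidl; last first.
  move=> x /=; rewrite !in_itv/= => /andP[ax xb].
  by rewrite (le_trans a0 ax) (le_trans (ltW xb) b1).
rewrite lebesgue_measure_itv/= lte_fin; case: ltP => //= ba.
by apply/eqP; rewrite eq_sym subr_eq0 eq_le ba ab.
Qed.

End uniform_layers.

Lemma bmeas_lt_indic {disp} {T : measurableType disp} {R : realType}
    (f g : T -> R) : measurable_fun setT f -> measurable_fun setT g ->
  bmeas (fun x => (f x < g x)%R%:R : R).
Proof.
move=> mf mg; rewrite (_ : (fun x => _) = \1_((fun x => f x - g x) @^-1` `]-oo, 0[%classic)).
  apply: bmeas_indic; rewrite -[X in measurable X]setTI.
  by apply: measurable_funB => //; exact: measurable_itv.
apply/funext => x; rewrite indicE; congr (nat_of_bool _)%:R.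
by apply/idP/idP; rewrite inE/= in_itv/= subr_lt0.
Qed.

Lemma bmeas_itv_indic {disp} {T : measurableType disp} {R : realType}
    (f g k : T -> R) : measurable_fun setT f -> measurable_fun setT g ->
  measurable_fun setT k -> bmeas (fun x => \1_`[f x, g x[%classic (k x) : R).
Proof.
move=> mf mg mk; rewrite (_ : (fun x => _) =
    (fun x => (1 - (k x < f x)%R%:R) * (k x < g x)%R%:R)).
  apply: bmeasM; last exact: bmeas_lt_indic.
  by apply: bmeasB; [exact: bmeas_cst|exact: bmeas_lt_indic].
apply/funext => x; rewrite indicE mem_setE/= in_itv/=.
by rewrite leNgt; case: (k x < f x)%R => /=; rewrite ?subrr ?mul0r// subr0 mul1r.
Qed.

Section conditional_expectation.
Context {R : realType} {d : nat}.
Local Notation obs := (d.-tuple R * R * R)%type.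
Local Notation X := (d.-tuple R).
Variable P : probability obs R.

(** Testing against indicators suffices: a function with values in [0,1] is an
    average of indicators of its superlevel sets. *)
Lemma test_indicators (H : obs -> R) : bmeas H ->
  (forall B, measurable B -> \int[P]_(o in @obsX R d @^-1` B) H o = 0) ->
  forall h : X -> R, bmeas h -> \int[P]_o (H o * h (obsX o)) = 0.
Proof.
move=> bH H0 h bh; have [C hC] := bh.2.
have C0 : 0 <= C by exact: le_trans (hC [tuple 0 | i < d]).
(* an affine image of [h] with values in the unit interval *)
pose D := 2 * (C + 1); have D0 : 0 < D by rewrite mulr_gt0// ltr_wpDl.
pose h' x := (h x + (C + 1)) / D.
have bc := bmeas_cst.
have bh' : bmeas h' by apply: bmeasM => //; exact: bmeasD.
have h'01 x : 0 <= h' x <= 1.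
  have := hC x; rewrite ler_norml => /andP[h1 h2].
  by rewrite divr_ge0 ?(ltW D0) ?ler_pdivrMr ?mul1r//= /D; lra.
have intH : \int[P]_o H o = 0.
  by have := H0 setT measurableT; rewrite preimage_setT.
suff h'0 : \int[P]_o (H o * h' (obsX o)) = 0.
  have -> : \int[P]_o (H o * h (obsX o)) =
      \int[P]_o (D * (H o * h' (obsX o)) - (C + 1) * H o).
    by apply: eq_Rintegral => o _; rewrite /h'; field; rewrite lt0r_neq0.
  have b1 : bmeas (fun o => H o * h' (obsX o)).
    by apply: bmeasM => //; exact: bmeas_obsX.
  rewrite RintB; [|exact: bmeasM|exact: bmeasM].
  by rewrite !RintZl// h'0 intH !mulr0 subr0.
pose F (ot : obs * R) := H ot.1 * \1_`[0, h' (obsX ot.1)[%classic ot.2.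
have bF : bmeas F.
  apply: bmeasM; first exact: (bmeas_comp measurable_fst).
  apply: bmeas_itv_indic => //.
  exact: (measurableT_comp (bmeas_obsX bh').1 measurable_fst).
transitivity (\int[P]_o \int[unif01]_t F (o, t)).
  apply: eq_Rintegral => o _; have /andP[h0 h1] := h'01 (obsX o).
  rewrite -[RHS]/(\int[unif01]_t (H o * \1_`[0, h' (obsX o)[%classic t)).
  rewrite RintZl; first by rewrite unif01_itv// subr0.
  by apply: bmeas_indic; exact: measurable_itv.
rewrite (Rint_exchange P unif01 bF) -[RHS](Rint_cst unif01).
apply: eq_Rintegral => t _ /=.
pose B := [set x | (0 <= t) && (t < h' x)].
have mB : measurable B.
  have [t0|t0] := leP 0 t; last first.
    rewrite (_ : B = set0)//; apply/seteqP; split => x //=.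
    by rewrite /B/= leNgt t0.
  rewrite (_ : B = h' @^-1` `]t, +oo[%classic).
    by rewrite -[X in measurable X]setTI; apply: bh'.1 => //; exact: measurable_itv.
  by apply/seteqP; split => x; rewrite /B/= t0 in_itv/= andbT.
rewrite -(H0 B mB) [RHS]Rintegral_mkcond; apply: eq_Rintegral => o _.
rewrite patchE; have -> : (o \in @obsX R d @^-1` B) = (obsX o \in B).
  by apply/idP/idP; rewrite !inE.
have -> : (obsX o \in B) = (t \in `[0, h' (obsX o)[%classic).
  by apply/idP/idP; rewrite !inE /B/= ?in_itv.
by rewrite /F/= indicE; case: (_ \in _); rewrite ?mulr1 ?mulr0.
Qed.

End conditional_expectation.

(** * Versions of conditional expectations *)

Section clamping.
Context {R : realType}.
Implicit Types a b x y : R.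

(** Responses and versions of their conditional means lie in the interval only almost
    surely; clamping gives representatives that are bounded everywhere. *)
Definition clamp a b x := Num.max a (Num.min b x).

Lemma clamp_itv a b x : a <= b -> a <= clamp a b x <= b.
Proof. by move=> ab; rewrite /clamp le_max lexx/= ge_max ab ge_min lexx. Qed.

Lemma clamp_id a b x : a <= x <= b -> clamp a b x = x.
Proof. by move=> /andP[ax xb]; rewrite /clamp min_r// max_r. Qed.

Lemma norm_le_of_itv a b x : a <= x <= b -> `|x| <= `|a| + `|b|.
Proof.
move=> /andP[h1 h2]; rewrite ler_norml; apply/andP; split.
  have := ler_norm (- a); rewrite normrN; have := normr_ge0 b; lra.
have := ler_norm b; have := normr_ge0 a; lra.
Qed.

Lemma clamp_lipschitz a b x y : `|clamp a b x - clamp a b y| <= `|x - y|.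
Proof.
have le (u v : R) : clamp a b u - clamp a b v <= `|u - v|.
  have := ler_norm (u - v); have := normr_ge0 (u - v); rewrite /clamp.
  by case: (leP b u); case: (leP b v) => ? ?; rewrite !maxEle;
    do ?case: ifP => ?; lra.
by rewrite ler_norml le (lerNl _ (_ - _)) opprB distrC le.
Qed.

Lemma measurable_clamp a b : measurable_fun setT (clamp a b).
Proof.
by apply: measurable_maxr; [exact: measurable_cst|apply: measurable_minr => //;
  exact: measurable_cst].
Qed.

Lemma bmeas_clamp {disp} {T : measurableType disp} (f : T -> R) a b : a <= b ->
  measurable_fun setT f -> bmeas (fun t => clamp a b (f t)).
Proof.
move=> ab mf; split; first exact: (measurableT_comp (measurable_clamp a b) mf).
by exists (`|a| + `|b|) => t; exact: norm_le_of_itv (clamp_itv _ ab).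
Qed.

End clamping.

Lemma ae_zero {disp} {T : measurableType disp} {R : realType}
    (P : probability T R) (E : set T) (H : T -> R) :
  measurable E -> P.-integrable setT (EFin \o H) ->
  \int[P]_(x in E) H x = 0 -> {ae P, forall x, E x -> 0 <= H x} ->
  {ae P, forall x, E x -> H x = 0}.
Proof.
move=> mE iH H0 aeH.
have iHE : P.-integrable E (EFin \o H) by exact: integrableS iH.
have mH : measurable_fun E (EFin \o H) by exact: measurable_int iHE.
have e0 : (\int[P]_(x in E) (EFin \o H) x = 0)%E.
  have := integrable_fin_num mE iHE; move: H0; rewrite /Rintegral/=.
  by case: integral => //= r ->.
have : (\int[P]_(x in E) `|(EFin \o H) x| = 0)%E.
  rewrite -[RHS]e0; apply: ae_eq_integral => //; first exact: measurableT_comp.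
  by apply: filterS aeH => x h Ex /=; rewrite ger0_norm// h.
move/(ae_eq_integral_abs P mE mH); apply: filterS => x h Ex.
by have /= [] := h Ex.
Qed.

Lemma Rint_ae_eq {disp} {T : measurableType disp} {R : realType}
    (P : probability T R) (E : set T) (f g : T -> R) : measurable E ->
  measurable_fun E f -> measurable_fun E g -> {ae P, forall x, f x = g x} ->
  \int[P]_(x in E) f x = \int[P]_(x in E) g x.
Proof.
move=> mE mf mg fg; congr fine; apply: ae_eq_integral => //; try exact/measurable_EFinP.
by apply: filterS fg => x /= ->.
Qed.

Section versions.
Context {R : realType} {d : nat}.
Local Notation obs := (d.-tuple R * R * R)%type.
Local Notation X := (d.-tuple R).
Variable P : probability obs R.
Hypothesis PX : forall B, measurable B -> P (@obsX R d @^-1` B) = unif B.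

Lemma measurable_obsX_preimage (B : set X) : measurable B ->
  measurable (@obsX R d @^-1` B).
Proof. by move=> mB; rewrite -[X in measurable X]setTI; exact: measurable_obsX. Qed.

Section one_variable.
Variables (V : obs -> R) (a b : R).
Hypothesis ab : a <= b.
Hypothesis mV : measurable_fun setT V.
Hypothesis Vab : {ae P, forall o, a <= V o <= b}.

Lemma clamp_ae : {ae P, forall o, clamp a b (V o) = V o}.
Proof. by apply: filterS Vab => o; exact: clamp_id. Qed.

(** On the event that [g] exceeds [b], the function [g - V] is nonnegative with
    vanishing integral; likewise below [a]. *)
Lemma condE_bounds g : is_condE P V g ->
  {ae P, forall o, clamp a b (g (obsX o)) = g (obsX o)}.
Proof.
move=> [mg iV ig gE].
have int0 B : measurable B -> \int[P]_(o in @obsX R d @^-1` B) (g (obsX o) - V o) = 0.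
  move=> mB; have mB' := measurable_obsX_preimage mB.
  rewrite RintegralB//; [|exact: integrableS ig|exact: integrableS iV].
  by rewrite gE// subrr.
have mgt : measurable [set x | b < g x].
  rewrite (_ : [set x | _] = g @^-1` `]b, +oo[%classic).
    by rewrite -[X in measurable X]setTI; apply: mg => //; exact: measurable_itv.
  by apply/seteqP; split => x /=; rewrite in_itv/= andbT.
have mlt : measurable [set x | g x < a].
  rewrite (_ : [set x | _] = g @^-1` `]-oo, a[%classic).
    by rewrite -[X in measurable X]setTI; apply: mg => //; exact: measurable_itv.
  by apply/seteqP; split => x /=; rewrite in_itv/=.
have h1 : {ae P, forall o, [set x | b < g x] (obsX o) -> g (obsX o) - V o = 0}.
  apply: (ae_zero (measurable_obsX_preimage mgt) _ (int0 _ mgt)).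
    exact: (integrableB _ ig iV).
  apply: filterS Vab => o /andP[_ Vb] /= bg; rewrite subr_ge0.
  exact: le_trans Vb (ltW bg).
have h2 : {ae P, forall o, [set x | g x < a] (obsX o) -> V o - g (obsX o) = 0}.
  apply: (ae_zero (measurable_obsX_preimage mlt)).
  - exact: (integrableB _ iV ig).
  - have mlt' := measurable_obsX_preimage mlt.
    rewrite RintegralB//; [|exact: integrableS iV|exact: integrableS ig].
    by rewrite gE// subrr.
  - apply: filterS Vab => o /andP[Va _] /= bg; rewrite subr_ge0.
    exact: le_trans (ltW bg) Va.
apply: filterS3 h1 h2 Vab => o /= h1 h2 /andP[Va Vb]; apply: clamp_id.
rewrite !leNgt; apply/andP; split; apply/negP.
  by move=> ga; have := h2 ga; lra.
by move=> bg; have := h1 bg; lra.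
Qed.

(** The defining property only tests against indicators of events of the
    covariate; averaging superlevel sets extends it to bounded functions. *)
Lemma condE_test g : is_condE P V g -> forall h : X -> R, bmeas h ->
  \int[P]_o (clamp a b (V o) * h (obsX o)) =
  \int[unif]_x (clamp a b (g x) * h x).
Proof.
move=> gE h bh; have [mg iV ig gB] := gE.
have bV := bmeas_clamp ab mV; have bg := bmeas_clamp ab mg.
have bgX := bmeas_obsX bg; have bhX := bmeas_obsX bh.
rewrite -(Rint_obsX PX (h := fun x => clamp a b (g x) * h x)); last exact: bmeasM.
apply/eqP; rewrite -subr_eq0 -RintB; [|exact: bmeasM|exact: bmeasM].
under eq_Rintegral do rewrite -mulrBl.
apply/eqP; apply: (test_indicators
  (H := fun o => clamp a b (V o) - clamp a b (g (obsX o)))) => //.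
  exact: bmeasB.
move=> B mB; have mB' := measurable_obsX_preimage mB.
rewrite RintegralB//; try exact: bmeas_integrable.
apply/eqP; rewrite subr_eq0; apply/eqP.
rewrite (Rint_ae_eq mB' _ _ clamp_ae); [|exact: measurable_funTS bV.1|exact: measurable_funTS].
rewrite gB//; apply: Rint_ae_eq => //.
- apply: measurable_funTS; exact: (measurableT_comp mg measurable_obsX).
- exact: measurable_funTS bgX.1.
- by apply: filterS (condE_bounds gE).
Qed.

Lemma version_integrable : P.-integrable setT (EFin \o V).
Proof.
have bV := bmeas_clamp ab mV.
have /integrableP[_ h] := bmeas_integrable P measurableT bV.
apply/integrableP; split; first exact/measurable_EFinP.
rewrite (_ : (\int[P]_x `|(EFin \o V) x|)%E =
  (\int[P]_x `|(EFin \o (fun o => clamp a b (V o))) x|)%E)//.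
apply: ae_eq_integral => //.
- by apply: measurableT_comp => //; exact/measurable_EFinP.
- by apply: measurableT_comp => //; apply/measurable_EFinP; exact: bV.1.
- by apply: filterS clamp_ae => o /= ->.
Qed.

(** Existence, by the Radon-Nikodym theorem for the image of [V dP]. *)
Lemma condE_exists : exists g, is_condE P V g.
Proof.
have bV := bmeas_clamp ab mV.
have iVc := bmeas_integrable P measurableT bV.
have mX := @measurable_obsX R d.
pose nu' : {charge set X -> \bar R} :=
  [the {charge set X -> \bar R} of pushforward (induced_charge iVc) (@obsX R d)].
pose nu := nu' mX.
have nuE A : nu A = (\int[P]_(o in @obsX R d @^-1` A) (clamp a b (V o))%:E)%E by [].
have dom : nu `<< unif.
  apply/null_content_dominatesP => A mA A0; rewrite nuE.
  have mA' := measurable_obsX_preimage mA.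
  apply: null_set_integral => //; last exact: etrans (PX mA) A0.
  by apply/measurable_EFinP; exact: measurable_funTS bV.1.
have rfin x := Radon_Nikodym_fin_num x dom.
have rint := Radon_Nikodym_integrable dom.
have rE A (mA : measurable A) := Radon_Nikodym_integral dom mA.
set r := Radon_Nikodym nu unif in rfin rint rE.
pose g x := fine (r x).
have gr : EFin \o g = r by apply/funext => x; rewrite /g/= fineK.
have ig : (unif : probability X R).-integrable setT (EFin \o g) by rewrite gr.
have mg : measurable_fun setT g by apply/measurable_EFinP; exact: measurable_int ig.
have igX : P.-integrable setT (EFin \o (g \o @obsX R d)).
  have /integrableP[_ h] := ig; apply/integrableP; split.
    by apply/measurable_EFinP; exact: measurableT_comp.
  have m1 : measurable_fun setT (fun x => `|(EFin \o g) x|)%E.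
    by apply: measurableT_comp => //; exact/measurable_EFinP.
  rewrite (_ : (\int[P]_x _)%E = (\int[distribution P (@obsX R d)]_y `|(EFin \o g) y|)%E).
    by rewrite (eq_measure_integral unif)// => A mA _; exact: PX.
  by rewrite ge0_integral_distribution.
exists g; split => //; first exact: version_integrable.
move=> B mB; have mB' := measurable_obsX_preimage mB.
rewrite -(Rint_ae_eq mB' _ _ clamp_ae); [|exact: measurable_funTS bV.1|exact: measurable_funTS].
rewrite /Rintegral; congr fine; rewrite -nuE rE// -gr.
have h := integral_pushforward (mu := P) measurable_obsX (D := B) (f := EFin \o g) _ _ mB.
rewrite -[RHS]h; first last.
- exact: integrableS igX.
- exact/measurable_EFinP.
by apply: eq_measure_integral => A mA _; exact: esym (PX mA).
Qed.

End one_variable.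
End versions.

(** * Bounded regressions of a law of the class *)

Section model_representation.
Context {R : realType} {d : nat}.
Local Notation obs := (d.-tuple R * R * R)%type.
Local Notation X := (d.-tuple R).

Lemma measurable_obsA : measurable_fun setT (@obsA R d).
Proof. exact: (measurableT_comp measurable_snd measurable_fst). Qed.

Lemma measurable_obsY : measurable_fun setT (@obsY R d).
Proof. exact: measurable_snd. Qed.

Lemma ae_exists {disp} {T : measurableType disp} (P : probability T R)
  (Q : T -> Prop) : {ae P, forall x, Q x} -> exists x, Q x.
Proof.
move=> aeQ; apply/not_existsP => nQ.
have [N [mN N0 sub]] := aeQ.
have : P setT = 0.
  by apply: (subset_measure0 _ mN _ N0) => // x _; apply: sub; exact: nQ.
by rewrite probability_setT => /eqP; rewrite onee_eq0.
Qed.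

Section marginal.
Variable P : probability obs R.
Hypothesis PX : forall B, measurable B -> P (@obsX R d @^-1` B) = unif B.

Lemma ae_obsX (Q : set X) : measurable Q ->
  {ae P, forall o, Q (obsX o)} -> {ae unif, forall x, Q x}.
Proof.
move=> mQ [N [mN N0 sub]]; exists (~` Q); split => //; first exact: measurableC.
rewrite -[LHS]PX; last exact: measurableC.
apply: (subset_measure0 _ mN _ N0).
  by apply: measurable_obsX_preimage; exact: measurableC.
by move=> o nQ; apply: sub.
Qed.

Lemma clamp_version_ae (a b : R) (g : X -> R) : measurable_fun setT g ->
  {ae P, forall o, clamp a b (g (obsX o)) = g (obsX o)} ->
  {ae unif, forall x, clamp a b (g x) = g x}.
Proof.
move=> mg; apply: (ae_obsX (Q := [set x | clamp a b (g x) = g x])).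
rewrite (_ : [set x | _] = (fun x => clamp a b (g x) - g x) @^-1` [set 0]).
  rewrite -[X in measurable X]setTI; apply: measurable_funB => //.
  exact: (measurableT_comp (measurable_clamp a b) mg).
by apply/seteqP; split => x /= => [->|/eqP]; rewrite ?subrr// subr_eq0 => /eqP.
Qed.

Lemma inner_clamp_version (a b : R) (g h : X -> R) : a <= b ->
  measurable_fun setT g ->
  {ae P, forall o, clamp a b (g (obsX o)) = g (obsX o)} -> bmeas h ->
  inner (fun x => clamp a b (g x)) h = inner g h.
Proof.
move=> ab mg gE bh; apply: Rint_ae_eq => //.
- by apply: (bmeasM (bmeas_clamp ab mg) bh).1.
- by apply: measurable_funM => //; exact: bh.1.
- by apply: filterS (clamp_version_ae mg gE) => x ->.
Qed.

End marginal.

Lemma unif_continuous_clamp (a b : R) (g : X -> R) :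
  unif_continuous_on_cube g -> unif_continuous_on_cube (fun x => clamp a b (g x)).
Proof.
move=> ug e e0; have [r r0 gr] := ug e e0; exists r => // x y cx cy xy.
by rewrite (le_lt_trans (clamp_lipschitz _ _ _ _))// gr.
Qed.

Variable W : wavelets R d.
Hypothesis HW : cdv_basis W.
Hypothesis d0 : (0 < d)%N.

Lemma holder_norm_ext (a M : R) (f g : X -> R) :
  (forall h, bmeas h -> inner f h = inner g h) ->
  (holder_norm W a f <= M%:E)%E -> (holder_norm W a g <= M%:E)%E.
Proof.
move=> fg /(holder_normP HW d0)[B [B' [[h1 h2 h3 h4] BM]]].
apply/(holder_normP HW d0); exists B, B'; split => //; split => // [m|l p Jl].
  by rewrite -fg//; exact: bmeas_Phi.
by rewrite -fg ?h4//; exact: bmeas_Psi.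
Qed.

(** The law enters the analysis through bounded regression functions and the
    moments of the (bounded) responses against functions of the covariate. *)
Definition regressions (C1 C2 a b M : R) (P : probability obs R)
    (p q : X -> R) : Prop :=
  [/\ bmeas p, bmeas q, (forall x, C1 <= p x <= C2) & (forall x, C1 <= q x <= C2)] /\
  [/\ holder_ball W a M p, holder_ball W b M q,
    (forall h, bmeas h ->
      \int[P]_o (clamp C1 C2 (obsA o) * h (obsX o)) = inner p h) &
    (forall h, bmeas h ->
      \int[P]_o (clamp C1 C2 (obsY o) * h (obsX o)) = inner q h)].

Lemma condE_regression C1 C2 a M (P : probability obs R) (V : obs -> R) g : C1 <= C2 ->
  (forall B, measurable B -> P (@obsX R d @^-1` B) = unif B) ->
  measurable_fun setT V -> {ae P, forall o, C1 <= V o <= C2} ->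
  is_condE P V g -> holder_ball W a M g ->
  let p x := clamp C1 C2 (g x) in
  [/\ bmeas p, (forall x, C1 <= p x <= C2), holder_ball W a M p &
    (forall h, bmeas h -> \int[P]_o (clamp C1 C2 (V o) * h (obsX o)) = inner p h)].
Proof.
move=> C12 PX mV Vab gE [ug hg] p; have mg : measurable_fun setT g by have [] := gE.
split.
- exact: bmeas_clamp.
- by move=> x; exact: clamp_itv.
- split; first exact: unif_continuous_clamp.
  apply: holder_norm_ext hg => h bh; apply/esym.
  by apply: (inner_clamp_version PX) => //; exact: (condE_bounds Vab).
- by move=> h bh; exact: (condE_test PX C12 mV Vab gE).
Qed.

Lemma condE_spec (P : probability obs R) (V : obs -> R) :
  (exists g, is_condE P V g) -> is_condE P V (condE P V).
Proof. by move=> [g gE]; rewrite /condE; apply: xgetPex; exists g. Qed.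

Lemma model_regressions C1 C2 a b M P : in_model W C1 C2 a b M P ->
  C1 <= C2 /\ (forall B, measurable B -> P (@obsX R d @^-1` B) = unif B) /\
  exists p q, regressions C1 C2 a b M P p q.
Proof.
move=> [PX Aae Yae [g gE hg] [g' g'E hg']].
have C12 : C1 <= C2.
  by have [z /andP[] /le_trans] := ae_exists Aae; apply.
split => //; split => //.
have [r1 r2 r3 r4] := condE_regression C12 PX measurable_obsA Aae gE hg.
have [k1 k2 k3 k4] := condE_regression C12 PX measurable_obsY Yae g'E hg'.
exists (fun x => clamp C1 C2 (g x)), (fun x => clamp C1 C2 (g' x)).
by split; split.
Qed.

(** The conditional mean of the product integrates to [E(A Y)]; the two chosen
    versions of the regressions may differ from [p] and [q], but not when tested
    against bounded functions. *)
Lemma psiE C1 C2 a b M P p q : in_model W C1 C2 a b M P ->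
  regressions C1 C2 a b M P p q ->
  psi P = \int[P]_o (clamp C1 C2 (obsA o) * clamp C1 C2 (obsY o)) - inner p q.
Proof.
move=> mP [[bp bq _ _] [_ _ Up Vq]].
have [C12 [PX _]] := model_regressions mP.
have [_ Aae Yae [g gE _] [g' g'E _]] := mP.
have aE := condE_spec (ex_intro _ _ gE); have yE := condE_spec (ex_intro _ _ g'E).
have mA := measurable_obsA; have mY := measurable_obsY.
pose K := (`|C1| + `|C2|) ^+ 2.
have mAY : measurable_fun setT (fun o : obs => obsA o * obsY o).
  exact: measurable_funM.
have AYae : {ae P, forall o, - K <= obsA o * obsY o <= K}.
  apply: filterS2 Aae Yae => o /norm_le_of_itv hA /norm_le_of_itv hY.
  by rewrite -ler_norml normrM /K expr2 ler_pM.
have K0 : 0 <= K by exact: sqr_ge0.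
have KK : - K <= K by lra.
have cE := condE_spec (condE_exists PX KK mAY AYae).
set c := condE P _ in cE *; set g1 := condE P _ in aE; set g2 := condE P _ in yE.
have [mg1 _ _ _] := aE; have [mg2 _ _ _] := yE; have [mc _ ic cB] := cE.
have bg1 := bmeas_clamp C12 mg1; have bg2 := bmeas_clamp C12 mg2.
have test1 h : bmeas h -> inner (fun x => clamp C1 C2 (g1 x)) h = inner p h.
  by move=> bh; rewrite -Up//; apply/esym; exact: (condE_test PX C12 mA Aae aE).
have test2 h : bmeas h -> inner (fun x => clamp C1 C2 (g2 x)) h = inner q h.
  by move=> bh; rewrite -Vq//; apply/esym; exact: (condE_test PX C12 mY Yae yE).
have innE : inner p q = inner (fun x => clamp C1 C2 (g1 x)) (fun x => clamp C1 C2 (g2 x)).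
  by rewrite test1// [RHS]innerC test2// innerC.
have bgg : bmeas (fun x => clamp C1 C2 (g1 x) * clamp C1 C2 (g2 x)) by exact: bmeasM.
have mX := @measurable_obsX R d.
transitivity (\int[P]_o (c (obsX o) -
    clamp C1 C2 (g1 (obsX o)) * clamp C1 C2 (g2 (obsX o)))).
  apply: Rint_ae_eq => //.
  - apply: measurable_funB; first exact: (measurableT_comp mc mX).
    by apply: measurable_funM; [exact: (measurableT_comp mg1 mX)|exact: (measurableT_comp mg2 mX)].
  - apply: measurable_funB; first exact: (measurableT_comp mc mX).
    exact: (bmeas_obsX bgg).1.
  - apply: filterS2 (condE_bounds Aae aE) (condE_bounds Yae yE) => o e1 e2.
    by rewrite /condCov -/c -/g1 -/g2 e1 e2.
rewrite RintegralB//; last exact: (bmeas_integrable P measurableT (bmeas_obsX bgg)).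
congr (_ - _); last by rewrite (Rint_obsX PX bgg) innE.
have := cB setT measurableT; rewrite preimage_setT => <-.
apply/esym; apply: Rint_ae_eq => //.
- by apply: (bmeasM (bmeas_clamp C12 mA) (bmeas_clamp C12 mY)).1.
- apply: filterS2 Aae Yae => o h1 h2.
  by rewrite !clamp_id.
Qed.

End model_representation.

(** * The estimators in terms of the two statistics *)

Section estimators.
Context {R : realType} {d : nat}.
Local Notation obs := (d.-tuple R * R * R)%type.
Local Notation X := (d.-tuple R).
Variable W : wavelets R d.
Hypothesis HW : cdv_basis W.
Local Notation J0 := (base_level W).
Local Notation AY := (fun o : obs => obsA o * obsY o).

Lemma p_hatE j n (D : n.-tuple obs) x : p_hat W j D x = smooth W j (@obsA R d) D x.
Proof. by rewrite smoothE. Qed.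

Lemma b_hatE j n (D : n.-tuple obs) x : b_hat W j D x = smooth W j (@obsY R d) D x.
Proof. by rewrite smoothE. Qed.

(** Integrating the product of the two smoothers composes their kernels. *)
Lemma inner_smooth j1 j2 n (U V : obs -> R) (D : n.-tuple obs) :
  (J0 <= j1)%N -> (J0 <= j2)%N ->
  inner (smooth W j1 U D) (smooth W j2 V D) = emp_quad W (minn j1 j2) U V D.
Proof.
move=> J1 J2; rewrite -emp_quadE.
have sE j F : smooth W j F D = fun x => \sum_(i < n)
    (n%:R^-1 * F (tnth D i)) * proj_kernel W j (obsX (tnth D i)) x.
  by apply/funext => x; rewrite smoothE mulr_sumr; apply: eq_bigr => i _; rewrite mulrA.
have bK j (i : 'I_n) : (J0 <= j)%N -> bmeas (proj_kernel W j (obsX (tnth D i))).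
  by move=> Jj; exact: bmeas_kernel.
have bsm : bmeas (smooth W j2 V D) by rewrite sE; apply: bmeas_lin => i; exact: bK.
rewrite {1}sE inner_suml//; last by move=> i; exact: bK.
rewrite mulr_sumr; apply: eq_bigr => i _; rewrite -mulrA; congr (_ * (_ * _)).
rewrite innerC sE inner_suml//; [|by move=> l; exact: bK|exact: bK].
rewrite sE; apply: eq_bigr => l _.
by rewrite innerC (kernel_compose HW) // proj_kernelC.
Qed.

Lemma psi_INT_E j1 j2 n (D : n.-tuple obs) : (J0 <= j1)%N -> (J0 <= j2)%N ->
  psi_INT W j1 j2 D =
  emp AY D - emp_quad W (minn j1 j2) (@obsA R d) (@obsY R d) D.
Proof.
move=> J1 J2; rewrite /psi_INT -inner_smooth//; congr (_ - _).
by apply: eq_Rintegral => x _; rewrite p_hatE b_hatE.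
Qed.

Lemma psi_MC_E j1 j2 n (D : n.-tuple obs) :
  psi_MC W j1 j2 D =
  emp AY D - emp_cross W j1 j2 (@obsA R d) (@obsY R d) D.
Proof.
rewrite /psi_MC; congr (_ - _ * _); apply: eq_bigr => i _.
by rewrite p_hatE b_hatE.
Qed.

(** The mixed terms of the product of residuals are quadratic statistics, each at
    the level of the smoother involved. *)
Lemma psi_IF_E j1 j2 n (D : n.-tuple obs) :
  psi_IF W j1 j2 D =
  emp AY D - emp_quad W j2 (@obsA R d) (@obsY R d) D -
  emp_quad W j1 (@obsA R d) (@obsY R d) D +
  emp_cross W j1 j2 (@obsA R d) (@obsY R d) D.
Proof.
rewrite [emp_quad W j1 _ _ _]emp_quadC -!emp_quadE /emp_cross /emp /tsum -!mulrBr -mulrDr.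
rewrite -!sumrB -big_split/= /psi_IF; congr (_ * _); apply: eq_bigr => i _.
by rewrite p_hatE b_hatE; ring.
Qed.

Lemma measurable_emp n (f : obs -> R) : measurable_fun setT f ->
  measurable_fun setT (@emp R d n f).
Proof.
move=> mf; apply: measurable_funM; first exact: measurable_cst.
apply: measurable_sum => i.
exact: (measurableT_comp mf (measurable_tnth i)).
Qed.

Lemma measurable_feat j (U : obs -> R) (m : loc W j) : (J0 <= j)%N ->
  measurable_fun setT U -> measurable_fun setT (feat U m).
Proof.
move=> Jj mU; apply: measurable_funM => //.
exact: (bmeas_obsX (bmeas_Phi HW m Jj)).1.
Qed.

Lemma measurable_emp_quad j n (U V : obs -> R) : (J0 <= j)%N ->
  measurable_fun setT U -> measurable_fun setT V ->
  measurable_fun setT (@emp_quad R d W j n U V).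
Proof.
move=> Jj mU mV; apply: measurable_sum => m.
by apply: measurable_funM; apply: measurable_emp; exact: measurable_feat.
Qed.

Lemma measurable_emp_cross j1 j2 n (U V : obs -> R) :
  (J0 <= j1)%N -> (J0 <= j2)%N ->
  measurable_fun setT U -> measurable_fun setT V ->
  measurable_fun setT (@emp_cross R d W j1 j2 n U V).
Proof.
have msm j F (i : 'I_n) : (J0 <= j)%N -> measurable_fun setT F ->
    measurable_fun setT (fun D : n.-tuple obs => smooth W j F D (obsX (tnth D i))).
  move=> Jj mF; apply: measurable_sum => m; apply: measurable_funM.
    by apply: measurable_emp; exact: measurable_feat.
  exact: (measurableT_comp (bmeas_obsX (bmeas_Phi HW m Jj)).1 (measurable_tnth i)).
move=> J1 J2 mU mV; apply: measurable_funM; first exact: measurable_cst.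
by apply: measurable_sum => i; apply: measurable_funM; exact: msm.
Qed.

Definition trunc_obs (C1 C2 : R) (z : obs) : obs :=
  (obsX z, clamp C1 C2 (obsA z), clamp C1 C2 (obsY z)).

Lemma measurable_trunc_obs C1 C2 : measurable_fun setT (trunc_obs C1 C2).
Proof.
apply: measurable_fun_pair; first apply: measurable_fun_pair.
- exact: measurable_obsX.
- exact: (measurableT_comp (measurable_clamp C1 C2) measurable_obsA).
- exact: (measurableT_comp (measurable_clamp C1 C2) measurable_obsY).
Qed.

Section truncation.
Variables (C1 C2 : R) (n : nat).
Local Notation U := (fun z : obs => clamp C1 C2 (obsA z)).
Local Notation V := (fun z : obs => clamp C1 C2 (obsY z)).

Lemma emp_trunc (f : obs -> R) (D : n.-tuple obs) :
  emp f (map_tuple (trunc_obs C1 C2) D) = emp (fun z => f (trunc_obs C1 C2 z)) D.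
Proof. by congr (_ * _); apply: eq_bigr => i _; rewrite tnth_map. Qed.

Lemma emp_quad_trunc j (D : n.-tuple obs) :
  emp_quad W j (@obsA R d) (@obsY R d) (map_tuple (trunc_obs C1 C2) D) =
  emp_quad W j U V D.
Proof. by apply: eq_bigr => m _; rewrite !emp_trunc. Qed.

Lemma emp_cross_trunc j1 j2 (D : n.-tuple obs) :
  emp_cross W j1 j2 (@obsA R d) (@obsY R d) (map_tuple (trunc_obs C1 C2) D) =
  emp_cross W j1 j2 U V D.
Proof.
have sE j (F : obs -> R) x : smooth W j F (map_tuple (trunc_obs C1 C2) D) x =
    smooth W j (fun z => F (trunc_obs C1 C2 z)) D x.
  by apply: eq_bigr => m _; rewrite emp_trunc.
by congr (_ * _); apply: eq_bigr => i _; rewrite !sE tnth_map.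
Qed.

End truncation.

(** The squared error only sees the bounded versions of the responses. *)
Lemma risk_trunc C1 C2 a b M (P : probability obs R) n
    (f : n.-tuple obs -> R) (g : n.-tuple obs -> R) c :
  in_model W C1 C2 a b M P -> measurable_fun setT f -> bmeas g ->
  (forall D, f (map_tuple (trunc_obs C1 C2) D) = g D) ->
  (\int[iid P n]_D ((f D - c) ^+ 2)%:E)%E =
  (\int[iid P n]_D ((g D - c) ^+ 2))%:E.
Proof.
move=> [_ Aae Yae _ _] mf bg fg.
have bgc : bmeas (fun D => (g D - c) ^+ 2).
  by apply: bmeasX; apply: bmeasB => //; exact: bmeas_cst.
rewrite (integral_iid_map (measurable_trunc_obs C1 C2)).
- by rewrite EFin_Rint//; apply: eq_integral => D _; rewrite fg.
- apply: filterS2 Aae Yae => -[[x y] z] /= h1 h2.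
  by rewrite /trunc_obs/= !clamp_id.
- apply/measurable_EFinP.
  exact: (measurable_funX 2 (measurable_funB mf (@measurable_cst _ _ _ _ setT c))).
- by move=> D; rewrite lee_fin sqr_ge0.
Qed.

End estimators.

(** * Upper bounds on the risk *)

Lemma Rint_sqr3_le {disp} {T : measurableType disp} {R : realType}
    (P : probability T R) (f g : T -> R) c : bmeas f -> bmeas g ->
  \int[P]_x ((f x + g x + c) ^+ 2) <=
  3 * (\int[P]_x (f x ^+ 2) + \int[P]_x (g x ^+ 2) + c ^+ 2).
Proof.
move=> bf bg; have bc := bmeas_cst; have bf2 := bmeasX 2 bf; have bg2 := bmeasX 2 bg.
have b1 := bmeasD bf2 bg2.
rewrite -[c ^+ 2 in leRHS](Rint_cst P) -RintD// -RintD// -RintZl; last exact: bmeasD.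
apply: le_Rint => [||x].
- by apply: bmeasX; apply: bmeasD => //; exact: bmeasD.
- by apply: bmeasM => //; exact: bmeasD.
- have := sqr_ge0 (f x - g x); have := sqr_ge0 (f x - c); have := sqr_ge0 (g x - c); nra.
Qed.

Lemma Rint_sqr5_le {disp} {T : measurableType disp} {R : realType}
    (P : probability T R) (f g h k : T -> R) c :
  bmeas f -> bmeas g -> bmeas h -> bmeas k ->
  \int[P]_x ((f x + g x + h x + k x + c) ^+ 2) <=
  9 * (\int[P]_x (f x ^+ 2) + \int[P]_x (g x ^+ 2) + \int[P]_x (h x ^+ 2) +
       \int[P]_x (k x ^+ 2) + c ^+ 2).
Proof.
move=> bf bg bh bk.
have fg : bmeas (fun x => f x + g x + 0) by apply: bmeasD; [exact: bmeasD|exact: bmeas_cst].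
have hk : bmeas (fun x => h x + k x + 0) by apply: bmeasD; [exact: bmeasD|exact: bmeas_cst].
have := Rint_sqr3_le P c fg hk; have := Rint_sqr3_le P 0 bf bg.
have := Rint_sqr3_le P 0 bh bk; rewrite expr0n/=.
have -> : \int[P]_x ((f x + g x + 0 + (h x + k x + 0) + c) ^+ 2) =
    \int[P]_x ((f x + g x + h x + k x + c) ^+ 2).
  by apply: eq_Rintegral => x _; congr (_ ^+ 2); ring.
have := sqr_ge0 c; lra.
Qed.

Section upper_bounds.
Context {R : realType} {d : nat}.
Local Notation obs := (d.-tuple R * R * R)%type.
Local Notation X := (d.-tuple R).
Variable W : wavelets R d.
Hypothesis HW : cdv_basis W.
Hypothesis d0 : (0 < d)%N.
Local Notation J0 := (base_level W).
Local Notation K j := (resolution d j)%:R.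
Variables (C1 C2 a b M : R).
Hypotheses (a0 : 0 < a) (b0 : 0 < b).
Local Notation U := (fun z : obs => clamp C1 C2 (obsA z)).
Local Notation V := (fun z : obs => clamp C1 C2 (obsY z)).
Local Notation UV := (fun z : obs => clamp C1 C2 (obsA z) * clamp C1 C2 (obsY z)).
Local Notation rate j := (2 `^ (- (j%:R * (a + b)))).

Lemma coef_regression P p q j (m : loc W j) : (J0 <= j)%N ->
  regressions W C1 C2 a b M P p q ->
  coef P U m = inner p (Phi m) /\ coef P V m = inner q (Phi m).
Proof.
move=> Jj [_ [_ _ Up Vq]]; have bm := bmeas_Phi HW m Jj.
by split; [rewrite -Up|rewrite -Vq].
Qed.

Lemma proj_coef_regression P p q j : (J0 <= j)%N ->
  regressions W C1 C2 a b M P p q ->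
  proj_coef W P j U = projV W j p /\ proj_coef W P j V = projV W j q.
Proof.
move=> Jj reg; split; apply/funext => x; apply: eq_bigr => m _;
  by have [e1 e2] := coef_regression m Jj reg; rewrite ?e1 ?e2.
Qed.

Lemma inner_projV_min p q j1 j2 : (J0 <= j1)%N -> (J0 <= j2)%N ->
  bmeas p -> bmeas q ->
  inner (projV W j1 p) (projV W j2 q) = ipV W (minn j1 j2) p q.
Proof.
move=> J1 J2 bp bq; case/orP: (leq_total j1 j2) => h.
  by rewrite (minn_idPl h) (inner_projV_projV HW).
by rewrite (minn_idPr h) innerC (inner_projV_projV HW)// ipVC.
Qed.

(** Everything the risk bounds need, with one constant for the whole class. *)
Lemma stochastic_and_bias_bounds : exists K0, 0 <= K0 /\
  forall P, in_model W C1 C2 a b M P -> exists p q,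
  [/\ regressions W C1 C2 a b M P p q,
      forall n, (0 < n)%N ->
        \int[iid P n]_D ((emp UV D - \int[P]_z UV z) ^+ 2) <= K0 * n%:R^-1,
      forall n j, (0 < n)%N -> (J0 <= j)%N ->
        \int[iid P n]_D ((emp_quad W j U V D - ipV W j p q) ^+ 2) <=
        K0 * (n%:R^-1 + (K j / n%:R) ^+ 2),
      forall n j1 j2, (0 < n)%N -> (J0 <= j1)%N -> (J0 <= j2)%N ->
        \int[iid P n]_D ((emp_cross W j1 j2 U V D - ipV W (minn j1 j2) p q) ^+ 2)
        <= K0 * (n%:R^-1 + ((K j1 / n%:R) ^+ 2 + (K j2 / n%:R) ^+ 2) +
             ((K j1 / n%:R) ^+ 4 + (K j2 / n%:R) ^+ 4)) &
      forall j, (J0 <= j)%N ->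
        (inner p q - ipV W j p q) ^+ 2 <= K0 * rate j ^+ 2].
Proof.
have [C [CPhi _]] := cdv_frames HW.
have [Ba [Ba0 HBa]] := holder_proj_le HW d0 M a0.
have [Bb [Bb0 HBb]] := holder_proj_le HW d0 M b0.
have [Cb [Cb0 HCb]] := approximation_bias HW d0 M a0 b0.
pose B := `|C1| + `|C2| + Ba + Bb.
have B12 : `|C1| + `|C2| <= B by rewrite /B -addrA lerDl addr_ge0.
have nC1 := normr_ge0 C1; have nC2 := normr_ge0 C2.
have BBa : Ba <= B by rewrite /B; lra.
have BBb : Bb <= B by rewrite /B; lra.
have B0 : 0 <= B by rewrite /B; lra.
have q0 := quad_const_ge0 C B.
pose K0 := B ^+ 4 + quad_const C B + cross_const C B + Cb ^+ 2.
have B40 : 0 <= B ^+ 4 by exact: exprn_even_ge0.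
have Cb20 : 0 <= Cb ^+ 2 by exact: sqr_ge0.
have cc0 : 0 <= cross_const C B by exact: (cross_const_ge0 CPhi B0).
exists K0; split; first by rewrite /K0; lra.
move=> P mP; have [C12 [PX [p [q reg]]]] := model_regressions HW d0 mP.
have [[bp bq pC qC] [[_ hp] [_ hq] Up Vq]] := reg.
have bU : bmeas U := bmeas_clamp C12 measurable_obsA.
have bV : bmeas V := bmeas_clamp C12 measurable_obsY.
have UB z : `|U z| <= B by rewrite (le_trans (norm_le_of_itv (clamp_itv _ C12))).
have VB z : `|V z| <= B by rewrite (le_trans (norm_le_of_itv (clamp_itv _ C12))).
exists p, q; split => //.
- move=> n n0; have bUV : bmeas UV by exact: bmeasM.
  apply: le_trans (emp_var P n0 bUV) _; rewrite mulrC ler_wpM2r ?invr_ge0//.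
  apply: (@le_trans _ _ (B ^+ 4)); last by rewrite /K0; lra.
  apply: Rint_le => [|z]; first exact: bmeasX.
  rewrite -[4%N]/(2 * 2)%N exprM; apply: sqr_le_of_norm.
  by rewrite normrM expr2 ler_pM.
- move=> n j n0 Jj; have := emp_quad_risk HW CPhi PX n0 Jj bU bV UB VB.
  have -> : \sum_(m : loc W j) coef P U m * coef P V m = ipV W j p q.
    by apply: eq_bigr => m _; have [-> ->] := coef_regression m Jj reg.
  move=> h; apply: le_trans h _; apply: ler_wpM2r; last by rewrite /K0; lra.
  by rewrite addr_ge0 ?invr_ge0// sqr_ge0.
- move=> n j1 j2 n0 J1 J2.
  have [e1 _] := proj_coef_regression J1 reg; have [_ e2] := proj_coef_regression J2 reg.
  have := cross_risk HW PX CPhi B0 n0 J1 J2 bU bV UB VB.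
  rewrite e1 e2 inner_projV_min// => /(_ _ _)/wrap[x|x|h].
  + by rewrite (le_trans _ BBa)//; exact: HBa.
  + by rewrite (le_trans _ BBb)//; exact: HBb.
  apply: le_trans h _; apply: ler_wpM2r; last by rewrite /K0; lra.
  apply: addr_ge0; first by rewrite addr_ge0 ?invr_ge0// addr_ge0 ?sqr_ge0.
  by rewrite addr_ge0 ?exprn_even_ge0.
- move=> j Jj; apply: (@le_trans _ _ (Cb ^+ 2 * rate j ^+ 2)).
    by rewrite -exprMn; apply: sqr_le_of_norm; exact: HCb.
  by rewrite ler_wpM2r ?sqr_ge0// /K0; lra.
Qed.

Local Notation A := (@obsA R d).
Local Notation Y := (@obsY R d).

Lemma measurable_AY n : measurable_fun setT (@emp R d n (fun z => obsA z * obsY z)).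
Proof.
by apply: measurable_emp; apply: measurable_funM;
  [exact: measurable_obsA|exact: measurable_obsY].
Qed.

Lemma measurable_quad n j : (J0 <= j)%N -> measurable_fun setT (@emp_quad R d W j n A Y).
Proof.
by move=> Jj; apply: measurable_emp_quad => //; [exact: measurable_obsA|exact: measurable_obsY].
Qed.

Lemma measurable_psi_INT n j1 j2 : (J0 <= j1)%N -> (J0 <= j2)%N ->
  measurable_fun setT (@psi_INT R d W j1 j2 n).
Proof.
move=> J1 J2; have Jm : (J0 <= minn j1 j2)%N by rewrite leq_min J1.
rewrite (_ : @psi_INT _ _ _ _ _ _ = fun D => emp (fun z => obsA z * obsY z) D -
  emp_quad W (minn j1 j2) A Y D); last by apply/funext => D; rewrite psi_INT_E.
by apply: measurable_funB; [exact: measurable_AY|exact: measurable_quad].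
Qed.

Lemma measurable_psi_MC n j1 j2 : (J0 <= j1)%N -> (J0 <= j2)%N ->
  measurable_fun setT (@psi_MC R d W j1 j2 n).
Proof.
move=> J1 J2.
rewrite (_ : @psi_MC _ _ _ _ _ _ = fun D => emp (fun z => obsA z * obsY z) D -
  emp_cross W j1 j2 A Y D); last by apply/funext => D; rewrite psi_MC_E.
apply: measurable_funB; first exact: measurable_AY.
exact: (measurable_emp_cross HW J1 J2 measurable_obsA measurable_obsY).
Qed.

Lemma measurable_psi_IF n j1 j2 : (J0 <= j1)%N -> (J0 <= j2)%N ->
  measurable_fun setT (@psi_IF R d W j1 j2 n).
Proof.
move=> J1 J2.
rewrite (_ : @psi_IF _ _ _ _ _ _ = fun D => emp (fun z => obsA z * obsY z) D -
  emp_quad W j2 A Y D - emp_quad W j1 A Y D + emp_cross W j1 j2 A Y D); last first.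
  by apply/funext => D; rewrite psi_IF_E.
apply: measurable_funD; last first.
  exact: (measurable_emp_cross HW J1 J2 measurable_obsA measurable_obsY).
apply: measurable_funB; last exact: measurable_quad.
by apply: measurable_funB; [exact: measurable_AY|exact: measurable_quad].
Qed.

Section bounded_versions.
Hypothesis C12 : C1 <= C2.

Let bU : bmeas U. Proof. exact: (bmeas_clamp C12 measurable_obsA). Qed.
Let bV : bmeas V. Proof. exact: (bmeas_clamp C12 measurable_obsY). Qed.

Lemma bmeas_empUV n : bmeas (@emp R d n UV).
Proof. by apply: bmeas_emp; exact: bmeasM. Qed.

Lemma bmeas_quadUV n j : (J0 <= j)%N -> bmeas (@emp_quad R d W j n U V).
Proof. by move=> Jj; exact: bmeas_emp_quad. Qed.

Lemma bmeas_crossUV n j1 j2 : (J0 <= j1)%N -> (J0 <= j2)%N ->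
  bmeas (@emp_cross R d W j1 j2 n U V).
Proof. by move=> J1 J2; exact: bmeas_emp_cross. Qed.

Lemma risk_INT_bounded n j1 j2 P c : (J0 <= j1)%N -> (J0 <= j2)%N ->
  in_model W C1 C2 a b M P ->
  (\int[iid P n]_D ((psi_INT W j1 j2 D - c) ^+ 2)%:E =
  (\int[iid P n]_D ((emp UV D - emp_quad W (minn j1 j2) U V D - c) ^+ 2))%:E)%E.
Proof.
move=> J1 J2 mP; have Jm : (J0 <= minn j1 j2)%N by rewrite leq_min J1.
apply: (risk_trunc _ mP (measurable_psi_INT J1 J2)).
- by apply: bmeasB; [exact: bmeas_empUV|exact: bmeas_quadUV].
- by move=> D; rewrite psi_INT_E// emp_trunc emp_quad_trunc.
Qed.

Lemma risk_MC_bounded n j1 j2 P c : (J0 <= j1)%N -> (J0 <= j2)%N ->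
  in_model W C1 C2 a b M P ->
  (\int[iid P n]_D ((psi_MC W j1 j2 D - c) ^+ 2)%:E =
  (\int[iid P n]_D ((emp UV D - emp_cross W j1 j2 U V D - c) ^+ 2))%:E)%E.
Proof.
move=> J1 J2 mP.
apply: (risk_trunc _ mP (measurable_psi_MC J1 J2)).
- by apply: bmeasB; [exact: bmeas_empUV|exact: bmeas_crossUV].
- by move=> D; rewrite psi_MC_E// emp_trunc emp_cross_trunc.
Qed.

Lemma risk_IF_bounded n j1 j2 P c : (J0 <= j1)%N -> (J0 <= j2)%N ->
  in_model W C1 C2 a b M P ->
  (\int[iid P n]_D ((psi_IF W j1 j2 D - c) ^+ 2)%:E =
  (\int[iid P n]_D ((emp UV D - emp_quad W j2 U V D - emp_quad W j1 U V D +
     emp_cross W j1 j2 U V D - c) ^+ 2))%:E)%E.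
Proof.
move=> J1 J2 mP.
apply: (risk_trunc _ mP (measurable_psi_IF J1 J2)).
- apply: bmeasD; last exact: bmeas_crossUV.
  by apply: bmeasB; [apply: bmeasB|]; by [exact: bmeas_empUV|exact: bmeas_quadUV].
- by move=> D; rewrite psi_IF_E// emp_trunc !emp_quad_trunc emp_cross_trunc.
Qed.

End bounded_versions.

Lemma risk_INT_le : exists K1, 0 <= K1 /\ forall n j1 j2 P, (0 < n)%N ->
  (J0 <= j1)%N -> (J0 <= j2)%N -> in_model W C1 C2 a b M P ->
  (\int[iid P n]_D ((psi_INT W j1 j2 D - psi P) ^+ 2)%:E <=
  (K1 * (n%:R^-1 + (K (minn j1 j2) / n%:R) ^+ 2 + rate (minn j1 j2) ^+ 2))%:E)%E.
Proof.
have [K0 [K00 H]] := stochastic_and_bias_bounds.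
exists (6 * K0); split; first exact: mulr_ge0.
move=> n j1 j2 P n0 J1 J2 mP; have [p [q [reg He Hq _ Hb]]] := H P mP.
have [C12 _] := model_regressions HW d0 mP.
have Jm : (J0 <= minn j1 j2)%N by rewrite leq_min J1.
rewrite (risk_INT_bounded C12)// lee_fin (psiE HW d0 mP reg).
set m := minn j1 j2 in Jm *.
set e0 := \int[P]_z _.
have bf : bmeas (fun D => @emp R d n UV D - e0).
  by apply: bmeasB; [exact: bmeas_empUV|exact: bmeas_cst].
have bg : bmeas (fun D => ipV W m p q - @emp_quad R d W m n U V D).
  by apply: bmeasB; [exact: bmeas_cst|exact: bmeas_quadUV].
have := Rint_sqr3_le (iid P n) (inner p q - ipV W m p q) bf bg.
have -> : \int[iid P n]_D ((emp UV D - e0 + (ipV W m p q - emp_quad W m U V D) +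
    (inner p q - ipV W m p q)) ^+ 2) =
  \int[iid P n]_D ((emp UV D - emp_quad W m U V D - (e0 - inner p q)) ^+ 2).
  by apply: eq_Rintegral => D _; congr (_ ^+ 2); ring.
move=> h; apply: le_trans h _.
have h1 := He n n0; have h2 := Hq n m n0 Jm; have h3 := Hb m Jm.
under [X in _ * (_ + X + _)]eq_Rintegral do rewrite -sqrrN opprB.
move: h1 h2 h3; rewrite -/e0.
set x := \int[_]_D _; set y := \int[_]_D _; set z := (_ - _) ^+ 2.
have v0 : 0 <= n%:R^-1 :> R by rewrite invr_ge0.
have k0 : 0 <= (K m / n%:R) ^+ 2 :> R by exact: sqr_ge0.
have r0 : 0 <= rate m ^+ 2 :> R by exact: sqr_ge0.
have := mulr_ge0 K00 v0; have := mulr_ge0 K00 k0; have := mulr_ge0 K00 r0.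
move: (n%:R^-1) (_ ^+ 2) (_ ^+ 2) x y z => v k r x y z; rewrite !mulrDr; lra.
Qed.

Lemma risk_MC_le : exists K1, 0 <= K1 /\ forall n j1 j2 P, (0 < n)%N ->
  (J0 <= j1)%N -> (J0 <= j2)%N -> in_model W C1 C2 a b M P ->
  (\int[iid P n]_D ((psi_MC W j1 j2 D - psi P) ^+ 2)%:E <=
  (K1 * (n%:R^-1 + ((K j1 / n%:R) ^+ 2 + (K j2 / n%:R) ^+ 2) +
    ((K j1 / n%:R) ^+ 4 + (K j2 / n%:R) ^+ 4) + rate (minn j1 j2) ^+ 2))%:E)%E.
Proof.
have [K0 [K00 H]] := stochastic_and_bias_bounds.
exists (6 * K0); split; first exact: mulr_ge0.
move=> n j1 j2 P n0 J1 J2 mP; have [p [q [reg He _ Hc Hb]]] := H P mP.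
have [C12 _] := model_regressions HW d0 mP.
have Jm : (J0 <= minn j1 j2)%N by rewrite leq_min J1.
rewrite (risk_MC_bounded C12)// lee_fin (psiE HW d0 mP reg).
set m := minn j1 j2 in Jm *.
set e0 := \int[P]_z _.
have bf : bmeas (fun D => @emp R d n UV D - e0).
  by apply: bmeasB; [exact: bmeas_empUV|exact: bmeas_cst].
have bg : bmeas (fun D => ipV W m p q - @emp_cross R d W j1 j2 n U V D).
  by apply: bmeasB; [exact: bmeas_cst|exact: bmeas_crossUV].
have := Rint_sqr3_le (iid P n) (inner p q - ipV W m p q) bf bg.
have -> : \int[iid P n]_D ((emp UV D - e0 + (ipV W m p q - emp_cross W j1 j2 U V D) +
    (inner p q - ipV W m p q)) ^+ 2) =
  \int[iid P n]_D ((emp UV D - emp_cross W j1 j2 U V D - (e0 - inner p q)) ^+ 2).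
  by apply: eq_Rintegral => D _; congr (_ ^+ 2); ring.
move=> h; apply: le_trans h _.
have h1 := He n n0; have h2 := Hc n j1 j2 n0 J1 J2; have h3 := Hb m Jm.
under [X in _ * (_ + X + _)]eq_Rintegral do rewrite -sqrrN opprB.
move: h1 h2 h3; rewrite -/e0 -/m.
set x := \int[_]_D _; set y := \int[_]_D _; set z := (_ - _) ^+ 2.
have v0 : 0 <= n%:R^-1 :> R by rewrite invr_ge0.
have r0 : 0 <= rate m ^+ 2 :> R by exact: sqr_ge0.
set k := (_ ^+ 2 + _ ^+ 2); set l := (_ ^+ 4 + _ ^+ 4).
have k0 : 0 <= k by rewrite addr_ge0 ?sqr_ge0.
have l0 : 0 <= l by rewrite addr_ge0 ?exprn_even_ge0.
have := mulr_ge0 K00 v0; have := mulr_ge0 K00 k0; have := mulr_ge0 K00 r0.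
have := mulr_ge0 K00 l0.
move: (n%:R^-1) k l (_ ^+ 2) x y z {k0 l0} => v k l r x y z; rewrite !mulrDr; lra.
Qed.

(** The two quadratic statistics and the cross statistic estimate inner products
    of projections at [j1], [j2] and the coarser of them; the coarser one cancels. *)
Lemma risk_IF_le : exists K1, 0 <= K1 /\ forall n j1 j2 P, (0 < n)%N ->
  (J0 <= j1)%N -> (J0 <= j2)%N -> in_model W C1 C2 a b M P ->
  (\int[iid P n]_D ((psi_IF W j1 j2 D - psi P) ^+ 2)%:E <=
  (K1 * (n%:R^-1 + ((K j1 / n%:R) ^+ 2 + (K j2 / n%:R) ^+ 2) +
    ((K j1 / n%:R) ^+ 4 + (K j2 / n%:R) ^+ 4) + rate (maxn j1 j2) ^+ 2))%:E)%E.
Proof.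
have [K0 [K00 H]] := stochastic_and_bias_bounds.
exists (36 * K0); split; first exact: mulr_ge0.
move=> n j1 j2 P n0 J1 J2 mP; have [p [q [reg He Hq Hc Hb]]] := H P mP.
have [C12 _] := model_regressions HW d0 mP.
have JM : (J0 <= maxn j1 j2)%N by rewrite leq_max J1.
rewrite (risk_IF_bounded C12)// lee_fin (psiE HW d0 mP reg).
set e0 := \int[P]_z _.
pose m := minn j1 j2.
have bf : bmeas (fun D => @emp R d n UV D - e0).
  by apply: bmeasB; [exact: bmeas_empUV|exact: bmeas_cst].
have bg j : (J0 <= j)%N -> bmeas (fun D => ipV W j p q - @emp_quad R d W j n U V D).
  by move=> Jj; apply: bmeasB; [exact: bmeas_cst|exact: bmeas_quadUV].
have bh : bmeas (fun D => @emp_cross R d W j1 j2 n U V D - ipV W m p q).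
  by apply: bmeasB; [exact: bmeas_crossUV|exact: bmeas_cst].
have e12 : ipV W j1 p q + ipV W j2 p q = ipV W m p q + ipV W (maxn j1 j2) p q.
  rewrite /m; case/orP: (leq_total j1 j2) => h.
    by rewrite (minn_idPl h) (maxn_idPr h).
  by rewrite (minn_idPr h) (maxn_idPl h) addrC.
have := Rint_sqr5_le (iid P n) (inner p q - ipV W (maxn j1 j2) p q) bf
  (bg j1 J1) (bg j2 J2) bh.
have -> : \int[iid P n]_D ((emp UV D - e0 + (ipV W j1 p q - emp_quad W j1 U V D) +
    (ipV W j2 p q - emp_quad W j2 U V D) +
    (emp_cross W j1 j2 U V D - ipV W m p q) +
    (inner p q - ipV W (maxn j1 j2) p q)) ^+ 2) =
  \int[iid P n]_D ((emp UV D - emp_quad W j2 U V D - emp_quad W j1 U V D +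
     emp_cross W j1 j2 U V D - (e0 - inner p q)) ^+ 2).
  apply: eq_Rintegral => D _; congr (_ ^+ 2).
  by move: e12 => /(canRL (addrK _)) ->; ring.
move=> h; apply: le_trans h _.
have h1 := He n n0; have h2 := Hc n j1 j2 n0 J1 J2; have h3 := Hb _ JM.
have h4 := Hq n j1 n0 J1; have h5 := Hq n j2 n0 J2.
under [X in _ * (_ + X + _ + _ + _)]eq_Rintegral do rewrite -sqrrN opprB.
under [X in _ * (_ + X + _ + _)]eq_Rintegral do rewrite -sqrrN opprB.
move: h1 h2 h3 h4 h5; rewrite -/e0 -/m.
set x := \int[_]_D _; set y := \int[_]_D _; set z := (_ - _) ^+ 2.
set t := \int[_]_D _; set w := \int[_]_D _.
have v0 : 0 <= n%:R^-1 :> R by rewrite invr_ge0.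
have r0 : 0 <= rate (maxn j1 j2) ^+ 2 :> R by exact: sqr_ge0.
set k := (_ / _) ^+ 2; set l := (_ / _) ^+ 2; set l4 := (_ ^+ 4 + _ ^+ 4).
have k0 : 0 <= k by exact: sqr_ge0.
have l0 : 0 <= l by exact: sqr_ge0.
have l40 : 0 <= l4 by rewrite addr_ge0 ?exprn_even_ge0.
have := mulr_ge0 K00 v0; have := mulr_ge0 K00 k0; have := mulr_ge0 K00 r0.
have := mulr_ge0 K00 l0; have := mulr_ge0 K00 l40.
move: (n%:R^-1) k l l4 (_ ^+ 2) x y z t w {k0 l0 l40} => v k l l4 r x y z t w.
rewrite !mulrDr; lra.
Qed.

End upper_bounds.

(** * Laws with prescribed regressions *)

(** A law with prescribed regressions: given [X = x], a uniform variable [t]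
    decides by membership in two intervals of lengths [prA x] and [prY x],
    overlapping in length [prAY x], whether each response is large or small. *)
Section two_point_responses.
Context {R : realType} {d : nat}.
Local Notation obs := (d.-tuple R * R * R)%type.
Local Notation X := (d.-tuple R).
Variables (C1 C2 : R) (prA prY prAY : X -> R).
Hypothesis C12 : C1 < C2.
Hypotheses (bA : bmeas prA) (bY : bmeas prY) (bAY : bmeas prAY).
Hypothesis AY0 : forall x, 0 <= prAY x.
Hypothesis AYA : forall x, prAY x <= prA x.
Hypothesis AYY : forall x, prAY x <= prY x.
Hypothesis AY1 : forall x, prA x + prY x - prAY x <= 1.
Local Notation D := (C2 - C1).

Definition largeA (xt : X * R) : R := \1_`[0, prA xt.1[%classic xt.2.
Definition largeY (xt : X * R) : R :=
  \1_`[prA xt.1 - prAY xt.1, prA xt.1 - prAY xt.1 + prY xt.1[%classic xt.2.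

Definition sample (xt : X * R) : obs :=
  (xt.1, C1 + D * largeA xt, C1 + D * largeY xt).

Lemma bmeas_largeA : bmeas largeA.
Proof.
apply: bmeas_itv_indic => //.
exact: (measurableT_comp bA.1 measurable_fst).
Qed.

Lemma bmeas_largeY : bmeas largeY.
Proof.
have h1 := measurableT_comp bA.1 (@measurable_fst _ _ X R).
have h2 := measurableT_comp bAY.1 (@measurable_fst _ _ X R).
have h3 := measurableT_comp bY.1 (@measurable_fst _ _ X R).
have h4 := measurable_funB h1 h2.
by apply: bmeas_itv_indic => //; exact: (measurable_funD h4 h3).
Qed.

Lemma measurable_sample : measurable_fun setT sample.
Proof.
have mlin (f : X * R -> R) : bmeas f -> measurable_fun setT (fun xt => C1 + D * f xt).
  by move=> bf; apply: (bmeasD (bmeas_cst C1) (bmeasM (bmeas_cst D) bf)).1.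
apply: measurable_fun_pair; first apply: measurable_fun_pair => //.
- exact: mlin bmeas_largeA.
- exact: mlin bmeas_largeY.
Qed.

Definition sample_mfun : {mfun (X * R)%type >-> obs} :=
  mfun_Sub (mem_set measurable_sample).

Definition two_point_law : probability obs R :=
  distribution (unif \x unif01)%E sample_mfun.

Lemma Rint_two_point (G : obs -> R) : bmeas G ->
  \int[two_point_law]_z G z = \int[unif]_x \int[unif01]_t G (sample (x, t)).
Proof.
move=> bG; rewrite Rint_distribution// Rint_prod//.
exact: (bmeas_comp measurable_sample bG).
Qed.

Lemma two_point_marginal B : measurable B ->
  two_point_law (@obsX R d @^-1` B) = unif B.
Proof.
move=> mB; rewrite -[LHS]/((unif \x unif01)%E (sample @^-1` (@obsX R d @^-1` B))).
rewrite (_ : sample @^-1` _ = B `*` setT); last first.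
  by apply/seteqP; split => [[x t] /=|[x t] []].
rewrite product_measure1E//; rewrite -[RHS]mule1; congr (_ * _)%E.
exact: probability_setT.
Qed.

Lemma largeA_itv xt : 0 <= largeA xt <= 1.
Proof. by rewrite /largeA indicE; case: (_ \in _); rewrite ?lexx ?ler01. Qed.

Lemma largeY_itv xt : 0 <= largeY xt <= 1.
Proof. by rewrite /largeY indicE; case: (_ \in _); rewrite ?lexx ?ler01. Qed.

Lemma response_itv (y : R) : 0 <= y <= 1 -> C1 <= C1 + D * y <= C2.
Proof.
have D0 : 0 < D by rewrite subr_gt0.
move=> /andP[y0 y1]; rewrite lerDl mulr_ge0 ?(ltW D0)//=.
by rewrite addrC -lerBrDr ler_piMr// ltW.
Qed.

Lemma two_point_ae (V : obs -> R) : measurable_fun setT V ->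
  (forall xt, C1 <= V (sample xt) <= C2) ->
  {ae two_point_law, forall z, C1 <= V z <= C2}.
Proof.
move=> mV h; exists (~` [set z | C1 <= V z <= C2]); split => //.
  apply: measurableC; rewrite (_ : [set z | _] = V @^-1` `[C1, C2]%classic).
    by rewrite -[X in measurable X]setTI; apply: mV => //; exact: measurable_itv.
  by apply/seteqP; split => z /=; rewrite in_itv.
rewrite -[LHS]/((unif \x unif01)%E (sample @^-1` (~` [set z | C1 <= V z <= C2]))).
rewrite (_ : sample @^-1` _ = set0) ?measure0//.
by apply/seteqP; split => // xt /=; apply; exact: h.
Qed.

Local Notation U := (fun z : obs => clamp C1 C2 (obsA z)).
Local Notation V := (fun z : obs => clamp C1 C2 (obsY z)).
Local Notation bc := bmeas_cst.

Let bU : bmeas U. Proof. exact: (bmeas_clamp (ltW C12) measurable_obsA). Qed.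
Let bV : bmeas V. Proof. exact: (bmeas_clamp (ltW C12) measurable_obsY). Qed.

Let prA1 x : prA x <= 1. Proof. by have := AYY x; have := AY1 x; lra. Qed.
Let prA0 x : 0 <= prA x. Proof. by have := AYA x; have := AY0 x; lra. Qed.

Lemma Rint_largeA x : \int[unif01]_t largeA (x, t) = prA x.
Proof.
rewrite -[LHS]/(\int[unif01]_t \1_`[0, prA x[%classic t : R).
by rewrite unif01_itv// subr0.
Qed.

Lemma Rint_largeY x : \int[unif01]_t largeY (x, t) = prY x.
Proof.
have := AYA x; have := AYY x; have := AY1 x; have := AY0 x => h1 h2 h3 h4.
rewrite -[LHS]/(\int[unif01]_t \1_`[prA x - prAY x,
  prA x - prAY x + prY x[%classic t : R).
by rewrite unif01_itv; lra.
Qed.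

Lemma Rint_largeAY x : \int[unif01]_t (largeA (x, t) * largeY (x, t)) = prAY x.
Proof.
have := AYA x; have := AYY x; have := AY1 x; have := AY0 x => h1 h2 h3 h4.
transitivity (\int[unif01]_t \1_`[prA x - prAY x, prA x[%classic t : R); last first.
  by rewrite unif01_itv; lra.
apply: eq_Rintegral => t _; rewrite /largeA /largeY !indicE !mem_setE/= !in_itv/=.
case: (ltP t (prA x)) => ta; last by rewrite !andbF mul0r.
rewrite !andbT; case: (leP (prA x - prAY x) t) => tb; last by rewrite mulr0.
have t0 : (0 <= t) = true by lra.
have t1 : (t < prA x - prAY x + prY x) = true by lra.
by rewrite t0 t1 mulr1.
Qed.

Lemma bmeas_largeA_at x : bmeas (fun t => largeA (x, t)).
Proof. exact: bmeas_section bmeas_largeA. Qed.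

Lemma bmeas_largeY_at x : bmeas (fun t => largeY (x, t)).
Proof. exact: bmeas_section bmeas_largeY. Qed.

Lemma two_point_momentA (h : X -> R) : bmeas h ->
  \int[two_point_law]_z (U z * h (obsX z)) =
  inner (fun x => C1 + D * prA x) h.
Proof.
move=> bh; rewrite Rint_two_point; last by apply: bmeasM => //; exact: bmeas_obsX.
apply: eq_Rintegral => x _.
transitivity (\int[unif01]_t ((C1 + D * largeA (x, t)) * h x)).
  by apply: eq_Rintegral => t _; rewrite clamp_id//; exact: response_itv (largeA_itv _).
have b1 := bmeas_largeA_at x; have b2 := bmeasM (bc D) b1.
rewrite RintZr; last exact: (bmeasD (bc C1) b2).
by rewrite (RintD _ (bc C1) b2) Rint_cst RintZl// Rint_largeA.
Qed.

Lemma two_point_momentY (h : X -> R) : bmeas h ->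
  \int[two_point_law]_z (V z * h (obsX z)) =
  inner (fun x => C1 + D * prY x) h.
Proof.
move=> bh; rewrite Rint_two_point; last by apply: bmeasM => //; exact: bmeas_obsX.
apply: eq_Rintegral => x _.
transitivity (\int[unif01]_t ((C1 + D * largeY (x, t)) * h x)).
  by apply: eq_Rintegral => t _; rewrite clamp_id//; exact: response_itv (largeY_itv _).
have b1 := bmeas_largeY_at x; have b2 := bmeasM (bc D) b1.
rewrite RintZr; last exact: (bmeasD (bc C1) b2).
by rewrite (RintD _ (bc C1) b2) Rint_cst RintZl// Rint_largeY.
Qed.

Lemma two_point_momentAY (h : X -> R) : bmeas h ->
  \int[two_point_law]_z (U z * V z * h (obsX z)) =
  inner (fun x => C1 ^+ 2 + C1 * D * (prA x + prY x) + D ^+ 2 * prAY x) h.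
Proof.
move=> bh; rewrite Rint_two_point; last first.
  by apply: bmeasM; [exact: bmeasM|exact: bmeas_obsX].
apply: eq_Rintegral => x _.
transitivity (\int[unif01]_t ((C1 ^+ 2 + (C1 * D) * largeA (x, t) +
   (C1 * D) * largeY (x, t) + D ^+ 2 * (largeA (x, t) * largeY (x, t))) * h x)).
  apply: eq_Rintegral => t _.
  rewrite -[obsX _]/x -[obsA _]/(C1 + D * largeA (x, t)) -[obsY _]/(C1 + D * largeY (x, t)).
  rewrite (clamp_id (response_itv (largeA_itv (x, t)))).
  by rewrite (clamp_id (response_itv (largeY_itv (x, t)))); ring.
have b1 := bmeas_largeA_at x; have b2 := bmeas_largeY_at x.
have b3 := bmeasM (bc (C1 * D)) b1; have b4 := bmeasM (bc (C1 * D)) b2.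
have b5 := bmeasM (bc (D ^+ 2)) (bmeasM b1 b2).
have b6 := bmeasD (bmeasD (bc (C1 ^+ 2)) b3) b4.
rewrite RintZr; last exact: (bmeasD b6 b5).
rewrite (RintD _ b6 b5) (RintD _ (bmeasD (bc (C1 ^+ 2)) b3) b4).
rewrite (RintD _ (bc (C1 ^+ 2)) b3) Rint_cst !RintZl//; last exact: bmeasM.
by rewrite Rint_largeA Rint_largeY Rint_largeAY; congr (_ * _); ring.
Qed.

Lemma two_point_condE (W : obs -> R) (g : X -> R) : measurable_fun setT W ->
  bmeas g -> {ae two_point_law, forall z, C1 <= W z <= C2} ->
  (forall h : X -> R, bmeas h ->
    \int[two_point_law]_z (clamp C1 C2 (W z) * h (obsX z)) = inner g h) ->
  is_condE two_point_law W g.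
Proof.
move=> mW bg Wae Wg; have bgX := bmeas_obsX bg.
split => //; first exact: bg.1.
- exact: (version_integrable (ltW C12) mW Wae).
- exact: bmeas_integrable bgX.
move=> B mB; have mB' := measurable_obsX_preimage mB.
have bW := bmeas_clamp (ltW C12) mW.
rewrite -(Rint_ae_eq mB' _ _ (clamp_ae Wae)); [|exact: measurable_funTS bW.1|exact: measurable_funTS].
have restr (f : obs -> R) : \int[two_point_law]_(z in @obsX R d @^-1` B) f z =
    \int[two_point_law]_z (f z * \1_B (obsX z)).
  rewrite Rintegral_mkcond; apply: eq_Rintegral => z _; rewrite patchE indicE.
  have -> : (z \in @obsX R d @^-1` B) = (obsX z \in B) by apply/idP/idP; rewrite !inE.
  by case: (_ \in _); rewrite ?mulr1 ?mulr0.
have bB : bmeas (\1_B : X -> R) by exact: bmeas_indic.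
rewrite !restr Wg// (Rint_obsX two_point_marginal (h := fun x => g x * \1_B x))//.
exact: bmeasM.
Qed.

Lemma two_point_in_model (W : wavelets R d) (a b M : R) :
  holder_ball W a M (fun x => C1 + D * prA x) ->
  holder_ball W b M (fun x => C1 + D * prY x) ->
  in_model W C1 C2 a b M two_point_law /\
  regressions W C1 C2 a b M two_point_law (fun x => C1 + D * prA x)
    (fun x => C1 + D * prY x).
Proof.
move=> hA hY.
have bp : bmeas (fun x => C1 + D * prA x) := bmeasD (bc C1) (bmeasM (bc D) bA).
have bq : bmeas (fun x => C1 + D * prY x) := bmeasD (bc C1) (bmeasM (bc D) bY).
have aeA : {ae two_point_law, forall z, C1 <= obsA z <= C2}.
  apply: two_point_ae; first exact: measurable_obsA.
  by move=> xt; exact: response_itv (largeA_itv _).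
have aeY : {ae two_point_law, forall z, C1 <= obsY z <= C2}.
  apply: two_point_ae; first exact: measurable_obsY.
  by move=> xt; exact: response_itv (largeY_itv _).
split; first split => //.
- exact: two_point_marginal.
- exists (fun x => C1 + D * prA x) => //.
  by apply: two_point_condE => //; [exact: measurable_obsA|exact: two_point_momentA].
- exists (fun x => C1 + D * prY x) => //.
  by apply: two_point_condE => //; [exact: measurable_obsY|exact: two_point_momentY].
split; split => //.
- by move=> x; apply: response_itv; rewrite prA0 prA1.
- move=> x; apply: response_itv.
  by have := AYA x; have := AYY x; have := AY1 x; have := AY0 x; lra.
- exact: two_point_momentA.
- exact: two_point_momentY.
Qed.

End two_point_responses.

(** * Uniform continuity of the wavelets *)

Section uniform_continuity.
Context {R : realType} {d : nat}.
Local Notation X := (d.-tuple R).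
Implicit Types f g : X -> R.

Lemma unif_continuousD f g : unif_continuous_on_cube f ->
  unif_continuous_on_cube g -> unif_continuous_on_cube (fun x => f x + g x).
Proof.
move=> uf ug e e0; have e2 : 0 < e / 2 by rewrite divr_gt0.
have [r r0 fr] := uf _ e2; have [s s0 gs] := ug _ e2.
exists (Num.min r s); first by rewrite lt_min r0.
move=> x y cx cy xy; rewrite opprD addrACA (le_lt_trans (ler_normD _ _))//.
rewrite [ltRHS](splitr e) ltrD//; [apply: fr|apply: gs] => // i;
  by have := xy i; rewrite lt_min => /andP[].
Qed.

Lemma unif_continuousZ (c : R) f : unif_continuous_on_cube f ->
  unif_continuous_on_cube (fun x => c * f x).
Proof.
move=> uf e e0; have c1 : 0 < `|c| + 1 by rewrite ltr_wpDl.
have [r r0 fr] := uf _ (divr_gt0 e0 c1); exists r => // x y cx cy xy.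
rewrite -mulrBr normrM (le_lt_trans (_ : _ <= (`|c| + 1) * `|f x - f y|))//.
  by rewrite ler_wpM2r// lerDl.
by rewrite mulrC -ltr_pdivlMr// fr.
Qed.

Lemma unif_continuous_cst (c : R) : unif_continuous_on_cube (fun _ : X => c).
Proof. by move=> e e0; exists 1 => // x y _ _ _; rewrite subrr normr0. Qed.

Lemma unif_continuous_sum (I : Type) (r : seq I) (P : pred I) (u : I -> X -> R) :
  (forall i, unif_continuous_on_cube (u i)) ->
  unif_continuous_on_cube (fun x => \sum_(i <- r | P i) u i x).
Proof.
move=> uu; elim: r => [|i r IH].
  by under eq_fun do rewrite big_nil; exact: unif_continuous_cst.
under eq_fun do rewrite big_cons.
by case: (P i) => //; exact: unif_continuousD.
Qed.

(** Mean value theorem, one coordinate at a time along a path inside the cube. *)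
Lemma lipschitz_on_cube (S : nat) g (L : R) : (0 < S)%N -> class_C S g ->
  (forall i x, cube x -> `|partial i g x| <= L) ->
  forall x y : X, cube x -> cube y ->
  `|g x - g y| <= L * \sum_(i < d) `|tnth x i - tnth y i|.
Proof.
move=> S0 [dg _] gL x y cx cy.
(* the path from [x] to [y] replaces the coordinates listed in [s] *)
pose mix (s : seq 'I_d) : X := [tuple if i \in s then tnth y i else tnth x i | i < d].
have cmix s : cube (mix s) by move=> i; rewrite tnth_mktuple; case: ifP.
suff H (s : seq 'I_d) : uniq s ->
    `|g x - g (mix s)| <= L * \sum_(i <- s) `|tnth x i - tnth y i|.
  have -> : y = mix (enum 'I_d).
    by apply: eq_from_tnth => i; rewrite tnth_mktuple mem_enum.
  rewrite (le_trans (H _ (enum_uniq _)))// big_enum/=.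
  under [X in _ <= _ * X]eq_bigr do rewrite tnth_mktuple mem_enum/=.
  by [].
elim: s => [_|i s IH /= /andP[ins us]].
  rewrite big_nil mulr0; have -> : mix [::] = x.
    by apply: eq_from_tnth => i; rewrite tnth_mktuple.
  by rewrite subrr normr0.
rewrite big_cons mulrDr; set z := mix s.
have zi : tnth z i = tnth x i by rewrite tnth_mktuple (negbTE ins).
have mE : mix (i :: s) = upd z i (tnth y i).
  apply: eq_from_tnth => k; rewrite !tnth_mktuple in_cons.
  by have [->|] := eqVneq k i.
have zE : z = upd z i (tnth x i).
  by apply: eq_from_tnth => k; rewrite [RHS]tnth_mktuple; have [->|] := eqVneq k i.
have uu t t' : upd (upd z i t) i t' = upd z i t'.
  by apply: eq_from_tnth => k; rewrite !tnth_mktuple; case: eqP.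
have ui t : tnth (upd z i t) i = t by rewrite tnth_mktuple eqxx.
pose phi (t : R) := g (upd z i t).
have dphi t : derivable phi t 1.
  have := dg [::] i (upd z i t) S0; rewrite /= ui.
  by under [X in derivable X]eq_fun do rewrite uu.
have phiE t : derive1 phi t = partial i g (upd z i t).
  rewrite /partial ui (_ : (fun t' => g (upd (upd z i t) i t')) = phi)//.
  by apply/funext => t'; rewrite uu.
have phiL t : 0 <= t <= 1 -> `|derive1 phi t| <= L.
  move=> t01; rewrite phiE; apply: gL => k; rewrite tnth_mktuple.
  by case: ifP => // _; exact: cmix.
have step : `|phi (tnth x i) - phi (tnth y i)| <= L * `|tnth x i - tnth y i|.
  have xi01 := cx i; have yi01 := cy i.
  have main (p q : R) : 0 <= p <= 1 -> 0 <= q <= 1 -> p <= q ->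
      `|phi q - phi p| <= L * `|q - p|.
    move=> /andP[p0 p1] /andP[q0 q1] pq.
    have [||c cpq ->] := @MVT_segment R phi (derive1 phi) p q pq.
    - by move=> t _; apply: DeriveDef => //; rewrite derive1E.
    - by apply: derivable_within_continuous => t _.
    rewrite normrM ler_wpM2r// phiL//.
    by move: cpq; rewrite in_itv/= => /andP[h1 h2]; lra.
  have [xy|/ltW yx] := leP (tnth x i) (tnth y i).
    by rewrite distrC (distrC (tnth x i)); exact: main.
  exact: main.
rewrite mE -/(phi _) -(subrKA (g z)) (le_trans (ler_normD _ _))// addrC lerD//.
  by rewrite {1}zE.
exact: IH.
Qed.

Lemma lipschitz_unif_continuous f (L : R) :
  (forall x y : X, cube x -> cube y ->
    `|f x - f y| <= L * \sum_(i < d) `|tnth x i - tnth y i|) ->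
  unif_continuous_on_cube f.
Proof.
move=> fL e e0; pose B : R := (`|L| + 1) * (d%:R + 1).
have B0 : 0 < B by rewrite mulr_gt0// ltr_wpDl.
exists (e / B); first exact: divr_gt0.
move=> x y cx cy xy; apply: le_lt_trans (fL x y cx cy) _.
apply: (@le_lt_trans _ _ (`|L| * (d%:R * (e / B)))).
  apply: (@le_trans _ _ (`|L| * \sum_(i < d) `|tnth x i - tnth y i|)).
    by rewrite ler_wpM2r ?ler_norm// sumr_ge0.
  rewrite ler_wpM2l//; apply: (@le_trans _ _ (\sum_(i < d) (e / B))).
    by apply: ler_sum => i _; exact: ltW.
  by rewrite sumr_const card_ord mulr_natl.
rewrite !mulrA ltr_pdivrMr// [ltLHS]mulrAC [ltLHS]mulrC [ltRHS]mulrC -subr_gt0.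
rewrite (_ : _ - _ = (`|L| + d%:R + 1) * e); last by rewrite /B; ring.
by rewrite mulr_gt0// ltr_wpDl// addr_ge0.
Qed.

Lemma local_regular_unif_continuous J0 S (I : nat -> finType)
    (u : forall j, I j -> X -> R) j (i : I j) :
  (0 < S)%N -> local_regular J0 S u -> (J0 <= j)%N ->
  unif_continuous_on_cube (u j i).
Proof.
move=> S0 [C H] Jj; have [_ _ _ Hg] := H j Jj.
have [g [gS ug gb]] := Hg i.
apply: (@lipschitz_unif_continuous _ (C * 2 `^ (j%:R * (d%:R / 2 + 1)))).
move=> x y cx cy; rewrite !ug//; apply: (lipschitz_on_cube S0 gS) => // k z cz.
by have := gb [:: k] z S0 cz.
Qed.

End uniform_continuity.

(** * Perturbing a law inside the class *)

Section perturbation.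
Context {R : realType} {d : nat}.
Local Notation obs := (d.-tuple R * R * R)%type.
Local Notation X := (d.-tuple R).
Variable W : wavelets R d.
Hypothesis HW : cdv_basis W.
Hypothesis d0 : (0 < d)%N.
Local Notation J0 := (base_level W).
Local Notation bc := bmeas_cst.

(** The scaling spaces contain the indicator of the cube, as polynomials of
    degree zero belong to them and scaling functions vanish off the cube. *)
Lemma unit_in_Vspace : exists2 e : X -> R, bmeas e /\ Vspace W J0 e &
  (forall x, cube x -> e x = 1) /\ (forall x, ~ cube x -> e x = 0).
Proof.
have deg0 : (\sum_(i < d) [ffun=> 0%N] i <= (regularity W).-1)%N.
  by rewrite big1// => i _; rewrite ffunE.
have [e Ve eE] := cdv_polynomials HW (leqnn J0) deg0.
exists e.
  split => //; have [c ->] := Ve; apply: bmeas_sum => m.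
  by apply: bmeasM (bc _) (bmeas_Phi HW m (leqnn J0)).
split => x cx.
  by rewrite -eE// big1// => i _; rewrite ffunE expr0.
have [c ->] := Ve; rewrite big1// => m _.
have [C H] := cdv_Phi_regular HW; have [off _ _ _] := H J0 (leqnn J0).
by rewrite off// mulr0.
Qed.

Lemma Phi_off_cube j (m : loc W j) x : (J0 <= j)%N -> ~ cube x -> Phi m x = 0.
Proof.
move=> Jj cx; have [C H] := cdv_Phi_regular HW; have [off _ _ _] := H j Jj.
exact: off.
Qed.

Lemma Psi_off_cube l (p : wtype d * loc W l) x : (J0 <= l)%N -> ~ cube x -> Psi_pair p x = 0.
Proof.
move=> Jl cx; have [C H] := cdv_Psi_regular HW; have [off _ _ _] := H l Jl.
exact: off.
Qed.

Lemma inner_cst_Psi (c : R) l (p : wtype d * loc W l) : (J0 <= l)%N ->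
  inner (fun=> c) (Psi_pair p) = 0.
Proof.
move=> Jl; have bp := bmeas_Psi HW p Jl.
have [e [be [cf eE]] [e1 e0]] := unit_in_Vspace.
rewrite -[RHS](mulr0 c).
have <- : inner e (Psi_pair p) = 0.
  rewrite eE inner_suml//; last by move=> m; exact: (bmeas_Phi HW).
  by rewrite big1// => m _; rewrite (Phi_Psi_ortho HW)// mulr0.
rewrite -innerZl//; apply: eq_Rintegral => x _.
have [cx|cx] := pselect (cube x); first by rewrite e1// mulr1.
by rewrite Psi_off_cube// !mulr0.
Qed.

(** Constants have vanishing wavelet coefficients, hence finite norm. *)
Lemma holder_norm_cst (a : R) : exists2 N, 0 <= N &
  forall c : R, (holder_norm W a (fun=> c) <= (`|c| * N)%:E)%E.
Proof.
pose w : R := 2 `^ (J0%:R * (a + d%:R / 2)).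
have w0 : 0 <= w by exact: powR_ge0.
pose N := w * \sum_(m : loc W J0) `|inner (fun=> 1) (Phi m)|.
have N0 : 0 <= N by rewrite mulr_ge0// sumr_ge0.
exists N => // c; apply/(holder_normP HW d0); exists (`|c| * N), 0; split; last by rewrite addr0.
split => //; first exact: mulr_ge0.
- move=> m; rewrite -/w (_ : inner _ _ = c * inner (fun=> 1) (Phi m)); last first.
    rewrite -(innerZl c (bc 1) (bmeas_Phi HW m (leqnn J0))).
    by apply: eq_Rintegral => x _; rewrite mulr1.
  rewrite normrM mulrCA ler_wpM2l// ler_wpM2l// (bigD1 m)//= lerDl.
  exact: sumr_ge0.
- by move=> l p Jl; rewrite inner_cst_Psi// normr0 mulr0.
Qed.

Variables (C1 C2 a b M : R).
Local Notation UV := (fun z : obs => clamp C1 C2 (obsA z) * clamp C1 C2 (obsY z)).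

Definition small (eta r : R) (u : X -> R) :=
  [/\ bmeas u, unif_continuous_on_cube u, (forall x, `|u x| <= eta) &
      (holder_norm W r u <= eta%:E)%E].

(** If [pi] and [rho] are at distance [t/2] from [0] and [1], the product
    [pi rho] is at distance [t^2/4] from each of the bounds that constrain the
    probability of a joint event with marginal probabilities [pi] and [rho]. *)
Lemma interior_margin (t pi rho u v c : R) : 0 < t -> t <= 1 ->
  t / 2 <= pi <= 1 - t / 2 -> t / 2 <= rho <= 1 - t / 2 ->
  `|u| <= t ^+ 2 / 12 -> `|v| <= t ^+ 2 / 12 -> `|c| <= t ^+ 2 / 12 ->
  [/\ 0 <= pi * rho + c, pi * rho + c <= pi + u, pi * rho + c <= rho + v &
      (pi + u) + (rho + v) - (pi * rho + c) <= 1].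
Proof.
move=> t0 t1 /andP[h1 h2] /andP[h3 h4]; rewrite !ler_norml.
move=> /andP[u1 u2] /andP[v1 v2] /andP[c1 c2].
have H (x y : R) : t / 2 <= x -> t / 2 <= y -> t ^+ 2 / 4 <= x * y.
  move=> tx ty; rewrite (_ : t ^+ 2 / 4 = (t / 2) * (t / 2)); last by field.
  by rewrite ler_pM ?divr_ge0// ltW.
have k1 := H _ _ h1 h3.
have k2 : t ^+ 2 / 4 <= pi * (1 - rho) by apply: H => //; lra.
have k3 : t ^+ 2 / 4 <= rho * (1 - pi) by apply: H => //; lra.
have k4 : t ^+ 2 / 4 <= (1 - pi) * (1 - rho) by apply: H => //; lra.
move: k2 k3 k4; rewrite !mulrBr !mulrBl !mul1r !mulr1 (mulrC rho pi).
have := sqr_ge0 t.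
by move: (pi * rho) (t ^+ 2) k1 u1 u2 v1 v2 c1 c2 => y q *; split; lra.
Qed.

(** Shrinking the two regressions of a law in the interior of the class
    towards the midpoint of the response interval leaves room to move both
    regressions and the conditional mean of the product independently. *)
Lemma perturbed_laws : nondegenerate_class W C1 C2 a b M ->
  exists p0 q0 g eta, [/\ bmeas p0, bmeas q0, bmeas g, 0 < eta &
   forall u v c, small eta a u -> small eta b v -> `|c| <= eta ->
   exists P, [/\ in_model W C1 C2 a b M P,
     regressions W C1 C2 a b M P (fun x => p0 x + u x) (fun x => q0 x + v x) &
     forall h, bmeas h -> \int[P]_z (UV z * h (obsX z)) =
       inner (fun x => g x + C1 * (u x + v x) + c) h]].
Proof.
move=> [C12 [M' M'M [P0 mP0]]].
have [_ [_ [p [q [[bp bq pC qC] [[up hp] [uq hq] _ _]]]]]] := model_regressions HW d0 mP0.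
have [Na Na0 HNa] := holder_norm_cst a; have [Nb Nb0 HNb] := holder_norm_cst b.
(* The shrinking factor [t] keeps the norms of the shrunk regressions a fixed
   amount [s] below [M], and the margin [e] is what [interior_margin] allows. *)
pose mid := (C1 + C2) / 2; pose s := (M - M') / 2.
have s0 : 0 < s by rewrite divr_gt0// subr_gt0.
pose B := `|mid| * Na + `|mid| * Nb + 1.
have m1 : 0 <= `|mid| * Na by exact: mulr_ge0.
have m2 : 0 <= `|mid| * Nb by exact: mulr_ge0.
have B0 : 0 < B by rewrite /B; lra.
pose t := Num.min 1 (s / B).
have t0 : 0 < t by rewrite lt_min ltr01 divr_gt0.
have t1 : t <= 1 by rewrite ge_min lexx.
have tB : t * B <= s by rewrite -ler_pdivlMr// ge_min lexx orbT.
have M'0 := holder_norm_ge0 HW d0 hp.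
pose mix (f : X -> R) x := (1 - t) * f x + t * mid.
have bmix f : bmeas f -> bmeas (mix f).
  by move=> bf; apply: bmeasD; [exact: (bmeasM (bc _))|exact: bc].
have umix f : unif_continuous_on_cube f -> unif_continuous_on_cube (mix f).
  move=> uf; apply: unif_continuousD; last exact: unif_continuous_cst.
  exact: unif_continuousZ.
have hmix r N f : bmeas f -> (holder_norm W r f <= M'%:E)%E -> 0 <= N ->
    (forall c, (holder_norm W r (fun=> c) <= (`|c| * N)%:E)%E) ->
    `|mid| * N <= B -> (holder_norm W r (mix f) <= (M' + s)%:E)%E.
  move=> bf hf N0 HN mB.
  apply: le_trans (holder_norm_comb HW d0 (1 - t) t bf (bc mid) hf (HN mid)) _.
  rewrite lee_fin ger0_norm ?subr_ge0// (gtr0_norm t0).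
  have := ler_wpM2l (ltW t0) mB; have := mulr_ge0 (ltW t0) M'0; lra.
have D0 : 0 < C2 - C1 by rewrite subr_gt0.
set D := C2 - C1 in D0.
pose e := t ^+ 2 / 12; have e0 : 0 < e by rewrite divr_gt0// exprn_gt0.
pose eta := Num.min s (Num.min (D * e) (D ^+ 2 * e)).
have eta0 : 0 < eta by rewrite !lt_min s0 !mulr_gt0// exprn_gt0.
pose pr (f : X -> R) x := (f x - C1) / D.
have bpr f : bmeas f -> bmeas (pr f).
  by move=> bf; apply: bmeasM; [exact: (bmeasB bf (bc C1))|exact: bc].
have prmix f x : (forall x, C1 <= f x <= C2) -> t / 2 <= pr (mix f) x <= 1 - t / 2.
  move=> /(_ x)/andP[f1 f2]; rewrite /pr.
  have -> : (mix f x - C1) = (t / 2) * D + (1 - t) * (f x - C1).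
    by rewrite /mix /mid /D; field.
  have h1 : 0 <= (1 - t) * (f x - C1) by rewrite mulr_ge0 ?subr_ge0.
  have h2 : (1 - t) * (f x - C1) <= (1 - t) * D by rewrite ler_wpM2l ?subr_ge0// lerD2r.
  by rewrite ler_pdivlMr// ler_pdivrMr// lerDl h1/=; lra.
pose th x := pr (mix p) x * pr (mix q) x.
have bth : bmeas th by apply: bmeasM; apply: bpr; exact: bmix.
pose g x := C1 ^+ 2 + C1 * (mix p x + mix q x - 2 * C1) + D ^+ 2 * th x.
have bg : bmeas g.
  apply: bmeasD; last exact: (bmeasM (bc _) bth).
  apply: (bmeasD (bc _)); apply: (bmeasM (bc _)); apply: bmeasB (bc _).
  by apply: bmeasD; exact: bmix.
exists (mix p), (mix q), g, eta; split; [exact: bmix|exact: bmix|exact: bg|exact: eta0|].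
move=> u v c [bu uu us hu] [bv uv vs hv] cs.
have etas : eta <= s by rewrite ge_min lexx.
have etaD : eta <= D * e by rewrite !ge_min lexx orbT.
have etaD2 : eta <= D ^+ 2 * e by rewrite !ge_min lexx !orbT.
pose f1 x := mix p x + u x; pose f2 x := mix q x + v x.
have bf1 : bmeas f1 by apply: bmeasD => //; exact: bmix.
have bf2 : bmeas f2 by apply: bmeasD => //; exact: bmix.
have bAY : bmeas (fun x => th x + c / D ^+ 2) by apply: bmeasD => //; exact: bc.
have prE f w x : pr (fun x => mix f x + w x) x = pr (mix f) x + w x / D.
  by rewrite /pr -mulrDl; congr (_ / _); ring.
have marg x : [/\ 0 <= th x + c / D ^+ 2, th x + c / D ^+ 2 <= pr f1 x,
    th x + c / D ^+ 2 <= pr f2 x & pr f1 x + pr f2 x - (th x + c / D ^+ 2) <= 1].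
  rewrite !prE; apply: (@interior_margin t) => //; try exact: prmix.
  - by rewrite normrM normfV (gtr0_norm D0) ler_pdivrMr// mulrC (le_trans (us x)).
  - by rewrite normrM normfV (gtr0_norm D0) ler_pdivrMr// mulrC (le_trans (vs x)).
  - rewrite normrM normfV (gtr0_norm (exprn_gt0 2 D0)) ler_pdivrMr ?exprn_gt0// mulrC.
    exact: le_trans cs _.
have E f : (fun x => C1 + D * pr f x) = f.
  by apply/funext => x; rewrite /pr; field; rewrite gt_eqF.
have ball r f w N : bmeas f -> unif_continuous_on_cube f ->
    (holder_norm W r f <= M'%:E)%E -> 0 <= N ->
    (forall c, (holder_norm W r (fun=> c) <= (`|c| * N)%:E)%E) ->
    `|mid| * N <= B -> small eta r w ->
    holder_ball W r M (fun x => mix f x + w x).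
  move=> bf uf hf N0 HN mB [bw uw _ hw]; split.
    by apply: unif_continuousD => //; exact: umix.
  have := holder_norm_comb HW d0 1 1 (bmix f bf) bw (hmix r N f bf hf N0 HN mB) hw.
  rewrite normr1 !mul1r; under eq_fun do rewrite !mul1r; move=> h; apply: le_trans h _.
  by rewrite lee_fin /s in etas *; lra.
have ball1 : holder_ball W a M (fun x => C1 + D * pr f1 x).
  by rewrite E; apply: (ball a p u Na) => //; rewrite /B; lra.
have ball2 : holder_ball W b M (fun x => C1 + D * pr f2 x).
  by rewrite E; apply: (ball b q v Nb) => //; rewrite /B; lra.
have n0 x : 0 <= th x + c / D ^+ 2 by have [] := marg x.
have n1 x : th x + c / D ^+ 2 <= pr f1 x by have [] := marg x.
have n2 x : th x + c / D ^+ 2 <= pr f2 x by have [] := marg x.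
have n3 x : pr f1 x + pr f2 x - (th x + c / D ^+ 2) <= 1 by have [] := marg x.
have [mP reg] := two_point_in_model C12 (bpr _ bf1) (bpr _ bf2) bAY n0 n1 n2 n3 ball1 ball2.
rewrite !E in reg.
exists (two_point_law C1 C2 (bpr _ bf1) (bpr _ bf2) bAY); split => // h bh.
rewrite (two_point_momentAY C12 _ _ _ n0 n1 n2 n3 bh); apply: eq_Rintegral => x _; congr (_ * _).
by rewrite -/D /g /f1 /f2 /pr; field; rewrite gt_eqF.
Qed.

End perturbation.

(** * The bias as a bilinear form *)

Section bias_forms.
Context {R : realType} {d : nat}.
Local Notation obs := (d.-tuple R * R * R)%type.
Local Notation X := (d.-tuple R).
Variable W : wavelets R d.
Hypothesis HW : cdv_basis W.
Hypothesis d0 : (0 < d)%N.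
Local Notation J0 := (base_level W).
Local Notation bc := bmeas_cst.
Variables (C1 C2 a b M : R).
Local Notation U := (fun z : obs => clamp C1 C2 (obsA z)).
Local Notation V := (fun z : obs => clamp C1 C2 (obsY z)).
Local Notation UV := (fun z : obs => clamp C1 C2 (obsA z) * clamp C1 C2 (obsY z)).
Local Notation kap j := (fun x : X => proj_kernel W j x x).

Definition linear_form (L : (X -> R) -> R) := forall f h s, bmeas f -> bmeas h ->
  L (fun x => f x + s * h x) = L f + s * L h.

Definition bilinear_form (B : (X -> R) -> (X -> R) -> R) :=
  (forall g, bmeas g -> linear_form (B^~ g)) /\
  (forall f, bmeas f -> linear_form (B f)).

Lemma linear_formD L L' : linear_form L -> linear_form L' ->
  linear_form (fun f => L f + L' f).
Proof. by move=> lL lL' f h s bf bh; rewrite lL// lL'//; ring. Qed.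

Lemma linear_formZ c L : linear_form L -> linear_form (fun f => c * L f).
Proof. by move=> lL f h s bf bh; rewrite lL//; ring. Qed.

Lemma linear_form_inner g : bmeas g -> linear_form (fun f => inner f g).
Proof.
move=> bg f h s bf bh; have bsh : bmeas (fun x => s * h x) by exact: (bmeasM (bc s)).
by rewrite innerDl// innerZl.
Qed.

Lemma bilinear_formD B B' : bilinear_form B -> bilinear_form B' ->
  bilinear_form (fun f g => B f g + B' f g).
Proof. by move=> [l r] [l' r']; split=> g bg; apply: linear_formD; auto. Qed.

Lemma bilinear_formZ c B : bilinear_form B -> bilinear_form (fun f g => c * B f g).
Proof. by move=> [l r]; split=> g bg; apply: linear_formZ; auto. Qed.

Lemma bilinear_inner : bilinear_form inner.
Proof.
split=> g bg; first exact: linear_form_inner.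
by move=> f h s bf bh; rewrite !(innerC g); exact: linear_form_inner.
Qed.

Lemma bilinear_ipV j : (J0 <= j)%N -> bilinear_form (ipV W j).
Proof.
move=> Jj; have H g : linear_form ((ipV W j)^~ g).
  move=> f h s bf bh; rewrite /ipV mulr_sumr -big_split/=; apply: eq_bigr => m _.
  by rewrite (linear_form_inner (bmeas_Phi HW m Jj))//; ring.
by split=> g bg; [exact: H|move=> f h s bf bh; rewrite !(ipVC _ _ g); exact: H].
Qed.

Lemma projV_lin j f h s x : (J0 <= j)%N -> bmeas f -> bmeas h ->
  projV W j (fun x => f x + s * h x) x = projV W j f x + s * projV W j h x.
Proof.
move=> Jj bf bh; rewrite /projV mulr_sumr -big_split/=; apply: eq_bigr => m _.
by rewrite (linear_form_inner (bmeas_Phi HW m Jj))//; ring.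
Qed.

Lemma bilinear_kernel_proj i j : (J0 <= i)%N -> (J0 <= j)%N ->
  bilinear_form (fun f g => inner f (fun x => kap i x * projV W j g x)).
Proof.
move=> Ji Jj; have bk := bmeas_kernel_diag HW Ji.
have bkp g : bmeas (fun x => kap i x * projV W j g x).
  by apply: bmeasM => //; exact: (bmeas_projV HW).
split=> g bg; first exact: linear_form_inner.
move=> f h s bf bh; rewrite !(innerC g) -(linear_form_inner bg)//.
by apply: eq_Rintegral => x _; rewrite (projV_lin s x Jj)//; ring.
Qed.

Lemma bilinear_formC B : bilinear_form B -> bilinear_form (fun f g => B g f).
Proof. by case. Qed.

Definition cross_form j1 j2 n (p q : X -> R) : R :=
  inner p (fun x => kap j1 x * projV W j2 q x) +
  inner q (fun x => kap j2 x * projV W j1 p x) +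
  (n%:R - 2) * ipV W (minn j1 j2) p q.

Definition quad_scale (n : nat) : R := 1 - n%:R^-1.
Definition cross_scale (n : nat) : R := n%:R^-1 ^+ 2 * (n%:R - 1).

Definition cross_product_form j1 j2 n (g : X -> R) : R :=
  n%:R^-1 ^+ 2 * (inner g (fun x => kap j1 x * kap j2 x) +
    (n%:R - 1) * inner g (kap (minn j1 j2))).

(** The errors of the estimators have means [bias p q + product g], where [p], [q] are
    the regressions and [g] is the conditional mean of the product. *)
Definition bias_INT j1 j2 n p q : R :=
  inner p q + - quad_scale n * ipV W (minn j1 j2) p q.
Definition product_INT j1 j2 n g : R := - n%:R^-1 * inner g (kap (minn j1 j2)).

Definition bias_MC j1 j2 n p q : R :=
  inner p q + - cross_scale n * cross_form j1 j2 n p q.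
Definition product_MC j1 j2 n g : R := - 1 * cross_product_form j1 j2 n g.

Definition bias_IF j1 j2 n p q : R :=
  inner p q + - quad_scale n * (ipV W j1 p q + ipV W j2 p q) +
  cross_scale n * cross_form j1 j2 n p q.
Definition product_IF j1 j2 n g : R :=
  - n%:R^-1 * (inner g (kap j1) + inner g (kap j2)) + cross_product_form j1 j2 n g.

Section levels.
Variables j1 j2 : nat.
Hypotheses (J1 : (J0 <= j1)%N) (J2 : (J0 <= j2)%N).
Let Jm : (J0 <= minn j1 j2)%N. Proof. by rewrite leq_min J1. Qed.

Lemma bilinear_cross_form n : bilinear_form (cross_form j1 j2 n).
Proof.
apply: bilinear_formD; last by apply: bilinear_formZ; exact: bilinear_ipV.
apply: bilinear_formD; first exact: bilinear_kernel_proj.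
by have /bilinear_formC := bilinear_kernel_proj J2 J1.
Qed.

Lemma bilinear_bias_INT n : bilinear_form (bias_INT j1 j2 n).
Proof.
apply: bilinear_formD; first exact: bilinear_inner.
by apply: bilinear_formZ; exact: bilinear_ipV.
Qed.

Lemma bilinear_bias_MC n : bilinear_form (bias_MC j1 j2 n).
Proof.
apply: bilinear_formD; first exact: bilinear_inner.
by apply: bilinear_formZ; exact: bilinear_cross_form.
Qed.

Lemma bilinear_bias_IF n : bilinear_form (bias_IF j1 j2 n).
Proof.
apply: bilinear_formD; last by apply: bilinear_formZ; exact: bilinear_cross_form.
apply: bilinear_formD; first exact: bilinear_inner.
by apply: bilinear_formZ; apply: bilinear_formD; exact: bilinear_ipV.
Qed.

Let bk j : (J0 <= j)%N -> bmeas (kap j). Proof. exact: bmeas_kernel_diag. Qed.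

Lemma linear_cross_product n : linear_form (cross_product_form j1 j2 n).
Proof.
apply: linear_formZ; apply: linear_formD; last apply: linear_formZ;
  apply: linear_form_inner; [apply: bmeasM|]; exact: bk.
Qed.

Lemma linear_product_INT n : linear_form (product_INT j1 j2 n).
Proof. by apply: linear_formZ; apply: linear_form_inner; exact: bk. Qed.

Lemma linear_product_MC n : linear_form (product_MC j1 j2 n).
Proof. by apply: linear_formZ; exact: linear_cross_product. Qed.

Lemma linear_product_IF n : linear_form (product_IF j1 j2 n).
Proof.
apply: linear_formD; last exact: linear_cross_product.
by apply: linear_formZ; apply: linear_formD; apply: linear_form_inner; exact: bk.
Qed.

Lemma Rint_sqr_dev_ge {disp} {T : measurableType disp} (P : probability T R)
    (f : T -> R) (c e : R) : bmeas f -> \int[P]_x f x - c = e ->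
  e ^+ 2 <= \int[P]_x ((f x - c) ^+ 2).
Proof.
move=> bf <-; rewrite -[c in leLHS](Rint_cst P) -RintB//; last exact: bc.
exact: (Rint_sqr_ge P (bmeasB bf (bc c))).
Qed.

Section law.
Variables (P : probability obs R) (p q g : X -> R) (n : nat).
Hypothesis n0 : (0 < n)%N.
Hypothesis mP : in_model W C1 C2 a b M P.
Hypothesis reg : regressions W C1 C2 a b M P p q.
Hypothesis gE : forall h, bmeas h -> \int[P]_z (UV z * h (obsX z)) = inner g h.

Let C12 : C1 <= C2. Proof. by have [] := model_regressions HW d0 mP. Qed.
Let PX : forall B, measurable B -> P (@obsX R d @^-1` B) = unif B.
Proof. by have [_ []] := model_regressions HW d0 mP. Qed.
Let bU : bmeas U. Proof. exact: (bmeas_clamp C12 measurable_obsA). Qed.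
Let bV : bmeas V. Proof. exact: (bmeas_clamp C12 measurable_obsY). Qed.
Let bUV : bmeas UV. Proof. exact: bmeasM. Qed.

Lemma mean_emp_product : \int[iid P n]_D emp UV D - psi P = inner p q.
Proof.
rewrite (psiE HW d0 mP reg) RintZl ?Rint_tsum//; last exact: bmeas_tsum.
by rewrite mulrA mulVf ?mul1r ?pnatr_eq0 -?lt0n//; ring.
Qed.

Lemma mean_emp_quad j : (J0 <= j)%N -> \int[iid P n]_D emp_quad W j U V D =
  n%:R^-1 * inner g (kap j) + quad_scale n * ipV W j p q.
Proof.
move=> Jj; rewrite (Rint_emp_quad HW)//; congr (_ * _ + _ * _).
  by rewrite -gE//; exact: bk.
by apply: eq_bigr => m _; have [-> ->] := coef_regression HW m Jj reg.
Qed.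

Lemma mean_emp_cross : \int[iid P n]_D emp_cross W j1 j2 U V D =
  cross_product_form j1 j2 n g + cross_scale n * cross_form j1 j2 n p q.
Proof.
have [[bp bq _ _] [_ _ Up Vq]] := reg.
have [e1 _] := proj_coef_regression HW J1 reg; have [_ e2] := proj_coef_regression HW J2 reg.
rewrite (Rint_emp_cross HW PX)// e1 e2 (inner_projV_min HW)//.
have -> : \int[P]_o (UV o * (kap j1 (obsX o) * kap j2 (obsX o))) =
    inner g (fun x => kap j1 x * kap j2 x).
  by rewrite -gE//; apply: bmeasM; exact: bk.
have -> : \int[P]_o (UV o * kap (minn j1 j2) (obsX o)) = inner g (kap (minn j1 j2)).
  by rewrite -gE//; exact: bk.
have -> : \int[P]_o (U o * kap j1 (obsX o) * projV W j2 q (obsX o)) =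
    inner p (fun x => kap j1 x * projV W j2 q x).
  rewrite -Up; first by apply: eq_Rintegral => o _; rewrite mulrA.
  by apply: bmeasM; [exact: bk|exact: (bmeas_projV HW)].
have -> : \int[P]_o (V o * kap j2 (obsX o) * projV W j1 p (obsX o)) =
    inner q (fun x => kap j2 x * projV W j1 p x).
  rewrite -Vq; first by apply: eq_Rintegral => o _; rewrite mulrA.
  by apply: bmeasM; [exact: bk|exact: (bmeas_projV HW)].
by rewrite /cross_product_form /cross_scale /cross_form; ring.
Qed.

Lemma bias_INT_le : (((bias_INT j1 j2 n p q + product_INT j1 j2 n g) ^+ 2)%:E <=
  \int[iid P n]_D ((psi_INT W j1 j2 D - psi P) ^+ 2)%:E)%E.
Proof.
rewrite (risk_INT_bounded HW C12 _ _ J1 J2 mP) lee_fin.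
have b1 := @bmeas_empUV R d C1 C2 C12 n; have b2 := bmeas_quadUV HW C12 n Jm.
apply: Rint_sqr_dev_ge; first exact: bmeasB.
rewrite RintB// mean_emp_quad// addrAC mean_emp_product /bias_INT /product_INT; ring.
Qed.

Lemma bias_MC_le : (((bias_MC j1 j2 n p q + product_MC j1 j2 n g) ^+ 2)%:E <=
  \int[iid P n]_D ((psi_MC W j1 j2 D - psi P) ^+ 2)%:E)%E.
Proof.
rewrite (risk_MC_bounded HW C12 _ _ J1 J2 mP) lee_fin.
have b1 := @bmeas_empUV R d C1 C2 C12 n; have b2 := bmeas_crossUV HW C12 n J1 J2.
apply: Rint_sqr_dev_ge; first exact: bmeasB.
rewrite RintB// mean_emp_cross// addrAC mean_emp_product /bias_MC /product_MC; ring.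
Qed.

Lemma bias_IF_le : (((bias_IF j1 j2 n p q + product_IF j1 j2 n g) ^+ 2)%:E <=
  \int[iid P n]_D ((psi_IF W j1 j2 D - psi P) ^+ 2)%:E)%E.
Proof.
rewrite (risk_IF_bounded HW C12 _ _ J1 J2 mP) lee_fin.
have b1 := @bmeas_empUV R d C1 C2 C12 n; have b2 := bmeas_crossUV HW C12 n J1 J2.
have q1 := bmeas_quadUV HW C12 n J1; have q2 := bmeas_quadUV HW C12 n J2.
have b3 := bmeasB b1 q2; have b4 := bmeasB b3 q1.
apply: Rint_sqr_dev_ge; first exact: bmeasD.
rewrite RintD// (RintB _ b3 q1) (RintB _ b1 q2) !mean_emp_quad// mean_emp_cross//.
rewrite (_ : \int[iid P n]_D emp UV D = inner p q + psi P).
  by rewrite /bias_IF /product_IF; ring.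
by rewrite -mean_emp_product subrK.
Qed.

End law.
End levels.
End bias_forms.

(** * Perturbations that reveal the bias *)

Lemma alternating_ge {R : realType} (x : \bar R) (e1 e2 e3 e4 B : R) :
  ((e1 ^+ 2)%:E <= x)%E -> ((e2 ^+ 2)%:E <= x)%E -> ((e3 ^+ 2)%:E <= x)%E ->
  ((e4 ^+ 2)%:E <= x)%E -> e1 - e2 - e3 + e4 = 4 * B -> ((B ^+ 2)%:E <= x)%E.
Proof.
case: x => [r| |] //=; last by move=> *; rewrite leey.
rewrite !lee_fin => h1 h2 h3 h4 e.
have : (4 * B) ^+ 2 <= 4 * (e1 ^+ 2 + e2 ^+ 2 + e3 ^+ 2 + e4 ^+ 2).
  rewrite -e; have := sqr_ge0 (e1 + e2); have := sqr_ge0 (e1 + e3).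
  have := sqr_ge0 (e1 - e4); have := sqr_ge0 (e2 - e3); have := sqr_ge0 (e2 + e4).
  have := sqr_ge0 (e3 + e4); nra.
by rewrite exprMn; lra.
Qed.

Lemma sqr_le_ereal {R : realType} (x : \bar R) (s t : R) : 0 <= s -> s <= `|t| ->
  ((t ^+ 2)%:E <= x)%E -> ((s ^+ 2)%:E <= x)%E.
Proof.
move=> s0 st; apply: le_trans; rewrite lee_fin -(real_normK (num_real t)).
by rewrite lerXn2r// nnegrE.
Qed.

Section lower_bounds.
Context {R : realType} {d : nat}.
Local Notation obs := (d.-tuple R * R * R)%type.
Local Notation X := (d.-tuple R).
Variable W : wavelets R d.
Hypothesis HW : cdv_basis W.
Hypothesis d0 : (0 < d)%N.
Local Notation J0 := (base_level W).
Local Notation K j := (resolution d j)%:R.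
Local Notation bc := bmeas_cst.
Variables (C1 C2 a b M : R).
Hypotheses (a0 : 0 < a) (b0 : 0 < b).
Local Notation UV := (fun z : obs => clamp C1 C2 (obsA z) * clamp C1 C2 (obsY z)).
Local Notation kap j := (fun x : X => proj_kernel W j x x).
Local Notation rate j := (2 `^ (- (j%:R * (a + b)))).
Local Notation risk est := (max_risk W C1 C2 a b M est).

Lemma smallZ eta r s u : 0 < eta -> `|s| <= 1 -> small W eta r u ->
  small W eta r (fun x => s * u x).
Proof.
move=> e0 s1 [bu uu us hu]; split.
- exact: (bmeasM (bc s) bu).
- exact: unif_continuousZ.
- by move=> x; rewrite normrM -[eta]mul1r ler_pM.
- have := holder_norm_comb HW d0 s 0 bu bu hu hu.
  under eq_fun do rewrite mul0r addr0.
  by move=> h; apply: le_trans h _; rewrite lee_fin normr0 mul0r addr0 ler_piMl// ltW.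
Qed.

Definition mean_error (est : @estimator R d) (j1 j2 n : nat)
    (B : (X -> R) -> (X -> R) -> R) (L : (X -> R) -> R) :=
  [/\ bilinear_form B, linear_form L & forall P p q g, in_model W C1 C2 a b M P ->
    regressions W C1 C2 a b M P p q ->
    (forall h, bmeas h -> \int[P]_z (UV z * h (obsX z)) = inner g h) ->
    (((B p q + L g) ^+ 2)%:E <= \int[iid P n]_D ((est j1 j2 n D - psi P) ^+ 2)%:E)%E].

(** Of four laws with regressions moved by [+-u] and [+-v], at least one has a
    bias as large as the interaction [B u v], because the alternating sum of
    their biases is [4 B u v]. *)
Lemma interaction_le_max_risk : nondegenerate_class W C1 C2 a b M ->
  exists2 eta : R, 0 < eta & forall est B L j1 j2 n,
    mean_error est (j1 n) (j2 n) n B L ->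
    (forall u v, small W eta a u -> small W eta b v ->
      ((B u v ^+ 2)%:E <= risk est j1 j2 n)%E) /\
    (((eta * L (fun=> 1%R)) ^+ 2)%:E <= risk est j1 j2 n)%E.
Proof.
move=> /(perturbed_laws HW d0)[p0 [q0 [g [eta [bp bq bg eta0 H]]]]].
exists eta => // est B L j1 j2 n [[Bl Br] lL err].
have main u v s t c : small W eta a u -> small W eta b v -> `|s| <= 1 -> `|t| <= 1 ->
    `|c| <= eta ->
    (((B p0 q0 + s * B u q0 + t * B p0 v + s * t * B u v +
      (L g + C1 * s * L u + C1 * t * L v + c * L (fun=> 1%R))) ^+ 2)%:E
      <= risk est j1 j2 n)%E.
  move=> su sv s1 t1 ce.
  have [P [mP reg gE]] := H _ _ c (smallZ eta0 s1 su) (smallZ eta0 t1 sv) ce.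
  have bu : bmeas u by have [] := su. 
  have bv : bmeas v by have [] := sv.
  apply: le_trans (_ : _ <= \int[iid P n]_D ((est (j1 n) (j2 n) n D - psi P) ^+ 2)%:E)%E _;
    last by apply: ereal_sup_ubound; exists P.
  apply: le_trans (err P _ _ _ mP reg gE); rewrite lee_fin le_eqVlt; apply/orP; left; apply/eqP.
  congr (_ ^+ 2); have bqv : bmeas (fun x => q0 x + t * v x).
    exact: (bmeasD bq (bmeasM (bc t) bv)).
  rewrite (Bl _ bqv p0 u s bp bu) (Br _ bp q0 v t bq bv) (Br _ bu q0 v t bq bv).
  rewrite (_ : (fun x => g x + C1 * (s * u x + t * v x) + c) =
    (fun x => (g x + (C1 * s) * u x + (C1 * t) * v x) + c * 1)); last first.
    by apply/funext => x; ring.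
  have b1 : bmeas (fun x => g x + C1 * s * u x).
    exact: (bmeasD bg (bmeasM (bc _) bu)).
  have b2 : bmeas (fun x => g x + C1 * s * u x + C1 * t * v x).
    exact: (bmeasD b1 (bmeasM (bc _) bv)).
  rewrite (lL _ _ c b2 (bc 1)) (lL _ _ (C1 * t) b1 bv) (lL _ _ (C1 * s) bg bu); ring.
have n1 : `|- 1| <= 1 :> R by rewrite normrN1.
have p1 : `|1| <= 1 :> R by rewrite normr1.
split=> [u v su sv|].
  have z0 : `|0 : R| <= eta by rewrite normr0 ltW.
  apply: (alternating_ge (main u v 1 1 0 su sv p1 p1 z0) (main u v (-1) 1 0 su sv n1 p1 z0)
    (main u v 1 (-1) 0 su sv p1 n1 z0) (main u v (-1) (-1) 0 su sv n1 n1 z0)).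
  by ring.
have z1 : `|0 : R| <= 1 :> R by rewrite normr0.
have e1 : `|eta| <= eta by rewrite gtr0_norm.
have e2 : `|- eta| <= eta by rewrite normrN gtr0_norm.
have s0 r : small W eta r (fun=> 0).
  split; first exact: bc; first exact: unif_continuous_cst.
    by move=> x /=; rewrite normr0 ltW.
  have [N N0 /(_ 0)] := holder_norm_cst HW d0 r.
  by rewrite normr0 mul0r => h; rewrite (le_trans h)// lee_fin ltW.
have m1 := main _ _ 0 0 eta (s0 a) (s0 b) z1 z1 e1.
have m2 := main _ _ 0 0 (- eta) (s0 a) (s0 b) z1 z1 e2.
apply: (alternating_ge m1 m2 m2 m1); ring.
Qed.

Section waves.
Variables (iota : wtype d) (l : nat).
Hypothesis Jl : (J0 <= l)%N.

Definition wave_coef (s : R) (p : wtype d * loc W l) : R := if p.1 == iota then s else 0.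

(** The sum of all wavelets of one type at one level, orthogonal to the scaling
    spaces up to that level; for a suitable [s] it is as large as the Hoelder norm
    allows. *)
Definition wave (s : R) (x : X) : R := \sum_p wave_coef s p * Psi_pair p x.

Lemma bmeas_wave s : bmeas (wave s).
Proof. by apply: bmeas_lin => p; exact: bmeas_Psi. Qed.

Lemma inner_wave_Psi s (p : wtype d * loc W l) : inner (wave s) (Psi_pair p) = wave_coef s p.
Proof.
apply: (inner_lin_ortho (u := @Psi_pair _ _ W l)) => [q|q q'].
  exact: bmeas_Psi.
exact: cdv_Psi_orthonormal.
Qed.

Lemma inner_wave s t : inner (wave s) (wave t) = s * t * #|loc W l|%:R.
Proof.
rewrite innerC {1}/wave inner_suml; last 2 first.
- by move=> p; exact: bmeas_Psi.
- exact: bmeas_wave.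
under eq_bigr do rewrite innerC inner_wave_Psi.
rewrite -(pair_bigA _ (fun i m => wave_coef t (i, m) * wave_coef s (i, m)))/=.
rewrite (bigD1 iota)//= [X in _ + X]big1 ?addr0; last first.
  by move=> i ii; apply: big1 => m _; rewrite /wave_coef/= (negbTE ii) mul0r.
by rewrite /wave_coef/= eqxx sumr_const mulr_natr (mulrC t).
Qed.

Lemma inner_wave_Phi j (m : loc W j) s : (J0 <= j)%N -> (j <= l)%N ->
  inner (wave s) (Phi m) = 0.
Proof.
move=> Jj jl; have bm := bmeas_Phi HW m Jj.
rewrite inner_suml//; last by move=> p; exact: bmeas_Psi.
by rewrite big1// => p _; rewrite innerC (Phi_Psi_ortho HW)// mulr0.
Qed.

Lemma projV_wave_ge j s : (J0 <= j)%N -> (j <= l)%N -> projV W j (wave s) = fun=> 0.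
Proof.
move=> Jj jl; apply/funext => x; rewrite /projV big1// => m _.
by rewrite inner_wave_Phi// mul0r.
Qed.

Lemma ipV_wave j s t : (J0 <= j)%N -> (j <= l)%N -> ipV W j (wave s) (wave t) = 0.
Proof. by move=> Jj jl; rewrite /ipV big1// => m _; rewrite inner_wave_Phi// mul0r. Qed.

Lemma projV_wave_lt j s : (l < j)%N -> projV W j (wave s) = wave s.
Proof.
move=> lj; have Jj : (J0 <= j)%N by rewrite (leq_trans Jl)// ltnW.
apply/funext => x; rewrite projVE//; last exact: bmeas_wave.
rewrite {1}/wave inner_suml; last 2 first.
- by move=> p; exact: bmeas_Psi.
- exact: bmeas_kernel.
apply: eq_bigr => p _; rewrite -(projVE HW)//; last exact: bmeas_Psi.
by rewrite (projV_Psi_lt HW).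
Qed.

Lemma waveZ s x : wave s x = s * wave 1 x.
Proof.
rewrite /wave mulr_sumr; apply: eq_bigr => p _; rewrite /wave_coef.
by case: ifP; rewrite ?mul0r ?mulr0// mul1r.
Qed.

(** At level [l] the amplitude [2^(-l(r+d/2))] is what the norm of order [r]
    allows; the sum is then at most of order [2^(-lr)], as overlaps are bounded. *)
Lemma small_wave C eta r :
  @frame_bounds R d J0 (fun l => (wtype d * loc W l)%type) (@Psi_pair _ _ W) C ->
  0 < r -> 0 < eta ->
  small W eta r (wave (eta / C ^+ 2 * 2 `^ (- (l%:R * (r + d%:R / 2))))).
Proof.
move=> CPsi r0 eta0; have C1' : 1 <= C by have [] := CPsi.
set w := 2 `^ _; set s := _ * w.
have w0 : 0 < w by rewrite powR_gt0.
have CC : 1 <= C ^+ 2 by rewrite exprn_ege1.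
have CC0 : 0 < C ^+ 2 by exact: lt_le_trans CC.
have ee0 : 0 < eta / C ^+ 2 by exact: divr_gt0.
have ee : eta / C ^+ 2 <= eta by rewrite ler_pdivrMr// ler_peMr// ltW.
have s0 : 0 <= s by rewrite mulr_ge0// ltW.
have cs p : `|wave_coef s p| <= s.
  by rewrite /wave_coef; case: ifP; rewrite ?normr0// ger0_norm.
split.
- exact: bmeas_wave.
- apply: unif_continuous_sum => p; apply: unif_continuousZ.
  have S0 : (0 < regularity W)%N by have /andP[] := cdv_regularity HW.
  exact: (local_regular_unif_continuous p S0 (cdv_Psi_regular HW) Jl).
- move=> x; apply: le_trans (ler_norm_sum _ _ _) _.
  apply: le_trans (frame_sum_le CPsi x Jl s0 cs) _.
  rewrite (_ : s * C ^+ 2 * _ = eta * 2 `^ (- (l%:R * r))).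
    by rewrite ler_piMr ?(ltW eta0)// -[leRHS](powRr0 (2 : R)) ler_powR ?ler1n// oppr_le0 mulr_ge0// ltW.
  rewrite /s /w [_ * C ^+ 2]mulrAC divfK ?gt_eqF// -mulrA -powRD; last by rewrite pnatr_eq0 implybT.
  by congr (_ * _ `^ _); ring.
- apply/(holder_normP HW d0); exists 0, eta; split; last by rewrite add0r.
  split => //; first exact: ltW.
    by move=> m; rewrite inner_wave_Phi// normr0 mulr0.
  move=> l' p' Jl'; have [ll|ll] := eqVneq l l'; last first.
    rewrite inner_suml; [|by move=> p; exact: bmeas_Psi|exact: bmeas_Psi].
    rewrite big1 ?normr0 ?mulr0 ?ltW// => p _.
    by rewrite (inner_Psi_Psi HW)// mulr0.
  case: _ / ll p' {Jl'} => p'; rewrite inner_wave_Psi.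
  apply: le_trans (ler_wpM2l (powR_ge0 _ _) (cs p')) _.
  rewrite /s mulrCA /w powRN mulfV ?mulr1// gt_eqF// powR_gt0//.
Qed.

End waves.

Lemma kernel_diag_ge0 j x : 0 <= proj_kernel W j x x.
Proof. by apply: sumr_ge0 => m _; rewrite -expr2 sqr_ge0. Qed.

Lemma Rint_kernel_diag j : (J0 <= j)%N -> inner (fun=> 1) (kap j) = #|loc W j|%:R.
Proof.
move=> Jj; rewrite innerC /proj_kernel.
transitivity (\int[unif]_x \sum_(m : loc W j) Phi m x * Phi m x).
  by apply: eq_Rintegral => x _; rewrite mulr1.
rewrite Rint_sum; last by move=> m; apply: bmeasM; exact: bmeas_Phi.
rewrite -sumr_const; apply: eq_bigr => m _.
by rewrite -[LHS]/(inner (Phi m) (Phi m)) (cdv_Phi_orthonormal HW)// eqxx.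
Qed.

End lower_bounds.

(** * Lower bounds on the maximal risk *)

Section explicit_lower_bounds.
Context {R : realType} {d : nat}.
Local Notation obs := (d.-tuple R * R * R)%type.
Local Notation X := (d.-tuple R).
Variable W : wavelets R d.
Hypothesis HW : cdv_basis W.
Hypothesis d0 : (0 < d)%N.
Local Notation J0 := (base_level W).
Local Notation K j := (resolution d j)%:R.
Local Notation bc := bmeas_cst.
Variables (C1 C2 a b M : R).
Hypotheses (a0 : 0 < a) (b0 : 0 < b).
Local Notation kap j := (fun x : X => proj_kernel W j x x).
Local Notation rate j := (2 `^ (- (j%:R * (a + b)))).
Local Notation risk est := (max_risk W C1 C2 a b M est).
Local Notation Z j := (#|loc W j|%:R).
Local Notation wv iota l eta C r :=
  (wave W iota l (eta / C ^+ 2 * 2 `^ (- (l%:R * (r + d%:R / 2))))).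

Lemma rate_itv j : 0 <= rate j <= 1.
Proof.
rewrite powR_ge0 -[leRHS](powRr0 (2 : R)) ler_powR ?ler1n//.
by rewrite oppr_le0 mulr_ge0// addr_ge0// ltW.
Qed.

(** There are about [2^(ld)] orthonormal terms, with coefficients multiplying to
    [2^(-l(a+b+d))]. *)
Lemma inner_wave_ge iota l (C c eta : R) : (J0 <= l)%N -> 0 < c ->
  c^-1 * K l <= Z l :> R -> 0 < eta ->
  (eta / C ^+ 2) ^+ 2 * c^-1 * rate l <= inner (wv iota l eta C a) (wv iota l eta C b).
Proof.
move=> Jl c0 cZ eta0; rewrite inner_wave//.
set e := eta / C ^+ 2; set s := 2 `^ (- (_ * (a + d%:R / 2))).
set t := 2 `^ (- (_ * (b + _))).
have st0 : 0 <= e * s * (e * t).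
  rewrite mulrACA mulr_ge0 -?expr2 ?sqr_ge0// mulr_ge0 ?powR_ge0//.
apply: le_trans _ (ler_wpM2l st0 cZ); rewrite le_eqVlt; apply/orP; left; apply/eqP.
have -> : (K l : R) = 2 `^ (l%:R * d%:R).
  by rewrite -pow2_level -powR_mulrn ?powR_ge0// -powRrM; congr (_ `^ _); field.
rewrite (_ : rate l = s * t * 2 `^ (l%:R * d%:R)); first by ring.
rewrite /s /t -!powRD; try by rewrite pnatr_eq0 implybT.
by congr (_ `^ _); field.
Qed.

(** The diagonal of the quadratic statistic has mean [<g, kernel>/n], which shifts
    by the number of basis functions over [n] when [g] is shifted; waves at the
    level of the projection are invisible to the statistic but not to [psi]. *)
Lemma lower_INT : nondegenerate_class W C1 C2 a b M -> exists2 c : R, 0 < c &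
  forall j1 j2 n, (0 < n)%N -> (J0 <= j1 n)%N -> (J0 <= j2 n)%N ->
  (((c * (K (minn (j1 n) (j2 n)) / n%:R)) ^+ 2)%:E <= risk (psi_INT W) j1 j2 n)%E /\
  (((c * rate (minn (j1 n) (j2 n))) ^+ 2)%:E <= risk (psi_INT W) j1 j2 n)%E.
Proof.
move=> /(interaction_le_max_risk HW d0)[eta eta0 H].
have [C [_ CPsi]] := cdv_frames HW; have [c c0 Hc] := cdv_card HW.
have [iota _] := wtype_inhabited d0.
have C0 : 0 < C by apply: lt_le_trans ltr01 _; have [] := CPsi.
have c1 : 0 < eta * c^-1 by rewrite mulr_gt0 ?invr_gt0.
have c2 : 0 < (eta / C ^+ 2) ^+ 2 * c^-1.
  by rewrite mulr_gt0 ?invr_gt0// exprn_gt0// divr_gt0// exprn_gt0.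
exists (Num.min (eta * c^-1) ((eta / C ^+ 2) ^+ 2 * c^-1)).
  by rewrite lt_min c1.
move=> j1 j2 n n0 J1 J2; set l := minn _ _.
have Jl : (J0 <= l)%N by rewrite leq_min J1.
have /andP[cZ _] := Hc l Jl.
have err : mean_error W C1 C2 a b M (psi_INT W) (j1 n) (j2 n) n
    (bias_INT W (j1 n) (j2 n) n) (product_INT W (j1 n) (j2 n) n).
  split; [exact: bilinear_bias_INT|exact: linear_product_INT|].
  by move=> P p q g mP reg gE; apply: (bias_INT_le HW d0 J1 J2 n0 mP reg gE).
have [Huv H1] := H _ _ _ _ _ _ err; split.
- apply: sqr_le_ereal H1; first by rewrite !mulr_ge0 ?invr_ge0// le_min !ltW.
  rewrite /product_INT Rint_kernel_diag// mulNr mulrN normrN.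
  rewrite ger0_norm ?mulr_ge0 ?invr_ge0 ?(ltW eta0)//.
  apply: (@le_trans _ _ (eta * c^-1 * (K l / n%:R))).
    by rewrite ler_wpM2r ?divr_ge0// ge_min lexx.
  rewrite -mulrA ler_wpM2l ?(ltW eta0)// mulrA mulrC ler_wpM2l ?invr_ge0//.
- have := Huv _ _ (small_wave HW d0 iota Jl CPsi a0 eta0) (small_wave HW d0 iota Jl CPsi b0 eta0).
  apply: sqr_le_ereal.
    by rewrite mulr_ge0 ?powR_ge0// le_min !ltW.
  rewrite /bias_INT ipV_wave// mulr0 addr0; apply: le_trans _ (ler_norm _).
  apply: le_trans _ (inner_wave_ge iota C Jl c0 cZ eta0).
  by rewrite ler_wpM2r ?powR_ge0// ge_min lexx orbT.
Qed.

(** The kernel of the coarser space is the only one that survives here, since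
    the projection to that space annihilates the waves. *)
Lemma cross_wave_le iota C s t j1 j2 n :
  frame_bounds J0 (@Phi _ _ W) C -> (J0 <= j1)%N -> (J0 <= j2)%N ->
  0 <= s -> 0 <= t -> let l := minn j1 j2 in
  cross_form W j1 j2 n (wave W iota l s) (wave W iota l t) <=
  C ^+ 3 * K l * inner (wave W iota l s) (wave W iota l t).
Proof.
move=> CPhi J1 J2 s0 t0 /=; set l := minn j1 j2; have Jl : (J0 <= l)%N by rewrite leq_min J1.
set u := wave W iota l s; set v := wave W iota l t.
have C0 : 0 <= C by apply: le_trans ler01 _; have [] := CPhi.
have uv0 : 0 <= inner u v by rewrite inner_wave// mulr_ge0// mulr_ge0.
have k0 : 0 <= C ^+ 3 * K l * inner u v by rewrite !mulr_ge0// exprn_ge0.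
have bu : bmeas u by exact: bmeas_wave.
have bv : bmeas v by exact: bmeas_wave.
have main i (f g : X -> R) : (J0 <= i)%N -> (forall x, 0 <= f x * g x) ->
    bmeas f -> bmeas g ->
    inner f (fun x => kap i x * g x) <= C ^+ 3 * K i * inner f g.
  move=> Ji fg bf bg; rewrite /inner -RintZl; last exact: bmeasM.
  apply: le_Rint => [||x].
  - by apply: bmeasM => //; apply: bmeasM => //; exact: bmeas_kernel_diag.
  - by apply: (bmeasM (bc _)); exact: bmeasM.
  - rewrite mulrCA ler_wpM2r// (le_trans (ler_norm _))//.
    exact: proj_kernel_le.
have uvx x : 0 <= u x * v x.
  by rewrite /u /v waveZ (waveZ W iota l t) mulrACA;
    apply: mulr_ge0; [exact: mulr_ge0|rewrite -expr2 sqr_ge0].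
have vux x : 0 <= v x * u x by rewrite mulrC.
rewrite /cross_form -/l ipV_wave// mulr0 addr0.
have [j12|j21|e12] := ltngtP j1 j2.
- have e : l = j1 by rewrite /l (minn_idPl (ltnW j12)).
  rewrite (projV_wave_lt HW) ?e// (projV_wave_ge HW) ?e// inner_mulr0 addr0.
  by rewrite -e; exact: main.
- have e : l = j2 by rewrite /l (minn_idPr (ltnW j21)).
  rewrite (projV_wave_ge HW) ?e// (projV_wave_lt HW) ?e// inner_mulr0 add0r.
  by rewrite -e (innerC u v); exact: main.
- have e : l = j2 by rewrite /l e12 minnn.
  by rewrite e12 !(projV_wave_ge HW) ?e// !inner_mulr0 addr0 -e.
Qed.

(** The diagonal terms also act on the waves, reducing their effect by a relative
    amount [K/n]. If that is not small, the bound coming from shifting [g] is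
    already of order one. *)
Lemma lower_MC : nondegenerate_class W C1 C2 a b M -> exists2 c : R, 0 < c &
  forall j1 j2 n, (1 < n)%N -> (J0 <= j1 n)%N -> (J0 <= j2 n)%N ->
  (((c * (K (minn (j1 n) (j2 n)) / n%:R)) ^+ 2)%:E <= risk (psi_MC W) j1 j2 n)%E /\
  (((c * rate (minn (j1 n) (j2 n))) ^+ 2)%:E <= risk (psi_MC W) j1 j2 n)%E.
Proof.
move=> /(interaction_le_max_risk HW d0)[eta eta0 H].
have [C [CPhi CPsi]] := cdv_frames HW; have [c c0 Hc] := cdv_card HW.
have [iota _] := wtype_inhabited d0.
have C0 : 0 < C by apply: lt_le_trans ltr01 _; have [] := CPsi.
pose c1 := eta * c^-1 / 2; pose c2 := (eta / C ^+ 2) ^+ 2 * c^-1 / 2.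
pose c3 := c1 / (2 * C ^+ 3).
have c10 : 0 < c1 by rewrite /c1 !mulr_gt0 ?invr_gt0.
have c20 : 0 < c2.
  by rewrite /c2 divr_gt0// mulr_gt0 ?invr_gt0// exprn_gt0// divr_gt0// exprn_gt0.
have C30 : 0 < 2 * C ^+ 3 by rewrite mulr_gt0// exprn_gt0.
have c30 : 0 < c3 by exact: divr_gt0.
exists (Num.min c1 (Num.min c2 c3)); first by rewrite !lt_min c10 c20.
set cc := Num.min _ _.
have cc0 : 0 <= cc by rewrite ltW// !lt_min c10 c20.
have cc1 : cc <= c1 by rewrite ge_min lexx.
have cc2 : cc <= c2 by rewrite !ge_min lexx orbT.
have cc3 : cc <= c3 by rewrite !ge_min lexx !orbT.
move=> j1 j2 n n1 J1 J2; set l := minn _ _; have n0 := ltnW n1.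
have Jl : (J0 <= l)%N by rewrite leq_min J1.
have /andP[cZ _] := Hc l Jl.
have nn0 : 0 < n%:R :> R by rewrite ltr0n.
have nn2 : 2 <= n%:R :> R by rewrite ler_nat.
have err : mean_error W C1 C2 a b M (psi_MC W) (j1 n) (j2 n) n
    (bias_MC W (j1 n) (j2 n) n) (product_MC W (j1 n) (j2 n) n).
  split; [exact: bilinear_bias_MC|exact: linear_product_MC|].
  by move=> P p q g mP reg gE; apply: (bias_MC_le HW d0 J1 J2 n0 mP reg gE).
have [Huv H1] := H _ _ _ _ _ _ err.
have Hk (s : R) : 0 <= s -> s <= c1 * (K l / n%:R) ->
    ((s ^+ 2)%:E <= risk (psi_MC W) j1 j2 n)%E.
  move=> s0 sc; apply: sqr_le_ereal H1 => //; apply: le_trans sc _.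
  rewrite /product_MC /cross_product_form Rint_kernel_diag// mulN1r mulrN normrN.
  have i0 : 0 <= inner (fun=> 1) (fun x => kap (j1 n) x * kap (j2 n) x).
    by apply: Rint_ge0 => x; rewrite mul1r mulr_ge0// kernel_diag_ge0.
  apply: le_trans _ (ler_norm _).
  apply: (@le_trans _ _ (eta * (n%:R^-1 ^+ 2 * ((n%:R - 1) * Z l)))); last first.
    by rewrite ler_wpM2l ?(ltW eta0)// ler_wpM2l ?sqr_ge0// lerDr.
  apply: (@le_trans _ _ (eta * (n%:R^-1 ^+ 2 * (n%:R / 2 * (c^-1 * K l))))).
    by rewrite le_eqVlt; apply/orP; left; apply/eqP; rewrite /c1; field; rewrite !gt_eqF.
  rewrite ler_wpM2l ?(ltW eta0)// ler_wpM2l ?sqr_ge0// ler_pM ?divr_ge0 ?mulr_ge0 ?invr_ge0 ?(ltW c0)//.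
  lra.
split.
  by apply: Hk; rewrite ?mulr_ge0 ?invr_ge0// ler_wpM2r ?divr_ge0.
have /andP[r0 r1] := rate_itv l.
(* [c3] is the value of the first bound when [C^3 K/n] equals one half *)
have [small_k|large_k] := leP (C ^+ 3 * (K l / n%:R)) (2^-1).
  have := Huv _ _ (small_wave HW d0 iota Jl CPsi a0 eta0) (small_wave HW d0 iota Jl CPsi b0 eta0).
  apply: sqr_le_ereal; first exact: mulr_ge0.
  apply: le_trans _ (ler_norm _); rewrite /bias_MC.
  set u := wave _ _ _ _; set v := wave _ _ _ (_ * 2 `^ (- (_ * (b + _)))).
  have ge0 r : 0 <= eta / C ^+ 2 * 2 `^ (- (l%:R * (r + d%:R / 2))).
    by rewrite mulr_ge0 ?powR_ge0// divr_ge0 ?exprn_ge0// ltW.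
  have hx : cross_form W (j1 n) (j2 n) n u v <= C ^+ 3 * K l * inner u v.
    exact: (cross_wave_le iota n CPhi J1 J2 (ge0 a) (ge0 b)).
  have hI : (eta / C ^+ 2) ^+ 2 * c^-1 * rate l <= inner u v.
    exact: (inner_wave_ge iota C Jl c0 cZ eta0).
  have hcs : cross_scale n <= n%:R^-1 :> R.
    rewrite /cross_scale expr2 -mulrA ler_piMr ?invr_ge0// mulrC ler_pdivrMr// mul1r.
    by rewrite gerBl.
  have hcs0 : 0 <= cross_scale n :> R by rewrite mulr_ge0 ?sqr_ge0// subr_ge0 ler1n.
  have I0 : 0 <= inner u v.
    apply: le_trans hI; rewrite mulr_ge0// mulr_ge0 ?sqr_ge0// invr_ge0 ltW//.
  have h1 : cross_scale n * cross_form W (j1 n) (j2 n) n u v <= inner u v / 2.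
    apply: le_trans (ler_wpM2l hcs0 hx) _.
    apply: (@le_trans _ _ (n%:R^-1 * (C ^+ 3 * K l * inner u v))).
      rewrite ler_wpM2r//; apply: mulr_ge0 I0; apply: mulr_ge0 => //.
      by rewrite exprn_ge0// ltW.
    rewrite [leLHS](_ : _ = C ^+ 3 * (K l / n%:R) * inner u v); last by ring.
    by rewrite mulrC ler_wpM2l.
  have h2 : cc * rate l <= inner u v / 2.
    apply: (@le_trans _ _ (c2 * rate l)); first by rewrite ler_wpM2r.
    by rewrite /c2 mulrAC ler_pM2r.
  by rewrite mulNr; lra.
apply: Hk; first exact: mulr_ge0.
apply: (@le_trans _ _ c3); first by rewrite (le_trans (ler_wpM2r r0 cc3))// ler_piMr// ltW.
rewrite /c3 ler_wpM2l ?(ltW c10)// -[leLHS]div1r ler_pdivrMr//.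
rewrite (_ : _ * (2 * _) = 2 * (C ^+ 3 * (K l / n%:R))); last by ring.
by rewrite -ler_pdivrMl// mulr1 ltW.
Qed.

(** Used for the bias of [IF] under constant perturbations: on the cube every
    projection fixes constants, so that the kernel diagonal integrates to the
    dimension of the space. *)
Lemma cst_wavelet_projection e : exists G : R, 0 <= G <= 1 /\
  forall i j, (J0 <= i)%N -> (J0 <= j)%N ->
    ipV W j (fun=> e) (fun=> e) = e ^+ 2 * G /\
    inner (fun=> e) (fun x => kap i x * projV W j (fun=> e) x) = e ^+ 2 * Z i.
Proof.
have [w [bw Vw] [w1 w0]] := unit_in_Vspace HW.
have w01 x : 0 <= w x <= 1.
  by have [cx|cx] := pselect (cube x); [rewrite w1// ler01 lexx|rewrite w0// lexx ler01].
exists (\int[unif]_x w x); split.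
  apply/andP; split; first by apply: Rint_ge0 => x; have /andP[] := w01 x.
  by apply: Rint_le => // x; have /andP[] := w01 x.
move=> i j Ji Jj.
have wV : projV W J0 w = w.
  apply/esym; apply: lin_spanE Vw => [m|m m']; first exact: bmeas_Phi.
  exact: cdv_Phi_orthonormal.
have pV x : projV W j (fun=> e) x = e * w x.
  transitivity (e * projV W j w x); last by rewrite -{1}wV projV_id// wV.
  rewrite /projV mulr_sumr; apply: eq_bigr => m _.
  rewrite mulrA; congr (_ * _).
  have bm := bmeas_Phi HW m Jj; rewrite -(innerZl e bw bm); apply: eq_Rintegral => y _.
  have [cy|cy] := pselect (cube y); first by rewrite w1// mulr1.
  by rewrite (Phi_off_cube HW)// !mulr0.
split.
  rewrite -(inner_projV HW)//; last exact: bc.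
  rewrite -[in RHS]RintZl//; apply: eq_Rintegral => x _.
  by rewrite pV; ring.
rewrite -(Rint_kernel_diag HW)// -[in RHS]RintZl; last first.
  by apply: (bmeasM (bc 1)); exact: bmeas_kernel_diag.
apply: eq_Rintegral => x _; rewrite pV mul1r.
have [cx|cx] := pselect (cube x); first by rewrite w1//; ring.
rewrite w0// (_ : kap i x = 0) ?mulr0//.
by rewrite /proj_kernel big1// => m _; rewrite (Phi_off_cube HW)// mul0r.
Qed.

End explicit_lower_bounds.

Section lower_bound_IF.
Context {R : realType} {d : nat}.
Local Notation obs := (d.-tuple R * R * R)%type.
Local Notation X := (d.-tuple R).
Variable W : wavelets R d.
Hypothesis HW : cdv_basis W.
Hypothesis d0 : (0 < d)%N.
Local Notation J0 := (base_level W).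
Local Notation K j := (resolution d j)%:R.
Local Notation bc := bmeas_cst.
Variables (C1 C2 a b M : R).
Hypotheses (a0 : 0 < a) (b0 : 0 < b).
Local Notation rate j := (2 `^ (- (j%:R * (a + b)))).
Local Notation risk est := (max_risk W C1 C2 a b M est).
Local Notation Z j := (#|loc W j|%:R).

Lemma small_cst eta : 0 < eta -> exists2 e : R, 0 < e &
  small W eta a (fun=> e) /\ small W eta b (fun=> e).
Proof.
move=> eta0; have [Na Na0 HNa] := holder_norm_cst HW d0 a.
have [Nb Nb0 HNb] := holder_norm_cst HW d0 b.
have N0 : 0 < Na + Nb + 1 by rewrite ltr_wpDl// addr_ge0.
have e0 : 0 < eta / (Na + Nb + 1) by exact: divr_gt0.
have le_eta N : N <= Na + Nb + 1 -> `|eta / (Na + Nb + 1)| * N <= eta.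
  by move=> h; rewrite gtr0_norm// mulrAC ler_pdivrMr// ler_pM2l.
exists (eta / (Na + Nb + 1)) => //.
have e1 : `|eta / (Na + Nb + 1)| <= eta.
  by rewrite -[leLHS]mulr1; apply: le_eta; lra.
split; split => //; try exact: bc; try exact: unif_continuous_cst.
- by apply: le_trans (HNa _) _; rewrite lee_fin; apply: le_eta; lra.
- by apply: le_trans (HNb _) _; rewrite lee_fin; apply: le_eta; lra.
Qed.

(** Value of the bilinear form of the bias at the constant function one:
    [z1] and [z2] are the dimensions of the two spaces, [G] is the mass of the cube. *)
Lemma bias_IF_arith (N G z1 z2 z : R) : 2 <= N -> 0 <= G <= 1 -> 1 <= z1 -> 1 <= z2 ->
  z = z1 \/ z = z2 ->
  z / (2 * N) <= 1 + - (1 - N^-1) * (G + G) +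
    N^-1 ^+ 2 * (N - 1) * (z1 + z2 + (N - 2) * G).
Proof.
move=> N2 /andP[G0 G1] h1 h2 hz; have N0 : 0 < N by lra.
rewrite -subr_ge0 (_ : _ - _ = ((N - 1) * (z1 + z2) - (N - 2) - z * N / 2 +
  (1 - G) * (N ^+ 2 + N - 2)) / N ^+ 2); last by field; rewrite gt_eqF.
rewrite divr_ge0 ?sqr_ge0// addr_ge0//; last first.
  by rewrite mulr_ge0 ?subr_ge0//; have := sqr_ge0 N; nra.
by case: hz => ->; nra.
Qed.

(** When the coarser resolution is of order [n], the effect of shifting [g] may be
    compensated by the triple coincidences of the cross statistic; the diagonal
    bias is reached through constant [u] and [v] instead. Waves at the finer level
    are invisible to all three statistics. *)
Lemma lower_IF : nondegenerate_class W C1 C2 a b M -> exists2 c : R, 0 < c &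
  forall j1 j2 n, (1 < n)%N -> (J0 <= j1 n)%N -> (J0 <= j2 n)%N ->
  (((c * (K (maxn (j1 n) (j2 n)) / n%:R)) ^+ 2)%:E <= risk (psi_IF W) j1 j2 n)%E /\
  (((c * rate (maxn (j1 n) (j2 n))) ^+ 2)%:E <= risk (psi_IF W) j1 j2 n)%E.
Proof.
move=> /(interaction_le_max_risk HW d0)[eta eta0 H].
have [C [_ CPsi]] := cdv_frames HW; have [c c0 Hc] := cdv_card HW.
have [iota _] := wtype_inhabited d0.
have C0 : 0 < C by apply: lt_le_trans ltr01 _; have [] := CPsi.
have [e e0 [sa sb]] := small_cst eta0.
have [G [G01 HG]] := cst_wavelet_projection HW e.
pose c1 := e ^+ 2 * c^-1 / 2; pose c2 := (eta / C ^+ 2) ^+ 2 * c^-1.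
have c10 : 0 < c1 by rewrite /c1 divr_gt0// mulr_gt0 ?invr_gt0// exprn_gt0.
have c20 : 0 < c2.
  by rewrite /c2 mulr_gt0 ?invr_gt0// exprn_gt0// divr_gt0// exprn_gt0.
exists (Num.min c1 c2); first by rewrite lt_min c10.
set cc := Num.min _ _.
have cc0 : 0 <= cc by rewrite ltW// lt_min c10.
have cc1 : cc <= c1 by rewrite ge_min lexx.
have cc2 : cc <= c2 by rewrite ge_min lexx orbT.
move=> j1 j2 n n1 J1 J2; set l := maxn _ _; have n0 := ltnW n1.
have Jl : (J0 <= l)%N by rewrite leq_max J1.
have Jm : (J0 <= minn (j1 n) (j2 n))%N by rewrite leq_min J1.
have jl1 : (j1 n <= l)%N by rewrite leq_maxl.
have jl2 : (j2 n <= l)%N by rewrite leq_maxr.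
have jlm : (minn (j1 n) (j2 n) <= l)%N by rewrite (leq_trans _ jl1)// geq_minl.
have /andP[cZ _] := Hc l Jl.
have err : mean_error W C1 C2 a b M (psi_IF W) (j1 n) (j2 n) n
    (bias_IF W (j1 n) (j2 n) n) (product_IF W (j1 n) (j2 n) n).
  split; [exact: bilinear_bias_IF|exact: linear_product_IF|].
  by move=> P p q g mP reg gE; apply: (bias_IF_le HW d0 J1 J2 n0 mP reg gE).
have [Huv _] := H _ _ _ _ _ _ err; split.
- have := Huv _ _ sa sb; apply: sqr_le_ereal.
    by rewrite mulr_ge0// divr_ge0.
  apply: le_trans _ (ler_norm _).
  have Z1 j : (J0 <= j)%N -> 1 <= Z j :> R.
    move=> Jj; have [m _] := loc_inhabited HW Jj; rewrite ler1n.
    by apply/card_gt0P; exists m.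
  have zE : (Z l : R) = Z (j1 n) \/ (Z l : R) = Z (j2 n).
    by rewrite /l; case: (leqP (j1 n) (j2 n)) => _; [right|left].
  have nn2 : 2 <= n%:R :> R by rewrite ler_nat.
  have nn0 : 0 < n%:R :> R by rewrite ltr0n.
  have := bias_IF_arith nn2 G01 (Z1 _ J1) (Z1 _ J2) zE.
  have [I1 X1] := HG (j1 n) (j2 n) J1 J2; have [I2 X2] := HG (j2 n) (j1 n) J2 J1.
  have [_] := HG _ _ J1 Jm; have [Im _] := HG _ _ Jm Jm => _.
  have [I1' _] := HG _ _ J1 J1.
  rewrite /bias_IF /cross_form X1 X2 Im I1 I2 /quad_scale /cross_scale.
  rewrite -/(inner (fun=> e) (fun=> e)) (_ : inner (fun=> e) (fun=> e) = e ^+ 2); last first.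
    by rewrite /inner Rint_cst expr2.
  move=> /(ler_wpM2l (sqr_ge0 e)) h; apply: (@le_trans _ _ _ _ _ (le_trans _ h)).
    apply: (@le_trans _ _ (c1 * (K l / n%:R))); first by rewrite ler_wpM2r// divr_ge0.
    rewrite (_ : c1 * _ = (e ^+ 2) * ((c^-1 * K l) / (2 * n%:R))).
      by rewrite ler_wpM2l ?sqr_ge0// ler_wpM2r// invr_ge0 mulr_ge0.
    by rewrite /c1; field; rewrite !gt_eqF.
  by rewrite le_eqVlt; apply/orP; left; apply/eqP; ring.
- have := Huv _ _ (small_wave HW d0 iota Jl CPsi a0 eta0) (small_wave HW d0 iota Jl CPsi b0 eta0).
  apply: sqr_le_ereal.
    by rewrite mulr_ge0 ?powR_ge0.
  rewrite /bias_IF /cross_form !(ipV_wave HW) ?(projV_wave_ge HW)//.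
  rewrite !inner_mulr0 !(addr0, mulr0); apply: le_trans _ (ler_norm _).
  apply: le_trans _ (inner_wave_ge HW a b iota C Jl c0 cZ eta0).
  by rewrite ler_wpM2r ?powR_ge0.
Qed.

End lower_bound_IF.

(** * Comparison with powers of the sample size *)

Section asymptotic_comparison.
Context {R : realType}.
Implicit Types (u v w : nat -> R) (e f : R).

Definition pw e (n : nat) : R := n%:R `^ e.

Lemma rlesssimP u v : rlesssim u v <-> exists2 C : R, 0 < C &
  exists n0 : nat, forall n, (n0 <= n)%N -> u n <= C * v n.
Proof.
by split=> -[C C0 [n0 H]]; exists C => //; exists n0 => n nn; have := H n nn;
  rewrite /= -?EFinM lee_fin.
Qed.

Lemma rlesssim_trans v u w : rlesssim u v -> rlesssim v w -> rlesssim u w.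
Proof.
move=> /rlesssimP[C C0 [n0 H]] /rlesssimP[C' C'0 [n1 H']]; apply/rlesssimP.
exists (C * C'); first exact: mulr_gt0.
exists (maxn n0 n1) => n; rewrite geq_max => /andP[h0 h1].
by rewrite (le_trans (H n h0))// -mulrA ler_wpM2l ?(ltW C0)// H'.
Qed.

Lemma rlesssimD u v w : rlesssim u w -> rlesssim v w -> rlesssim (fun n => u n + v n) w.
Proof.
move=> /rlesssimP[C C0 [n0 H]] /rlesssimP[C' C'0 [n1 H']]; apply/rlesssimP.
exists (C + C'); first exact: addr_gt0.
exists (maxn n0 n1) => n; rewrite geq_max => /andP[h0 h1].
by rewrite mulrDl lerD// ?H ?H'.
Qed.

Lemma rlesssim_sqr u v : (forall n, 0 <= u n) -> rlesssim u v ->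
  rlesssim (fun n => u n ^+ 2) (fun n => v n ^+ 2).
Proof.
move=> u0 /rlesssimP[C C0 [n0 H]]; apply/rlesssimP; exists (C ^+ 2); first exact: exprn_gt0.
exists n0 => n nn; rewrite -exprMn; apply: sqr_le_of_norm.
by rewrite ger0_norm// H.
Qed.

(** The eventual inequality needs only be checked at positive indices, where
    powers of the index multiply. *)
Lemma le_rlesssim u v : (forall n, (0 < n)%N -> u n <= v n) -> rlesssim u v.
Proof.
move=> H; apply/rlesssimP; exists 1 => //; exists 1%N => n nn.
by rewrite mul1r H.
Qed.

Lemma pw_gt0 e n : (0 < n)%N -> 0 < pw e n.
Proof. by move=> n0; rewrite powR_gt0// ltr0n. Qed.

Lemma pwD e f n : (0 < n)%N -> pw (e + f) n = pw e n * pw f n.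
Proof. by move=> n0; rewrite /pw powRD// pnatr_eq0 -lt0n n0 implybT. Qed.

Lemma pwV n : pw (-1) n = n%:R^-1.
Proof. by rewrite /pw powRN powRr1. Qed.

Lemma ler_pw e f n : (0 < n)%N -> e <= f -> pw e n <= pw f n.
Proof. by move=> n0 ef; rewrite ler_powR// ler1n. Qed.

Lemma pw_sqr e n : pw e n ^+ 2 = pw (2 * e) n.
Proof. by rewrite /pw -powR_mulrn ?powR_ge0// -powRrM mulrC. Qed.

Lemma powR_rlesssim u v e : (forall n, 0 < u n) -> (forall n, (0 < n)%N -> 0 < v n) ->
  0 <= e -> rlesssim v u ->
  rlesssim (fun n => u n `^ (- e)) (fun n => v n `^ (- e)).
Proof.
move=> u0 v0 e0 /rlesssimP[C C0 [n0 H]]; apply/rlesssimP.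
exists (C `^ e); first exact: powR_gt0.
exists (maxn n0 1) => n; rewrite geq_max => /andP[nn n1].
have vn := v0 n n1.
rewrite !powRN ler_pdivlMr ?powR_gt0// ler_pdivrMl ?powR_gt0//.
rewrite mulrC -powRM ?(ltW C0) ?(ltW (u0 n))//.
by rewrite ge0_ler_powR// ?nnegrE ?mulr_ge0 ?(ltW C0) ?(ltW (u0 n)) ?(ltW vn)// H.
Qed.

(** A power of the index beats every constant. *)
Lemma pw_not_rlesssim e f : e < f -> ~ rlesssim (pw f) (pw e).
Proof.
move=> ef /rlesssimP[C C0 [n0 H]].
have g0 : 0 < f - e by rewrite subr_gt0.
(* beyond [x] the power of exponent [f - e] exceeds [C] *)
pose x : R := (C + 1) `^ (f - e)^-1.
pose n := maxn n0 (Num.truncn x).+1.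
have n1 : (0 < n)%N by rewrite leq_max orbT.
have xn : x <= n%:R.
  apply: (@le_trans _ _ (Num.truncn x).+1%:R); last by rewrite ler_nat leq_maxr.
  exact/ltW/truncnS_gt.
have : pw (f - e) n <= C.
  have := H n (leq_maxl _ _); rewrite -{1}(subrK e f) (pwD (f - e))// ler_pM2r//.
  exact: pw_gt0.
apply/negP; rewrite -ltNge (lt_le_trans (_ : _ < C + 1)) ?ltrDl//.
rewrite (_ : C + 1 = x `^ (f - e)); last first.
  by rewrite /x -powRrM mulVf ?gt_eqF// powRr1// addr_ge0 ?(ltW C0).
by rewrite ge0_ler_powR ?(ltW g0)// nnegrE ?powR_ge0.
Qed.

(** Resolutions are powers of [2^d], hence dense enough to match any increasing
    power of [n] up to a constant. *)
Lemma exists_level d J0 e : (0 < d)%N -> 0 < e ->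
  exists2 j : nat -> nat, (forall n, (J0 <= j n)%N) &
    rasymp (fun n => (resolution d (j n))%:R) (pw (d%:R * e)).
Proof.
move=> d0 e0; pose t n := pw e n; pose j0 n := trunc_log 2 (Num.truncn (t n)).
exists (fun n => (J0 + j0 n)%N) => [n|]; first exact: leq_addr.
have t1 n : (0 < n)%N -> 1 <= t n.
  by move=> n0; rewrite -[leLHS](powRr0 (n%:R : R)) ler_powR ?ler1n// ltW.
have jt n : (0 < n)%N -> 2 ^+ j0 n <= t n /\ t n <= 2 * 2 ^+ j0 n.
  move=> n0; have m0 : (0 < Num.truncn (t n))%N by rewrite truncn_gt0 t1.
  have /andP[h1 h2] := trunc_log_bounds (isT : (1 < 2)%N) m0.
  have t0 : 0 <= t n by exact: le_trans (t1 n n0).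
  have /andP[h3 h4] := truncn_itv t0; split.
    by rewrite (le_trans _ h3)// -natrX ler_nat.
  by rewrite -exprS (le_trans (ltW h4))// -natrX ler_nat.
have rE n : (resolution d (J0 + j0 n))%:R = (2 ^+ J0) ^+ d * (2 ^+ j0 n) ^+ d :> R.
  by rewrite /resolution natrX -exprM -exprM -exprD -mulnDl.
have pE n : pw (d%:R * e) n = t n ^+ d.
  by rewrite /t /pw -powR_mulrn ?powR_ge0// -powRrM mulrC.
split; apply/rlesssimP.
  exists ((2 ^+ J0) ^+ d); first by rewrite !exprn_gt0.
  exists 1%N => n n1; rewrite rE pE ler_wpM2l ?exprn_ge0 ?exprn_ge0//.
  by have [h _] := jt n n1; rewrite lerXn2r// ?nnegrE ?exprn_ge0// (le_trans _ h)// exprn_ge0.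
exists (2 ^+ d); first by rewrite exprn_gt0.
exists 1%N => n n1; rewrite rE pE; have [_ h] := jt n n1.
apply: (@le_trans _ _ (2 ^+ d * (2 ^+ j0 n) ^+ d)).
  rewrite -exprMn lerXn2r// ?nnegrE ?mulr_ge0 ?exprn_ge0//.
  by rewrite (le_trans _ (t1 n n1)).
rewrite ler_wpM2l ?exprn_ge0// ler_peMl ?exprn_ge0// ?exprn_ge0//.
by rewrite exprn_ege1// exprn_ege1// ler1n.
Qed.

End asymptotic_comparison.

(** * Rates *)

Section rates.
Context {R : realType} {d : nat}.
Local Notation obs := (d.-tuple R * R * R)%type.
Variable W : wavelets R d.
Hypothesis HW : cdv_basis W.
Hypothesis d0 : (0 < d)%N.
Local Notation J0 := (base_level W).
Local Notation K j := (resolution d j)%:R.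
Variables (C1 C2 a b M : R).
Hypotheses (a0 : 0 < a) (b0 : 0 < b).
Local Notation rate j := (2 `^ (- (j%:R * (a + b)))).
Local Notation risk est := (max_risk W C1 C2 a b M est).
Local Notation s := (a + b).
Local Notation dR := (d%:R : R).

Let s0 : 0 < s. Proof. exact: addr_gt0. Qed.
Let dR0 : 0 < dR. Proof. by rewrite ltr0n. Qed.
Let sd0 : 0 < s + dR. Proof. exact: addr_gt0. Qed.

Lemma resolution_gt0 j : 0 < K j :> R.
Proof. by rewrite ltr0n expn_gt0. Qed.

Lemma ler_resolution i j : (i <= j)%N -> K i <= K j :> R.
Proof. by move=> ij; rewrite ler_nat leq_exp2l// leq_mul2r ij orbT. Qed.

Lemma k_minE j1 j2 : k_min R d j1 j2 = fun n => K (minn (j1 n) (j2 n)).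
Proof.
apply/funext => n; rewrite /k_min; case/orP: (leq_total (j1 n) (j2 n)) => h.
  by rewrite !(minn_idPl _)// leq_exp2l// leq_mul2r h orbT.
by rewrite !(minn_idPr _)// leq_exp2l// leq_mul2r h orbT.
Qed.

Lemma k_maxE j1 j2 : k_max R d j1 j2 = fun n => K (maxn (j1 n) (j2 n)).
Proof.
apply/funext => n; rewrite /k_max; case/orP: (leq_total (j1 n) (j2 n)) => h.
  by rewrite !(maxn_idPr _)// leq_exp2l// leq_mul2r h orbT.
by rewrite !(maxn_idPl _)// leq_exp2l// leq_mul2r h orbT.
Qed.

Lemma rateE j : rate j = K j `^ (- (s / dR)).
Proof.
rewrite -pow2_level -powR_mulrn ?powR_ge0// -!powRrM; congr (_ `^ _).
by field; rewrite gt_eqF.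
Qed.

Lemma variance_rlesssim (k : nat -> R) e : (forall n, 0 <= k n) -> rlesssim k (pw e) ->
  rlesssim (fun n => (k n / n%:R) ^+ 2) (pw (2 * e - 2)).
Proof.
move=> k0 /rlesssimP[C C0 [n0 H]].
rewrite (_ : pw _ = fun n => pw (e - 1) n ^+ 2); last first.
  by apply/funext => n; rewrite pw_sqr; congr pw; ring.
apply: rlesssim_sqr => [n|]; first by rewrite divr_ge0.
apply/rlesssimP; exists C => //; exists (maxn n0 1) => n; rewrite geq_max => /andP[nn n1].
by rewrite pwD// pwV mulrA ler_wpM2r ?invr_ge0// H.
Qed.

(** The rate is at most one, so squaring it only makes it smaller. *)
Lemma quartic_rlesssim (x : nat -> R) f : f <= 0 ->
  rlesssim (fun n => x n ^+ 2) (pw f) -> rlesssim (fun n => x n ^+ 4) (pw f).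
Proof.
move=> f0 H; apply: (@rlesssim_trans _ (fun n => pw f n ^+ 2)).
  have := rlesssim_sqr (fun n => sqr_ge0 (x n)) H.
  by under eq_fun do rewrite -exprM.
apply: le_rlesssim => n n0; rewrite pw_sqr ler_pw//; lra.
Qed.

Lemma bias_rlesssim (j : nat -> nat) e : rlesssim (pw e) (fun n => K (j n)) ->
  rlesssim (fun n => rate (j n) ^+ 2) (pw (- (2 * e * s / dR))).
Proof.
move=> H.
rewrite (_ : pw _ = fun n => (pw e n `^ (- (s / dR))) ^+ 2); last first.
  apply/funext => n; rewrite -powR_mulrn ?powR_ge0// /pw -!powRrM; congr (_ `^ _).
  by field; rewrite gt_eqF.
under eq_fun do rewrite rateE.
apply: rlesssim_sqr => [n|]; first exact: powR_ge0.
apply: powR_rlesssim => [n|n n1||//]; [exact: resolution_gt0|exact: pw_gt0|].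
by rewrite divr_ge0 ?ltW.
Qed.

Lemma achieves_of_bound (est : @estimator R d) j1 j2 (bnd : nat -> R) f :
  (exists K1, 0 <= K1 /\ forall n P, (0 < n)%N -> in_model W C1 C2 a b M P ->
    (\int[iid P n]_D ((est (j1 n) (j2 n) n D - psi P) ^+ 2)%:E <= (K1 * bnd n)%:E)%E) ->
  rlesssim bnd (pw f) -> achieves W C1 C2 a b M est (pw f) j1 j2.
Proof.
move=> [K1 [K10 H]] /rlesssimP[C C0 [n0 Hb]].
exists (K1 * C + 1); first by rewrite ltr_wpDl// mulr_ge0// ltW.
exists (maxn n0 1) => n; rewrite geq_max => /andP[nn n1].
apply: ge_ereal_sup => _ [P mP <-]; apply: le_trans (H n P n1 mP) _.
rewrite /= -EFinM lee_fin.
have h := ler_wpM2l K10 (Hb n nn); have := powR_ge0 (n%:R : R) f; rewrite -/(pw f n).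
by rewrite mulrDl mul1r -mulrA; lra.
Qed.

Section upper_rates.
Variables (j1 j2 : nat -> nat) (e e' f : R).
Hypotheses (J1 : level_sequence W j1) (J2 : level_sequence W j2).
Hypotheses (f0 : f <= 0) (f1 : -1 <= f) (ef : 2 * e - 2 <= f) (e'f : - (2 * e' * s / dR) <= f).
Local Notation jm := (fun n => minn (j1 n) (j2 n)).
Local Notation jM := (fun n => maxn (j1 n) (j2 n)).

Let pw_trans u g : rlesssim u (pw g) -> g <= f -> rlesssim u (pw f).
Proof.
by move=> H gf; apply: rlesssim_trans H (le_rlesssim _) => n n0; exact: ler_pw.
Qed.

Let sampling : rlesssim (fun n => n%:R^-1) (pw f).
Proof. by apply: le_rlesssim => n n0; rewrite -pwV ler_pw. Qed.

Let variance j : rlesssim (fun n => K (j n)) (pw e) ->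
  rlesssim (fun n => (K (j n) / n%:R) ^+ 2) (pw f).
Proof. by move=> H; apply: pw_trans ef; apply: variance_rlesssim. Qed.

Let bias j : rlesssim (pw e') (fun n => K (j n)) ->
  rlesssim (fun n => rate (j n) ^+ 2) (pw f).
Proof. by move=> H; apply: pw_trans e'f; exact: bias_rlesssim. Qed.

Let coarser : rlesssim (fun n => K (jM n)) (pw e) ->
  rlesssim (fun n => K (j1 n)) (pw e) /\ rlesssim (fun n => K (j2 n)) (pw e).
Proof.
by move=> H; split; apply: rlesssim_trans H; apply: le_rlesssim => n _;
  apply: ler_resolution; rewrite ?leq_maxl ?leq_maxr.
Qed.

Lemma achieves_INT : rlesssim (fun n => K (jm n)) (pw e) ->
  rlesssim (pw e') (fun n => K (jm n)) ->
  achieves W C1 C2 a b M (psi_INT W) (pw f) j1 j2.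
Proof.
move=> H H'; have [K1 [K10 Hr]] := risk_INT_le HW d0 C1 C2 M a0 b0.
apply: (achieves_of_bound
  (bnd := fun n => n%:R^-1 + (K (jm n) / n%:R) ^+ 2 + rate (jm n) ^+ 2)).
  by exists K1; split => // n P n0 mP; apply: Hr.
apply: rlesssimD (bias H'); apply: rlesssimD sampling _.
exact: (variance H).
Qed.

Lemma sampling_variance : rlesssim (fun n => K (jM n)) (pw e) ->
  rlesssim (fun n => n%:R^-1 + ((K (j1 n) / n%:R) ^+ 2 + (K (j2 n) / n%:R) ^+ 2) +
    ((K (j1 n) / n%:R) ^+ 4 + (K (j2 n) / n%:R) ^+ 4)) (pw f).
Proof.
move=> /coarser[/variance h1 /variance h2].
apply: rlesssimD; first by apply: rlesssimD sampling _; exact: rlesssimD.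
by apply: rlesssimD; exact: quartic_rlesssim.
Qed.

Lemma achieves_MC : rlesssim (fun n => K (jM n)) (pw e) ->
  rlesssim (pw e') (fun n => K (jm n)) ->
  achieves W C1 C2 a b M (psi_MC W) (pw f) j1 j2.
Proof.
move=> H H'; have [K1 [K10 Hr]] := risk_MC_le HW d0 C1 C2 M a0 b0.
apply: (achieves_of_bound (bnd := fun n => n%:R^-1 +
    ((K (j1 n) / n%:R) ^+ 2 + (K (j2 n) / n%:R) ^+ 2) +
    ((K (j1 n) / n%:R) ^+ 4 + (K (j2 n) / n%:R) ^+ 4) + rate (jm n) ^+ 2)).
  by exists K1; split => // n P n0 mP; apply: Hr.
exact: rlesssimD (sampling_variance H) (bias H').
Qed.

Lemma achieves_IF : rlesssim (fun n => K (jM n)) (pw e) ->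
  rlesssim (pw e') (fun n => K (jM n)) ->
  achieves W C1 C2 a b M (psi_IF W) (pw f) j1 j2.
Proof.
move=> H H'; have [K1 [K10 Hr]] := risk_IF_le HW d0 C1 C2 M a0 b0.
apply: (achieves_of_bound (bnd := fun n => n%:R^-1 +
    ((K (j1 n) / n%:R) ^+ 2 + (K (j2 n) / n%:R) ^+ 2) +
    ((K (j1 n) / n%:R) ^+ 4 + (K (j2 n) / n%:R) ^+ 4) + rate (jM n) ^+ 2)).
  by exists K1; split => // n P n0 mP; apply: Hr.
exact: rlesssimD (sampling_variance H) (bias H').
Qed.

End upper_rates.

Local Notation f_star := (- ((2 * a + 2 * b) / (a + b + dR))).

(** The two lower bounds cross at the resolution [n^(d/(a+b+d))]. *)
Lemma lower_rate (r : nat -> \bar R) (j : nat -> nat) (c : R) : 0 < c ->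
  (forall n, (1 < n)%N -> (((c * (K (j n) / n%:R)) ^+ 2)%:E <= r n)%E /\
    (((c * rate (j n)) ^+ 2)%:E <= r n)%E) ->
  lesssim (EFin \o pw f_star) r.
Proof.
move=> c0 H; have c20 : 0 < c ^+ 2 by exact: exprn_gt0.
exists (c ^- 2); first by rewrite invr_gt0.
exists 2%N => n n1; have [h1 h2] := H n n1; have n0 := ltnW n1.
suff h : ((c ^+ 2 * pw f_star n)%:E <= r n)%E.
  have := lee_wpmul2l (x := (c ^- 2)%:E) _ h; rewrite lee_fin invr_ge0 ltW// => /(_ isT).
  by rewrite -EFinM mulKf// gt_eqF.
(* both bounds are of size [n^g] at the crossing point *)
set g := - (s / (s + dR)).
have fE : pw f_star n = pw g n ^+ 2 by rewrite pw_sqr; congr pw; rewrite /g; field; rewrite gt_eqF.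
have g0 : 0 <= pw g n by exact: powR_ge0.
rewrite fE -exprMn.
have mono (x : R) : pw g n <= x -> (((c * x) ^+ 2)%:E <= r n)%E ->
    (((c * pw g n) ^+ 2)%:E <= r n)%E.
  move=> gx; apply: le_trans; rewrite lee_fin lerXn2r// ?nnegrE ?mulr_ge0 ?(ltW c0)//.
    exact: le_trans gx.
  by rewrite ler_wpM2l// ltW.
have [hk|/ltW hk] := leP (pw (dR / (s + dR)) n) (K (j n)).
  apply: mono h1; rewrite (_ : g = dR / (s + dR) - 1); last first.
    by rewrite /g; field; rewrite gt_eqF.
  by rewrite pwD// pwV ler_wpM2r ?invr_ge0.
apply: mono h2; rewrite rateE.
rewrite (_ : pw g n = pw (dR / (s + dR)) n `^ (- (s / dR))); last first.
  by rewrite /pw -powRrM; congr (_ `^ _); rewrite /g; field; rewrite !gt_eqF.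
rewrite !powRN lef_pV2 ?posrE ?powR_gt0 ?resolution_gt0 ?ltr0n//.
by rewrite ge0_ler_powR ?nnegrE ?powR_ge0 ?(ltW (resolution_gt0 _))// divr_ge0 ?ltW.
Qed.

(** The exponent of the attained rate is strictly larger than the minimax one, and
    no constant compensates a power of [n]. *)
Lemma not_minimax_optimal (est : @estimator R d) j1 j2 : s / 2 < dR / 2 ->
  lesssim (EFin \o pw f_star) (risk est j1 j2) ->
  ~ minimax_rate_optimal W C1 C2 a b M est j1 j2.
Proof.
move=> sd [C C0 [n0 H]] [C' C'0 [n1 H']].
pose f := if dR / 4 <= s / 2 then - 1 else
  - ((4 * a + 4 * b) / (2 * a + 2 * b + dR)).
have mE n : @minimax_rate R d a b n = pw f n.
  by rewrite /minimax_rate /f; case: ifP => _ //; rewrite pwV.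
have f_lt : f < f_star.
  rewrite /f ltrNr; case: ifP => _; rewrite ?opprK ltr_pdivrMr//; last first.
    rewrite mulrAC ltr_pdivlMr; last by rewrite -mulrDr ltr_wpDl// mulr_ge0// ltW.
    have := mulr_gt0 s0 dR0; have := mulr_gt0 dR0 dR0; lra.
  by lra.
apply: (pw_not_rlesssim f_lt); apply/rlesssimP; exists (C * C'); first exact: mulr_gt0.
exists (maxn n0 n1) => n; rewrite geq_max => /andP[h0 h1].
rewrite -lee_fin (le_trans (H n h0))// -mulrA [in leRHS]EFinM lee_wpmul2l// ?lee_fin ?(ltW C0)//.
by rewrite EFinM -mE; exact: H'.
Qed.

End rates.

Theorem corollary10 (R : realType) (d : nat) (W : wavelets R d)
    (C1 C2 alpha beta M : R) :
  (0 < d)%N -> 0 < alpha -> 0 < beta -> 0 < M ->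
  cdv_basis W -> Num.max alpha beta < (regularity W)%:R ->
  let levels j1 j2 := level_sequence W j1 /\ level_sequence W j2 in
  let optimal := minimax_rate_optimal W C1 C2 alpha beta M in
  let k_min := k_min R d in
  let k_max := k_max R d in
  let sqrt_n := fun n : nat => Num.sqrt n%:R : R in
  let k_low := fun n : nat =>
    n%:R `^ (d%:R / (2 * alpha + 2 * beta)) : R in
  let k_star := fun n : nat => n%:R `^ (d%:R / (alpha + beta + d%:R)) : R in
  let r_star := fun n : nat =>
    n%:R `^ (- ((2 * alpha + 2 * beta) / (alpha + beta + d%:R))) : R in
  (d%:R / 2 <= (alpha + beta) / 2 ->
    [/\ (forall j1 j2, levels j1 j2 ->
           rlesssim k_low (k_min j1 j2) -> rlesssim (k_min j1 j2) sqrt_n ->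
           optimal (psi_INT W) j1 j2),
        (forall j1 j2, levels j1 j2 ->
           rlesssim k_low (k_min j1 j2) -> rlesssim (k_max j1 j2) sqrt_n ->
           optimal (psi_MC W) j1 j2) &
        (forall j1 j2, levels j1 j2 ->
           rlesssim k_low (k_max j1 j2) -> rlesssim (k_max j1 j2) sqrt_n ->
           optimal (psi_IF W) j1 j2)]) /\
  ((alpha + beta) / 2 < d%:R / 2 ->
    (nondegenerate_class W C1 C2 alpha beta M ->
      [/\ (forall j1 j2, levels j1 j2 ->
             [/\ ~ optimal (psi_INT W) j1 j2, ~ optimal (psi_MC W) j1 j2 &
                 ~ optimal (psi_IF W) j1 j2]),
          best_rate W C1 C2 alpha beta M (psi_INT W) r_star,
          best_rate W C1 C2 alpha beta M (psi_MC W) r_star &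
          best_rate W C1 C2 alpha beta M (psi_IF W) r_star]) /\
    [/\ (forall j1 j2, levels j1 j2 -> rasymp (k_min j1 j2) k_star ->
           achieves W C1 C2 alpha beta M (psi_INT W) r_star j1 j2),
        (forall j1 j2, levels j1 j2 ->
           rasymp (k_min j1 j2) (k_max j1 j2) ->
           rasymp (k_max j1 j2) k_star ->
           achieves W C1 C2 alpha beta M (psi_MC W) r_star j1 j2) &
        (forall j1 j2, levels j1 j2 -> rasymp (k_max j1 j2) k_star ->
           achieves W C1 C2 alpha beta M (psi_IF W) r_star j1 j2)]).

Proof.
move=> d0 a0 b0 M0 HW _ levels optimal kmin kmax sqrt_n k_low k_star r_star.
set s := alpha + beta; have s0 : 0 < s by exact: addr_gt0.
have dR0 : 0 < d%:R :> R by rewrite ltr0n.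
have sd0 : 0 < s + d%:R by exact: addr_gt0.
pose e0 : R := d%:R / (2 * alpha + 2 * beta); pose e1 : R := d%:R / (s + d%:R).
pose f1 : R := - ((2 * alpha + 2 * beta) / (alpha + beta + d%:R)).
have tsE : 2 * alpha + 2 * beta = 2 * s by rewrite mulrDr.
split=> [ds|sd].
  have sqrtE : sqrt_n = pw 2^-1.
    by apply/funext => n; rewrite /pw powR12_sqrt.
  have rateE : @minimax_rate R d alpha beta = pw (-1).
    apply/funext => n; rewrite /minimax_rate pwV ifT//.
    by rewrite (le_trans _ ds)// ler_pM2l// lef_pV2 ?posrE// ler_nat.
  have h1 : (-1 : R) <= 0 by lra.
  have h2 : (-1 : R) <= -1 by [].
  have h3 : 2 * 2^-1 - 2 <= -1 :> R by lra.
  have h4 : - (2 * e0 * s / d%:R) <= -1.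
    by rewrite le_eqVlt; apply/orP; left; apply/eqP; rewrite /e0 tsE; field; rewrite !gt_eqF.
  rewrite /optimal /minimax_rate_optimal rateE sqrtE.
  split=> j1 j2 [J1 J2]; rewrite /kmin /kmax ?k_minE ?k_maxE => hlow hup.
  - exact: (achieves_INT HW d0 C1 C2 M a0 b0 J1 J2 h2 h3 h4 hup hlow).
  - exact: (achieves_MC HW d0 C1 C2 M a0 b0 J1 J2 h1 h2 h3 h4 hup hlow).
  - exact: (achieves_IF HW d0 C1 C2 M a0 b0 J1 J2 h1 h2 h3 h4 hup hlow).
have h1 : f1 <= 0 by rewrite oppr_le0 divr_ge0// ltW// tsE mulr_gt0.
have h2 : -1 <= f1 by rewrite lerN2 ler_pdivrMr// mul1r; lra.
have h3 : 2 * e1 - 2 <= f1.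
  by rewrite le_eqVlt; apply/orP; left; apply/eqP; rewrite /e1 /f1 /s; field; rewrite gt_eqF.
have h4 : - (2 * e1 * s / d%:R) <= f1.
  by rewrite le_eqVlt; apply/orP; left; apply/eqP; rewrite /e1 /f1 /s; field; rewrite !gt_eqF.
have upper_INT j1 j2 : levels j1 j2 -> rasymp (kmin j1 j2) k_star ->
    achieves W C1 C2 alpha beta M (psi_INT W) r_star j1 j2.
  move=> [J1 J2]; rewrite /kmin k_minE => -[hup hlow].
  exact: (achieves_INT HW d0 C1 C2 M a0 b0 J1 J2 h2 h3 h4 hup hlow).
have upper_MC j1 j2 : levels j1 j2 -> rasymp (kmin j1 j2) (kmax j1 j2) ->
    rasymp (kmax j1 j2) k_star ->
    achieves W C1 C2 alpha beta M (psi_MC W) r_star j1 j2.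
  move=> [J1 J2]; rewrite /kmin /kmax k_minE k_maxE => -[_ mM] [hup hlow].
  exact: (achieves_MC HW d0 C1 C2 M a0 b0 J1 J2 h1 h2 h3 h4 hup (rlesssim_trans hlow mM)).
have upper_IF j1 j2 : levels j1 j2 -> rasymp (kmax j1 j2) k_star ->
    achieves W C1 C2 alpha beta M (psi_IF W) r_star j1 j2.
  move=> [J1 J2]; rewrite /kmax k_maxE => -[hup hlow].
  exact: (achieves_IF HW d0 C1 C2 M a0 b0 J1 J2 h1 h2 h3 h4 hup hlow).
split; last by split.
move=> nd.
have i0 : 0 < (s + d%:R)^-1 by rewrite invr_gt0.
have [j Jj jE] := exists_level (base_level W) d0 i0.
have jmin : rasymp (kmin j j) k_star.
  by rewrite /kmin k_minE; under eq_fun do rewrite minnn.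
have jmax : rasymp (kmax j j) k_star.
  by rewrite /kmax k_maxE; under eq_fun do rewrite maxnn.
have jmm : rasymp (kmin j j) (kmax j j).
  rewrite /kmin /kmax k_minE k_maxE; split; apply: le_rlesssim => n _;
    by rewrite minnn maxnn.
have lj : levels j j by split.
have lower_bound_INT j1 j2 : levels j1 j2 ->
    lesssim (EFin \o r_star) (max_risk W C1 C2 alpha beta M (psi_INT W) j1 j2).
  move=> [J1 J2]; have [c c0 H] := lower_INT HW d0 a0 b0 nd.
  apply: (lower_rate d0 a0 b0 (j := fun n => minn (j1 n) (j2 n)) c0) => n n1.
  by apply: H => //; exact: ltnW.
have lower_bound_MC j1 j2 : levels j1 j2 ->
    lesssim (EFin \o r_star) (max_risk W C1 C2 alpha beta M (psi_MC W) j1 j2).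
  move=> [J1 J2]; have [c c0 H] := lower_MC HW d0 a0 b0 nd.
  apply: (lower_rate d0 a0 b0 (j := fun n => minn (j1 n) (j2 n)) c0) => n n1.
  exact: H.
have lower_bound_IF j1 j2 : levels j1 j2 ->
    lesssim (EFin \o r_star) (max_risk W C1 C2 alpha beta M (psi_IF W) j1 j2).
  move=> [J1 J2]; have [c c0 H] := lower_IF HW d0 a0 b0 nd.
  apply: (lower_rate d0 a0 b0 (j := fun n => maxn (j1 n) (j2 n)) c0) => n n1.
  exact: H.
split.
- by move=> j1 j2 lv; split; apply: (not_minimax_optimal d0 a0 b0 sd);
    [exact: lower_bound_INT|exact: lower_bound_MC|exact: lower_bound_IF].
- split; last by move=> j1 j2 J1 J2; exact: lower_bound_INT.
  by exists j, j; split => //; exact: upper_INT.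
- split; last by move=> j1 j2 J1 J2; exact: lower_bound_MC.
  by exists j, j; split => //; exact: upper_MC.
- split; last by move=> j1 j2 J1 J2; exact: lower_bound_IF.
  by exists j, j; split => //; exact: upper_IF.
Qed.
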